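(* Let $T$ be a zero-mean, finite-variance, isotropic real random field on the sphere $\mathbb{S}^2\subset\mathbb{R}^3$. Let $\ell\ge 1$ be an integer and let $a_{\ell\cdot}=(a_{\ell m})_{m=-\ell,\dots,\ell}$ be the $(2\ell+1)$-dimensional real random vector of the random coefficients of the $\ell$-th component of $T$ with respect to a real orthonormal basis $(Y_{\ell m})_{m=-\ell,\dots,\ell}$ of spherical harmonics of degree $\ell$. If the random variables $a_{\ell m}$, $m=-\ell,\dots,\ell$, are exchangeable, then the law of $a_{\ell\cdot}$ is rotationally invariant (i.e. invariant under the action of $SO(2\ell+1)$ on $\mathbb{R}^{2\ell+1}$), and there exist a random vector $u_{\ell\cdot}$ uniformly distributed on the unit sphere of $\mathbb{R}^{2\ell+1}$ and a nonnegative random variable $\eta_\ell$, independent of $u_{\ell\cdot}$, such that $\mathbb{E}[\eta_\ell^2]=(2\ell+1)C_\ell$ and the following identity in distribution holds: $$a_{\ell\cdot}\ \overset{\text{law}}{=}\ \eta_\ell\, u_{\ell\cdot}.$$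
   Context: A finite-variance isotropic random field on $\mathbb{S}^2$ is a (jointly measurable) map $T:\Omega\times\mathbb{S}^2\to\mathbb{R}$, where $(\Omega,\mathcal{F},P)$ is a probability space, with $\mathbb{E}[T(x)^2]<\infty$ for every $x$, such that for every $g\in SO(3)$ the processes $(T(gx))_{x\in\mathbb{S}^2}$ and $(T(x))_{x\in\mathbb{S}^2}$ have the same law; zero-mean means $\mathbb{E}[T(x)]=0$ for every $x$. For $\ell=0,1,2,\dots$ the spherical harmonics of degree $\ell$ form the eigenspace of the Laplace–Beltrami operator of $\mathbb{S}^2$ with eigenvalue $-\ell(\ell+1)$, which has dimension $2\ell+1$; a real basis $(Y_{\ell m})_{m=-\ell,\dots,\ell}$ of it, orthonormal in $L^2(\mathbb{S}^2)$ with respect to surface measure, is fixed. The field admits the mean-square expansion $T(x)=\sum_{\ell=0}^\infty\sum_{m=-\ell}^{\ell}a_{\ell m}Y_{\ell m}(x)$ with $a_{\ell m}=\int_{\mathbb{S}^2}T(x)Y_{\ell m}(x)\,dx$; the $a_{\ell m}$ are real-valued, zero-mean and satisfy $\mathbb{E}[a_{\ell m}a_{\ell' m'}]=C_\ell\,\delta_\ell^{\ell'}\delta_m^{m'}$, which defines the angular power spectrum $C_\ell\ge 0$. A finite family of real random variables is exchangeable if its joint law is unchanged by every permutation of the variables. *)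

(* Defs.v *)
From HB Require Import structures.
From mathcomp Require Import all_boot all_order all_algebra all_fingroup.
From mathcomp Require Import all_classical all_reals all_analysis.

Set Implicit Arguments.
Unset Strict Implicit.
Unset Printing Implicit Defensive.

Import Order.TTheory GRing.Theory Num.Theory.
Import numFieldNormedType.Exports.

Local Open Scope classical_set_scope.
Local Open Scope ring_scope.

(** Points of R^n are row vectors. The norm that the library puts on 'rV[R]_n
    is the sup norm; it is used below only through the (Euclidean) topology it
    induces, for derivatives and continuity. *)

Definition rV_display : measure_display.
Proof. exact: default_measure_display. Qed.

Section measurable_rV.
Context {R : realType} (n : nat).

Let coord : 'I_n -> 'rV[R]_n -> R := fun i x => x ord0 i.

Let rV_set0 : g_sigma_preimage coord set0.
Proof. exact: sigma_algebra0. Qed.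

Let rV_setC A : g_sigma_preimage coord A -> g_sigma_preimage coord (~` A).
Proof. exact: sigma_algebraC. Qed.

Let rV_bigcup (F : (set 'rV[R]_n)^nat) :
  (forall i, g_sigma_preimage coord (F i)) ->
  g_sigma_preimage coord (\bigcup_i (F i)).
Proof. exact: sigma_algebra_bigcup. Qed.

(** The Borel sigma-algebra of R^n, generated by the coordinates. *)
HB.instance Definition _ := @isMeasurable.Build rV_display 'rV[R]_n
  (g_sigma_preimage coord) rV_set0 rV_setC rV_bigcup.

End measurable_rV.

Section euclidean.
Context {R : realType}.

Definition enorm n (x : 'rV[R]_n) : R := Num.sqrt (\sum_i x ord0 i ^+ 2).

Definition sphere n : set 'rV[R]_n := [set x | enorm x = 1].

Definition SO n : set 'M[R]_n := [set g | g *m g^T = 1%:M /\ \det g = 1].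

(** The row vector form of the matrix-vector product g x. *)
Definition rotate n (g : 'M[R]_n) (x : 'rV[R]_n) : 'rV[R]_n := x *m g^T.

(** Lebesgue measure on R^n, as an iterated product. *)
Fixpoint lebesgue_rV n : set 'rV[R]_n -> \bar R :=
  match n with
  | 0 => \d_(0 : 'rV[R]_0)
  | n'.+1 =>
      pushforward (@lebesgue_measure R \x @lebesgue_rV n')%E
        (fun z : R * 'rV[R]_n' => row_mx (z.1)%:M z.2 : 'rV[R]_n'.+1)
  end.

(** Surface measure of the unit sphere of R^n: n times the volume of the cone
    over A with apex at the origin, which is what integration in polar
    coordinates forces. It has total mass 4 pi for n = 3. *)
Definition surface_measure n (A : set 'rV[R]_n) : \bar R :=
  (n%:R%:E * lebesgue_rV
     [set x | (0 < enorm x <= 1)%R /\ A ((enorm x)^-1 *: x)])%E.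

End euclidean.

Section laplace_beltrami.
Context {R : realType}.
Implicit Types (F f : 'rV[R]_3 -> R) (x : 'rV[R]_3).

Definition partial (i : 'I_3) F : 'rV[R]_3 -> R := 'D_(delta_mx ord0 i) F.

Definition C2_on (D : set 'rV[R]_3) F := forall x, D x -> forall i j : 'I_3,
  [/\ derivable F x (delta_mx ord0 i),
      derivable (partial i F) x (delta_mx ord0 j) &
      {for x, continuous (partial j (partial i F))}].

(** A function on the 2-sphere is represented by a function on R^3 whose values
    off the sphere are irrelevant. Its extension that is homogeneous of degree
    0 gives its differential calculus: the function is C^2 on the sphere when
    the extension is C^2 away from the origin, and the Laplace-Beltrami operator
    is the restriction to the sphere of the Laplacian of the extension. *)
Definition hom0_ext f : 'rV[R]_3 -> R := fun x => f ((enorm x)^-1 *: x).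

Definition laplace_beltrami f x : R :=
  \sum_(i < 3) partial i (partial i (hom0_ext f)) x.

Definition spherical_harmonic (l : nat) f :=
  C2_on [set x | x != 0] (hom0_ext f) /\
  forall x, sphere x -> laplace_beltrami f x = - (l * l.+1)%:R * f x.

(** The order m in {-l, ..., l} is shifted to the index m + l. *)
Definition orthonormal_harmonic_basis (l : nat)
    (Y : 'I_(2 * l).+1 -> 'rV[R]_3 -> R) :=
  [/\ forall m, spherical_harmonic l (Y m),
      forall m m', (\int[@surface_measure R 3]_(x in @sphere R 3) (Y m x * Y m' x)%:E)%E =
        (m == m')%:R%:E &
      forall f, spherical_harmonic l f ->
        exists c : 'I_(2 * l).+1 -> R,
          forall x, sphere x -> f x = \sum_m c m * Y m x].

End laplace_beltrami.
Arguments orthonormal_harmonic_basis {R} l Y.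

Section laws.
Context {R : realType}.

Definition same_law d1 d2 d (T1 : measurableType d1) (T2 : measurableType d2)
    (E : measurableType d) (P : probability T1 R) (X : T1 -> E)
    (Q : probability T2 R) (Y : T2 -> E) :=
  forall B, measurable B -> pushforward P X B = pushforward Q Y B.

(** The product sigma-algebra of R^D, on functions of which only the values on
    D are observed. *)
Definition process_measurable (I : Type) (D : set I) : set (set (I -> R)) :=
  <<s [set B | exists x (A : set R),
        [/\ D x, measurable A & B = [set f | A (f x)]]] >>.

Definition same_process_law d1 d2 (T1 : measurableType d1)
    (T2 : measurableType d2) (I : Type) (D : set I)
    (P : probability T1 R) (X : T1 -> I -> R)
    (Q : probability T2 R) (Y : T2 -> I -> R) :=
  forall B, process_measurable D B -> P (X @^-1` B) = Q (Y @^-1` B).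

Context {d} {Omega : measurableType d} (P : probability Omega R).

Definition independent d1 d2 (E1 : measurableType d1) (E2 : measurableType d2)
    (X : Omega -> E1) (Y : Omega -> E2) :=
  forall A B, measurable A -> measurable B ->
    P (X @^-1` A `&` Y @^-1` B) = (P (X @^-1` A) * P (Y @^-1` B))%E.

Definition exchangeable n (X : Omega -> 'rV[R]_n) :=
  forall s : 'S_n, same_law P (fun w => col_perm s (X w)) P X.

Definition rotationally_invariant n (X : Omega -> 'rV[R]_n) :=
  forall g, SO g -> same_law P (fun w => rotate g (X w)) P X.

Definition uniform_on_sphere n (u : Omega -> 'rV[R]_n) :=
  forall B : set 'rV[R]_n, measurable B ->
    pushforward P u B =
    (fine (surface_measure B) / fine (surface_measure (@sphere R n)))%:E.

End laws.

Section random_field.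
Context {R : realType} {d} {Omega : measurableType d}.
Context (P : probability Omega R) (T : Omega -> 'rV[R]_3 -> R).

Definition jointly_measurable :=
  measurable_fun ([set: Omega] `*` @sphere R 3)
    (fun z : Omega * 'rV[R]_3 => T z.1 z.2).

Definition finite_variance :=
  forall x, sphere x -> ('E_P[fun w => (T w x ^+ 2)%R] < +oo)%E.

Definition zero_mean := forall x, sphere x -> ('E_P[fun w => T w x] = 0)%E.

Definition isotropic := forall g, SO g ->
  same_process_law (@sphere R 3) P (fun w x => T w (rotate g x)) P T.

(** The integral is pathwise: it converges for almost every w when T is
    jointly measurable, isotropic and of finite variance. *)
Definition harmonic_coef (l : nat) (Y : 'I_(2 * l).+1 -> 'rV[R]_3 -> R)
    (w : Omega) : 'rV[R]_(2 * l).+1 :=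
  \row_m fine (\int[@surface_measure R 3]_(x in @sphere R 3)
                (T w x * Y m x)%:E)%E.

(** The number C_l such that E[a_m a_m'] is C_l if m = m', and 0 otherwise. *)
Definition angular_power (l : nat) (Y : 'I_(2 * l).+1 -> 'rV[R]_3 -> R) : R :=
  get [set C : R | forall m m',
    ('E_P[fun w => (harmonic_coef Y w ord0 m * harmonic_coef Y w ord0 m')%R]
     = (C * (m == m')%:R)%:E)%E].

End random_field.

(* Main.v *)
Require Import Defs.
From HB Require Import structures.
From mathcomp Require Import all_boot all_order all_algebra all_fingroup.
From mathcomp Require Import all_classical all_reals all_analysis.
From mathcomp Require Import measurable_realfun ring lra.

Set Implicit Arguments.
Unset Strict Implicit.
Unset Printing Implicit Defensive.

Import Order.TTheory GRing.Theory Num.Theory.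
Import numFieldNormedType.Exports.

Local Open Scope classical_set_scope.
Local Open Scope ring_scope.

(** Write [a] for the vector of the [n = 2 l + 1] coefficients. Its law is
    determined by the numbers [E cos (<xi, a> + th)] ([charfun_unique]), and the
    heart of the proof is that these numbers depend on [xi] only through its
    Euclidean norm ([coef_charfun_radial]).

    Two families of orthogonal matrices preserve the law of [a]. A rotation [g]
    of the sphere acts on the harmonics of degree [l] through an orthogonal
    matrix [D(g)], and isotropy makes the law invariant under [D(g)];
    exchangeability makes it invariant under the permutation matrices. For
    [l >= 2] neither family is transitive on the unit sphere of R^n; combined
    they are, up to closure. To see this without Lie groups, differentiate: since
    [E |a|^2 < oo], the function [xi |-> E cos (<xi, a> + th)] has a derivative,
    and one considers the space [L] of the antisymmetric matrices [A] for which
    this derivative vanishes at every [xi] in the direction [xi A], for every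
    [th].
    - [L] is a linear space stable under conjugation by all the symmetries.
    - [L] is not zero: there are infinitely many matrices [D(g)], so they
      accumulate somewhere, and a limit direction of the differences belongs to
      [L] ([exists_tangent]).
    - A nonzero space of antisymmetric matrices that is stable under the
      permutations and under some symmetry which does not preserve the line
      spanned by [(1, ..., 1)] contains all the antisymmetric matrices
      ([invariant_skew_space_full]). The reason is that under the permutations
      R^n has only two proper nonzero invariant subspaces, this line and its
      orthogonal complement ([permutation_module_full] is the part of this that
      is needed).
    Hence the derivative vanishes along great circles, and any two vectors of
    the same norm are joined by two of these ([charfun_radial]).

    Both requirements on the matrices [D(g)], that they are infinitely many and
    that some of them moves the line of [(1, ..., 1)], hold because a harmonic
    of degree [l >= 1] which takes finitely many values on the sphere is zero:
    its differential vanishes, so the eigenvalue equation makes it vanish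
    ([harmonic_finite_range]).

    The invariance under [D(g)] needs an argument, because isotropy speaks of
    the values of the field at finitely many points while [a] is an integral
    over the sphere. The integral is a mean square limit of averages of the
    integrand over finite samples of points. The points are chosen one after
    the other: each new one is at most as bad as the average over the sphere,
    which keeps the mean square of the sum of [N] deviations linear in [N]
    ([exists_sample]); one sample serves both the field and the rotated field,
    whose coefficients therefore have the same law
    ([pathwise_integral_same_cos], [rotation_charfun_invariant]).

    Once the law of [a] is known to be rotation invariant, let [u] be uniform on
    the unit sphere and independent of [a], and let [eta = |a|]. Given [a], the
    variables [<xi, |a| u>] and [<|xi| u, a>] have the same law, and averaging
    the second one over [a] first gives [<xi, a>] again ([radial_polar_law]).
    Finally the covariance matrix of [a] commutes with all orthogonal matrices,
    so it is scalar, and its trace is [E eta^2] ([radial_covariance]). *)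

(** * Measurability in R^n *)

Lemma measurable_preimage d1 d2 (T1 : measurableType d1) (T2 : measurableType d2)
    (f : T1 -> T2) (A : set T2) :
  measurable_fun setT f -> measurable A -> measurable (f @^-1` A).
Proof. by move=> mf mA; rewrite -[X in measurable X]setTI; exact: mf. Qed.

Section measurable_row_vectors.
Context {R : realType}.

Lemma measurable_coord n (i : 'I_n) :
  measurable_fun setT (fun x : 'rV[R]_n => x ord0 i).
Proof.
move=> _ B mB; rewrite setTI; apply: sub_sigma_algebra.
rewrite -bigcup_seq; exists i; first by rewrite /= mem_index_enum.
by exists B => //; rewrite setTI.
Qed.

Lemma measurable_fun_rV d (T : measurableType d) n (f : T -> 'rV[R]_n) :
  (forall i, measurable_fun setT (fun w => f w ord0 i)) -> measurable_fun setT f.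
Proof.
move=> mf; apply: measurability; first by [].
move=> _ [B + <-]; rewrite -bigcup_seq => -[i _ [C mC <-]].
rewrite !setTI; have := mf i measurableT C mC.
by rewrite setTI.
Qed.

Lemma measurable_fun_coord d (T : measurableType d) n (f : T -> 'rV[R]_n) i :
  measurable_fun setT f -> measurable_fun setT (fun w => f w ord0 i).
Proof. move=> mf; exact: (measurableT_comp (@measurable_coord n i)). Qed.

Lemma measurable_mulmx n p (g : 'M[R]_(n, p)) :
  measurable_fun setT (fun x : 'rV[R]_n => x *m g).
Proof.
apply: measurable_fun_rV => j.
under eq_fun do rewrite mxE.
apply: measurable_sum => k.
apply: measurable_funM => //; exact: measurable_coord.
Qed.

Lemma measurable_addrV d (T : measurableType d) n (f g : T -> 'rV[R]_n) :
  measurable_fun setT f -> measurable_fun setT g ->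
  measurable_fun setT (fun w => f w + g w).
Proof.
move=> mf mg; apply: measurable_fun_rV => i.
under eq_fun do rewrite mxE.
by apply: measurable_funD; exact: measurable_fun_coord.
Qed.

Lemma measurable_scalerV d (T : measurableType d) n (c : T -> R)
    (f : T -> 'rV[R]_n) :
  measurable_fun setT c -> measurable_fun setT f ->
  measurable_fun setT (fun w => c w *: f w).
Proof.
move=> mc mf; apply: measurable_fun_rV => i.
under eq_fun do rewrite mxE.
by apply: measurable_funM => //; exact: measurable_fun_coord.
Qed.

Lemma row_mx_head n (t : R) (x : 'rV[R]_n) (j : 'I_1) :
  (row_mx t%:M x : 'rV[R]_n.+1) ord0 (lshift n j) = t.
Proof. by rewrite (@row_mxEl _ 1 1 n) mxE !ord1. Qed.

Lemma row_mx_tail n (t : R) (x : 'rV[R]_n) j :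
  (row_mx t%:M x : 'rV[R]_n.+1) ord0 (rshift 1 j) = x ord0 j.
Proof. by rewrite (@row_mxEr _ 1 1 n). Qed.

Lemma measurable_row_mx n :
  measurable_fun setT
    (fun z : measurableTypeR R * 'rV[R]_n =>
      row_mx (z.1 : R)%:M z.2 : 'rV[R]_n.+1).
Proof.
apply: measurable_fun_rV => i.
case: (split_ordP (i : 'I_(1 + n))) => j ->.
  apply: (eq_measurable_fun (fst : measurableTypeR R * 'rV[R]_n -> measurableTypeR R)); last exact: measurable_fst.
  by move=> z _; rewrite row_mx_head.
apply: (eq_measurable_fun (fun z : measurableTypeR R * 'rV[R]_n => z.2 ord0 j)).
  by move=> z _; rewrite row_mx_tail.
by apply: measurable_fun_coord; exact: measurable_snd.
Qed.

Lemma sumsqr_ge0 n (x : 'rV[R]_n) : 0 <= \sum_i x ord0 i ^+ 2.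
Proof. by apply: sumr_ge0 => i _; exact: sqr_ge0. Qed.

(** The square root enters through the power [2^-1], for which measurability is
    available on all of [R]. *)
Lemma measurable_enorm n : measurable_fun setT (@enorm R n).
Proof.
apply: (eq_measurable_fun (fun x : 'rV[R]_n => (\sum_i x ord0 i ^+ 2) `^ 2^-1)).
  by move=> x _; rewrite powR12_sqrt// sumsqr_ge0.
apply: (measurableT_comp (measurable_powR _)).
apply: measurable_sum => i.
by apply: measurable_funX; exact: measurable_coord.
Qed.

Lemma measurable_enormV n :
  measurable_fun setT (fun x : 'rV[R]_n => (enorm x)^-1).
Proof.
apply: (eq_measurable_fun (fun x : 'rV[R]_n => enorm x `^ (-1))).
  by move=> x _; rewrite powR_inv1// sqrtr_ge0.
by apply: (measurableT_comp (measurable_powR _)); exact: measurable_enorm.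
Qed.

Lemma measurable_sphere n : measurable (@sphere R n).
Proof.
rewrite (_ : @sphere R n = setT `&` @enorm R n @^-1` [set 1]); last first.
  by rewrite setTI.
by apply: measurable_enorm => //; exact: measurable_set1.
Qed.

End measurable_row_vectors.

(** * Lebesgue measure on R^n *)

Section lebesgue_translation.
Context {R : realType}.

Lemma lebesgue_measure_translation (t : R) (A : set R) : measurable A ->
  lebesgue_measure ((fun x => t + x) @^-1` A) = lebesgue_measure A.
Proof.
move=> mA.
have mf : measurable_fun [set: R] (fun x : R => t + x).
  by apply: measurable_funD; [exact: measurable_cst|exact: measurable_id].
apply/esym/(lebesgue_measure_unique (mu := pushforward lebesgue_measure
  ((fun x => t + x) : _ -> measurableTypeR R))) => //= _ [[a b]] _ <-.
rewrite /pushforward.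
rewrite (_ : _ @^-1` _ = `]a - t, b - t]%classic).
  rewrite !lebesgue_measure_itv/= !lte_fin ltrD2r.
  by case: ifP => // _; rewrite -!EFinB; congr (_%:E); ring.
apply/seteqP; split => x; rewrite /= !in_itv/= => /andP[h1 h2]; apply/andP; split; lra.
Qed.

Lemma lebesgue_measure_segment (a b : R) : a <= b ->
  lebesgue_measure `[a, b]%classic = (b - a)%:E.
Proof.
rewrite le_eqVlt => /predU1P[->|ab].
  by rewrite lebesgue_measure_itv/= lte_fin ltxx subrr.
by rewrite lebesgue_measure_itv/= lte_fin ab EFinB.
Qed.

End lebesgue_translation.

Section lebesgue_rV_measure.
Context {R : realType}.

Definition cube n (a b : R) : set 'rV[R]_n :=
  [set x | forall i, a <= x ord0 i <= b].
Arguments cube n a b _ : clear implicits.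

Lemma measurable_cube n (a b : R) : measurable (cube n a b).
Proof.
rewrite (_ : cube n a b =
    \bigcap_(i in [set: 'I_n]) ((fun x => x ord0 i) @^-1` `[a, b]%classic)).
  apply: fin_bigcap_measurable => // i _.
  rewrite -[X in measurable X]setTI; exact: measurable_coord.
apply/seteqP; split => x /=.
  by move=> xab i _; rewrite /= in_itv/=.
by move=> xab i; have := xab i Logic.I; rewrite /= in_itv.
Qed.

Lemma cubeS n (a b : R) :
  (fun z : measurableTypeR R * 'rV[R]_n =>
      row_mx (z.1 : R)%:M z.2 : 'rV[R]_n.+1) @^-1` cube n.+1 a b =
  `[a, b]%classic `*` cube n a b.
Proof.
apply/seteqP; split => [[t x]|[t x]] /=.
  move=> h; split.
    by have := h (lshift n (ord0 : 'I_1)); rewrite row_mx_head/= in_itv.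
  by move=> i; have := h (rshift 1 i); rewrite row_mx_tail.
move=> [/=]; rewrite in_itv/= => tab xab i.
by case: (split_ordP (i : 'I_(1 + n))) => j ->;
  rewrite (row_mx_head, row_mx_tail).
Qed.

Section sigma_finite_cube.
Variables (n : nat) (m : {measure set 'rV[R]_n -> \bar R}).
Hypothesis mE : forall a b, a <= b -> m (cube n a b) = ((b - a) ^+ n)%:E.

Let mu : set 'rV[R]_n -> \bar R := m.
HB.instance Definition _ := Measure.copy mu m.

Let mu_sigma_finite : sigma_finite setT mu.
Proof.
exists (fun k => cube n (- k%:R) k%:R).
  apply/esym; rewrite -subTset => x _.
  exists (Num.truncn (\sum_i `|x ord0 i|)).+1 => //= i.
  rewrite -ler_norml (le_trans _ (ltW (truncnS_gt _)))//.
  by rewrite (bigD1 i)//= lerDl sumr_ge0.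
move=> k; split; first exact: measurable_cube.
by rewrite [X in (X < _)%E]mE ?ltry// lerNl (le_trans _ (ler0n _ _))// oppr_le0.
Qed.

HB.instance Definition _ := Measure_isSigmaFinite.Build _ _ _ mu mu_sigma_finite.

(** A measure with the right values on the cubes is sigma-finite since the cubes
    [[-k, k]^n] exhaust the space. The statement produces a bundled measure
    because the recursion that defines Lebesgue measure on R^n needs one at
    every step. *)
Lemma sigma_finite_cube :
  exists m' : {sigma_finite_measure set 'rV[R]_n -> \bar R},
    m' = m :> (set _ -> \bar R).
Proof. by exists mu. Qed.

End sigma_finite_cube.

(** The sigma-finiteness of the product of the first [n] factors is needed to
    form the next product, so it is carried through the induction together with
    the volume of the cubes that proves it. *)
Lemma lebesgue_rV_exists n :
  exists m : {sigma_finite_measure set 'rV[R]_n -> \bar R},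
    m = @lebesgue_rV R n :> (set _ -> \bar R) /\
    forall a b, a <= b -> m (cube n a b) = ((b - a) ^+ n)%:E.
Proof.
elim: n => [|n [m [mE mcube]]].
  exists [the {sigma_finite_measure set 'rV[R]_0 -> \bar R} of
    dirac (0 : 'rV[R]_0)]; split => // a b _.
  by rewrite /= diracE mem_set ?expr0// => -[].
pose m1 := measure_function_pushforward__canonical__measure_function_Measure
  (lebesgue_measure \x m)%E (@measurable_row_mx R n).
have m1cube a b : a <= b -> m1 (cube n.+1 a b) = ((b - a) ^+ n.+1)%:E.
  move=> ab; rewrite /m1 /= /pushforward.
  rewrite cubeS product_measure1E//; last exact: measurable_cube.
  rewrite mcube// exprS EFinM; congr (_ * _)%E.
  exact: lebesgue_measure_segment.
have [m' m'E] := sigma_finite_cube m1cube.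
by exists m'; split; rewrite m'E// /= mE.
Qed.

Let leb n := projT1 (cid (lebesgue_rV_exists n)).
Let lebE n : leb n = @lebesgue_rV R n :> (set _ -> \bar R).
Proof. by rewrite /leb; case: cid => ? []. Qed.

Let leb0 n : @lebesgue_rV R n set0 = 0%E.
Proof. by rewrite -lebE measure0. Qed.
Let leb_ge0 n A : (0 <= @lebesgue_rV R n A)%E.
Proof. by rewrite -lebE. Qed.
Let leb_sigma_additive n : semi_sigma_additive (@lebesgue_rV R n).
Proof. by rewrite -lebE; exact: measure_semi_sigma_additive. Qed.
Let leb_sigma_finite n : sigma_finite setT (@lebesgue_rV R n).
Proof. by rewrite -lebE; exact: sigma_finiteT. Qed.

HB.instance Definition _ n := isMeasure.Build _ _ _ (@lebesgue_rV R n)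
  (@leb0 n) (@leb_ge0 n) (@leb_sigma_additive n).
HB.instance Definition _ n := Measure_isSigmaFinite.Build _ _ _
  (@lebesgue_rV R n) (@leb_sigma_finite n).

Lemma lebesgue_rV_cube n a b : a <= b ->
  lebesgue_rV (cube n a b) = ((b - a) ^+ n)%:E.
Proof. by move=> ab; have [m [<- ->]] := lebesgue_rV_exists n. Qed.

Lemma row_mx_addl n (v : 'rV[R]_n.+1) (t : R) (x : 'rV[R]_n) :
  v + (row_mx t%:M x : 'rV[R]_n.+1) =
  row_mx (v ord0 (lshift n (ord0 : 'I_1)) + t)%:M
         ((rsubmx (v : 'rV_(1 + n)) : 'rV[R]_n) + x).
Proof.
apply/rowP => i; rewrite mxE.
case: (split_ordP (i : 'I_(1 + n))) => j ->.
  by rewrite !row_mx_head (ord1 j).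
by rewrite !row_mx_tail mxE [in RHS]mxE.
Qed.

(** By induction on the dimension: the translated measure takes the same values
    on rectangles as the product measure, which these values determine. *)
Lemma lebesgue_rV_translation n (v : 'rV[R]_n) A : measurable A ->
  lebesgue_rV ((fun x => v + x) @^-1` A) = lebesgue_rV A.
Proof.
elim: n v A => [|n IHn] v A mA.
  rewrite (_ : (fun x => v + x) = id)//.
  by apply/funext => x; apply/rowP => -[].
pose f (z : measurableTypeR R * 'rV[R]_n) : measurableTypeR R * 'rV[R]_n :=
  ((v ord0 (lshift n (ord0 : 'I_1)) : R) + (z.1 : R),
   (rsubmx (v : 'rV_(1 + n)) : 'rV[R]_n) + z.2).
have mf : measurable_fun setT f.
  apply: measurable_fun_pair.
    by apply: (@measurable_funD _ _ R setT (cst _) fst).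
  by apply: measurable_addrV; [exact: measurable_cst|exact: measurable_snd].
pose m1 := measure_function_pushforward__canonical__measure_function_Measure
  (lebesgue_measure \x @lebesgue_rV R n)%E mf.
pose B := (fun z : measurableTypeR R * 'rV[R]_n =>
      row_mx (z.1 : R)%:M z.2 : 'rV[R]_n.+1) @^-1` A.
have mB : measurable B.
  by rewrite -[X in measurable X]setTI; exact: measurable_row_mx.
have -> : lebesgue_rV ((fun x => v + x) @^-1` A) = m1 B.
  rewrite /m1 /= /pushforward /B; congr (product_measure1 _ _ _).
  by apply/funext => -[t x]; rewrite /preimage/= row_mx_addl.
have := @product_measure_unique _ _ _ _ _ lebesgue_measure
  (@lebesgue_rV R n) m1.
move=> /(_ _ B mB) <- // C D mC mD.
rewrite /m1 /= /pushforward.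
rewrite (_ : f @^-1` _ =
    (fun t : measurableTypeR R => v ord0 (lshift n (ord0 : 'I_1)) + (t : R) : measurableTypeR R)
      @^-1` C `*` (fun x => rsubmx (v : 'rV_(1 + n)) + x) @^-1` D)//.
rewrite product_measure1E.
- congr (_ * _)%E; [exact: lebesgue_measure_translation | exact: IHn].
- apply: measurable_preimage => //.
  by apply: (@measurable_funD _ _ R setT (cst _) id).
- apply: measurable_preimage => //.
  by apply: (@measurable_addrV R _ _ _ (cst _) id).
Qed.

End lebesgue_rV_measure.
Arguments cube {R} n a b _.

(** * Translation invariant measures *)

Section rotation_invariance.
Context {R : realType} (n : nat).
Implicit Types (A B : set 'rV[R]_n) (lam nu : {sigma_finite_measure set 'rV[R]_n -> \bar R}).

Definition translation_invariant (mu : set 'rV[R]_n -> \bar R) :=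
  forall v A, measurable A -> mu ((fun x => v + x) @^-1` A) = mu A.

(** Both sides are the measure of [{(x, y) | x \in A, x + y \in B}]: integrating
    first over [y] gives the left-hand side, and the substitution
    [x |-> x - y] followed by an integration over [y] gives the right-hand side.
    With [A] of positive finite measure this says that two translation invariant
    measures are proportional, without any appeal to densities. *)
Lemma translation_invariant_swap lam nu A B :
  translation_invariant lam -> translation_invariant nu ->
  measurable A -> measurable B ->
  (lam A * nu B = lam B * nu (-%R @^-1` A))%E.
Proof.
move=> lamT nuT mA mB.
pose E1 := [set z : 'rV[R]_n * 'rV[R]_n | A z.1 /\ B (z.1 + z.2)].
pose E2 := [set z : 'rV[R]_n * 'rV[R]_n | B z.1 /\ A (z.1 - z.2)].
have mV : measurable_fun setT (fun x : 'rV[R]_n => - x).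
  apply: measurable_fun_rV => i.
  apply: (eq_measurable_fun (fun x : 'rV[R]_n => - x ord0 i)).
    by move=> z _; rewrite !mxE.
  by apply: measurableT_comp => //; exact: measurable_coord.
have mE1 : measurable E1.
  apply: measurableI.
    exact: (measurable_preimage (f := fst)).
  apply: (measurable_preimage (f := fun z : 'rV[R]_n * 'rV[R]_n => z.1 + z.2)) => //.
  by apply: measurable_addrV.
have mE2 : measurable E2.
  apply: measurableI.
    exact: (measurable_preimage (f := fst)).
  apply: (measurable_preimage (f := fun z : 'rV[R]_n * 'rV[R]_n => z.1 - z.2)) => //.
  apply: measurable_addrV => //.
  exact: (measurableT_comp mV measurable_snd).
have prodE (E : set ('rV[R]_n * 'rV[R]_n)) : measurable E ->
    (lam \x nu)%E E = (lam \x^ nu)%E E.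
  by apply: product_measure_unique => C D mC mD; exact: product_measure2E.
transitivity ((lam \x nu)%E E1).
  rewrite /product_measure1 (eq_integral (fun x => (nu B * (\1_A x)%:E)%E)).
    by rewrite ge0_integralZl ?integral_indic ?setIT 1?muleC//;
      apply/measurable_EFinP; exact: measurable_indic.
  move=> x _ /=; rewrite indicE; have [Ax|Ax] := boolP (x \in A).
    rewrite mule1 -(nuT x B)//; congr (nu _).
    apply/seteqP; split => y; rewrite /xsection/= inE; first by case.
    by move=> Bxy; split => //; exact/set_mem.
  rewrite mule0 (_ : xsection _ _ = set0) ?measure0//.
  rewrite -subset0 => y; rewrite /xsection/= inE => -[Ax'].
  by move: Ax; rewrite notin_setE.
rewrite prodE// (_ : (lam \x^ nu)%E E1 = (lam \x^ nu)%E E2); last first.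
  rewrite /product_measure2; apply: eq_integral => y _ /=.
  rewrite -(lamT y (ysection E2 y)); last exact: measurable_ysection.
  congr (lam _); apply/seteqP; split => x; rewrite /ysection/= !inE /E1 /E2 /=.
    by move=> [Ax Bx]; rewrite addrC; split => //; rewrite addrK.
  by rewrite addrC addrK => -[].
rewrite -prodE// /product_measure1.
rewrite (eq_integral (fun x => (nu (-%R @^-1` A) * (\1_B x)%:E)%E)).
  by rewrite ge0_integralZl ?integral_indic ?setIT 1?muleC//;
    apply/measurable_EFinP; exact: measurable_indic.
move=> x _ /=; rewrite indicE; have [Bx|Bx] := boolP (x \in B).
  rewrite mule1 -(nuT (- x) (-%R @^-1` A)); last exact: measurable_preimage.
  congr (nu _); apply/seteqP; split => y; rewrite /xsection/= inE /E2/= opprD opprK.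
    by case.
  by move=> Axy; split => //; exact/set_mem.
rewrite mule0 (_ : xsection _ _ = set0) ?measure0//.
rewrite -subset0 => y; rewrite /xsection/= inE => -[Bx'].
by move: Bx; rewrite notin_setE.
Qed.

End rotation_invariance.

(** * Inner product and orthogonal matrices *)

Section orthogonal.
Context {R : realType}.

Definition dot n (x y : 'rV[R]_n) : R := \sum_i x ord0 i * y ord0 i.

Lemma dotE n (x y : 'rV[R]_n) : dot x y = (x *m y^T) ord0 ord0.
Proof. by rewrite mxE; apply: eq_bigr => i _; rewrite mxE. Qed.

Lemma dotC n (x y : 'rV[R]_n) : dot x y = dot y x.
Proof. by apply: eq_bigr => i _; rewrite mulrC. Qed.

Lemma dotDl n (x y z : 'rV[R]_n) : dot (x + y) z = dot x z + dot y z.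
Proof. by rewrite !dotE mulmxDl mxE. Qed.

Lemma dotDr n (x y z : 'rV[R]_n) : dot z (x + y) = dot z x + dot z y.
Proof. by rewrite dotC dotDl !(dotC z). Qed.

Lemma dotZl n c (x y : 'rV[R]_n) : dot (c *: x) y = c * dot x y.
Proof. by rewrite !dotE -scalemxAl mxE. Qed.

Lemma dotZr n c (x y : 'rV[R]_n) : dot x (c *: y) = c * dot x y.
Proof. by rewrite dotC dotZl dotC. Qed.

Lemma dotNl n (x y : 'rV[R]_n) : dot (- x) y = - dot x y.
Proof. by rewrite -scaleN1r dotZl mulN1r. Qed.

Lemma dotNr n (x y : 'rV[R]_n) : dot x (- y) = - dot x y.
Proof. by rewrite dotC dotNl dotC. Qed.

Lemma dot_mulmx n (g : 'M[R]_n) (x y : 'rV[R]_n) :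
  dot (x *m g) y = dot x (y *m g^T).
Proof. by rewrite !dotE trmx_mul trmxK mulmxA. Qed.

Lemma dot_ge0 n (x : 'rV[R]_n) : 0 <= dot x x.
Proof. by apply: sumr_ge0 => i _; rewrite -expr2 sqr_ge0. Qed.

Lemma dot_eq0 n (x : 'rV[R]_n) : (dot x x == 0) = (x == 0).
Proof.
apply/idP/idP => [|/eqP ->]; last by rewrite /dot big1// => i _; rewrite mxE mul0r.
rewrite psumr_eq0 => [/allP h|i _]; last by rewrite -expr2 sqr_ge0.
apply/eqP/rowP => i; rewrite mxE.
by have := h i (mem_index_enum _); rewrite mulf_eq0 orbb => /eqP.
Qed.

Lemma dot_delta n (x : 'rV[R]_n) i : dot x (delta_mx ord0 i) = x ord0 i.
Proof.
rewrite /dot (bigD1 i)//= mxE !eqxx mulr1 big1 ?addr0// => j ji.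
by rewrite mxE (negbTE ji) andbF mulr0.
Qed.

Lemma enormE n (x : 'rV[R]_n) : enorm x = Num.sqrt (dot x x).
Proof. by congr Num.sqrt; apply: eq_bigr => i _; rewrite expr2. Qed.

Lemma enorm_ge0 n (x : 'rV[R]_n) : 0 <= enorm x.
Proof. exact: sqrtr_ge0. Qed.

Lemma sqr_enorm n (x : 'rV[R]_n) : enorm x ^+ 2 = dot x x.
Proof. by rewrite enormE sqr_sqrtr ?dot_ge0. Qed.

Lemma enorm_eq0 n (x : 'rV[R]_n) : (enorm x == 0) = (x == 0).
Proof. by rewrite -dot_eq0 -sqr_enorm sqrf_eq0. Qed.

Lemma enorm_gt0 n (x : 'rV[R]_n) : (0 < enorm x) = (x != 0).
Proof. by rewrite lt_def enorm_ge0 andbT enorm_eq0. Qed.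

Lemma enormZ n c (x : 'rV[R]_n) : enorm (c *: x) = `|c| * enorm x.
Proof.
by rewrite !enormE dotZl dotZr mulrA -expr2 sqrtrM ?sqr_ge0// sqrtr_sqr.
Qed.

Lemma enormN n (x : 'rV[R]_n) : enorm (- x) = enorm x.
Proof. by rewrite -scaleN1r enormZ normrN1 mul1r. Qed.

Lemma sphere_delta n (i : 'I_n) : sphere (delta_mx ord0 i : 'rV[R]_n).
Proof. by rewrite /sphere/= enormE dot_delta mxE !eqxx sqrtr1. Qed.

Lemma dot_sphere n (x : 'rV[R]_n) : sphere x -> dot x x = 1.
Proof. by move=> xS; rewrite -sqr_enorm (xS : enorm x = 1) expr1n. Qed.

Lemma enorm_normalize n (x : 'rV[R]_n) :
  x != 0 -> enorm ((enorm x)^-1 *: x) = 1.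
Proof.
by move=> x0; rewrite enormZ ger0_norm ?invr_ge0 ?enorm_ge0// mulVf// enorm_eq0.
Qed.

Definition orthogonalmx n (g : 'M[R]_n) := g *m g^T = 1%:M.

Lemma orthogonalC n (g : 'M[R]_n) : orthogonalmx g -> g^T *m g = 1%:M.
Proof. exact: mulmx1C. Qed.

Lemma orthogonalT n (g : 'M[R]_n) : orthogonalmx g -> orthogonalmx g^T.
Proof. by move=> gg; rewrite /orthogonalmx trmxK; exact: mulmx1C. Qed.

Lemma orthogonal1 n : orthogonalmx (1%:M : 'M[R]_n).
Proof. by rewrite /orthogonalmx trmx1 mulmx1. Qed.

Lemma orthogonalM n (g h : 'M[R]_n) :
  orthogonalmx g -> orthogonalmx h -> orthogonalmx (g *m h).
Proof.
move=> gg hh; rewrite /orthogonalmx trmx_mul mulmxA -(mulmxA g).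
by rewrite (hh : h *m h^T = _) mulmx1.
Qed.

Lemma dot_orthogonal n (g : 'M[R]_n) (x y : 'rV[R]_n) :
  orthogonalmx g -> dot (x *m g) (y *m g) = dot x y.
Proof. by move=> gg; rewrite dot_mulmx -mulmxA gg mulmx1. Qed.

Lemma enorm_orthogonal n (g : 'M[R]_n) (x : 'rV[R]_n) :
  orthogonalmx g -> enorm (x *m g) = enorm x.
Proof. by move=> gg; rewrite !enormE dot_orthogonal. Qed.

End orthogonal.

(** * Surface measure of the unit sphere *)

Section surface_measure.
Context {R : realType}.

Definition punctured_ball n : set 'rV[R]_n := [set x | 0 < enorm x <= 1].
Arguments punctured_ball n _ : clear implicits.

Lemma measurable_punctured_ball n : measurable (punctured_ball n).
Proof.
rewrite (_ : punctured_ball n = @enorm R n @^-1` `]0, 1]%classic).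
  by apply: measurable_preimage => //; exact: measurable_enorm.
by apply/seteqP; split => x /=; rewrite in_itv.
Qed.

(** The ball contains the cube [[1/(2n), 1/n]^n], which avoids the origin, and
    is contained in the cube [[-1, 1]^n]. *)
Lemma lebesgue_punctured_ball n : (0 < n)%N ->
  (0 < lebesgue_rV (punctured_ball n) < +oo)%E.
Proof.
move=> n0; have n0' : (0 : R) < n%:R by rewrite ltr0n.
apply/andP; split.
  apply: (@lt_le_trans _ _ (lebesgue_rV (cube n ((2 * n%:R)^-1 : R) n%:R^-1))).
    rewrite lebesgue_rV_cube.
      rewrite lte_fin exprn_gt0// invfM subr_gt0.
      by have := n0'; rewrite -invr_gt0; set t := _^-1; lra.
    by have := n0'; rewrite invfM -invr_gt0; set t := _^-1; lra.
  apply: le_measure; rewrite ?inE.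
  - exact: measurable_cube.
  - exact: measurable_punctured_ball.
  - move=> x xc.
    have xc0 i : 0 < x ord0 i.
      have /andP[+ _] := xc i; apply: lt_le_trans.
      by rewrite invr_gt0 mulr_gt0.
    apply/andP; split.
      rewrite enorm_gt0; apply/eqP => x0.
      by have := xc0 (Ordinal n0); rewrite x0 mxE ltxx.
    rewrite -(@ler_pXn2r _ 2%N)// ?nnegrE ?enorm_ge0// sqr_enorm expr1n.
    apply: (@le_trans _ _ (\sum_(i < n) n%:R^-1)); last first.
      by rewrite sumr_const card_ord -[leLHS]mulr_natr mulVf// gt_eqF.
    apply: ler_sum => i _; have /andP[_ xi] := xc i.
    apply: le_trans xi; rewrite -[leRHS]mulr1 ler_wpM2l//; first exact/ltW.
    have /andP[_ xi] := xc i; apply: (le_trans xi).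
    by rewrite invf_le1// ler1n.
apply: (@le_lt_trans _ _ (lebesgue_rV (cube n (-1 : R) 1))).
  apply: le_measure; rewrite ?inE.
  - exact: measurable_punctured_ball.
  - exact: measurable_cube.
  - move=> x /andP[_ x1] i; rewrite -ler_norml.
    rewrite -(@ler_pXn2r _ 2%N)// ?nnegrE// expr1n real_normK ?num_real//.
    apply: (@le_trans _ _ (enorm x ^+ 2)); last by rewrite exprn_ile1// enorm_ge0.
    rewrite sqr_enorm /dot (bigD1 i)//= -expr2 lerDl sumr_ge0// => j _.
    by rewrite -expr2 sqr_ge0.
by rewrite lebesgue_rV_cube ?ltry// lerN10.
Qed.

End surface_measure.
Arguments punctured_ball {R} n _.

Section pushforward_bijection.
Context d1 d2 (T1 : measurableType d1) (T2 : measurableType d2) (R : realType).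
Variables (m : {sigma_finite_measure set T1 -> \bar R}) (f : T1 -> T2) (g : T2 -> T1).
Hypotheses (mf : measurable_fun setT f) (mg : measurable_fun setT g).
Hypothesis fK : cancel f g.

Let nu : set T2 -> \bar R := pushforward m f.

HB.instance Definition _ := Measure.copy nu
  (measure_function_pushforward__canonical__measure_function_Measure m mf).

Let nu_sigma_finite : sigma_finite setT nu.
Proof.
have [F FT mF] := sigma_finiteT m.
exists (fun k => g @^-1` F k).
  by rewrite -preimage_bigcup -FT preimage_setT.
move=> k; have [mFk Fk] := mF k; split; first exact: measurable_preimage.
rewrite /nu /pushforward (_ : f @^-1` _ = F k)//.
by rewrite -comp_preimage (_ : g \o f = id)//; apply/funext => x; exact: fK.
Qed.

HB.instance Definition _ := Measure_isSigmaFinite.Build _ _ _ nu nu_sigma_finite.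

(** Bundles the image measure for use with the theorems on sigma-finite
    measures; an exhausting sequence is transported by the inverse. *)
Lemma sigma_finite_pushforward :
  exists nu' : {sigma_finite_measure set T2 -> \bar R},
    nu' = pushforward m f :> (set T2 -> \bar R).
Proof. by exists nu. Qed.

End pushforward_bijection.

Section surface_measure_orthogonal.
Context {R : realType}.

(** The image of Lebesgue measure by [g] is translation invariant, hence
    proportional to Lebesgue measure by [translation_invariant_swap]; the ball,
    which [g] preserves, shows that the factor is 1. The origin is removed from
    the ball to match the cone that defines the surface measure. *)
Lemma lebesgue_rV_orthogonal n (g : 'M[R]_n) A : (0 < n)%N ->
  orthogonalmx g -> measurable A ->
  lebesgue_rV ((fun x => x *m g) @^-1` A) = lebesgue_rV A.
Proof.
move=> n0 og mA.
have gK : cancel (fun x : 'rV[R]_n => x *m g) (fun x => x *m g^T).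
  by move=> x; rewrite -mulmxA og mulmx1.
have gK' : cancel (fun x : 'rV[R]_n => x *m g^T) (fun x => x *m g).
  by move=> x; rewrite -mulmxA (orthogonalC og) mulmx1.
have [nu nuE] := sigma_finite_pushforward (@lebesgue_rV R n)
  (measurable_mulmx g) (measurable_mulmx g^T) gK.
have lebT : translation_invariant (@lebesgue_rV R n).
  by move=> v B mB; exact: lebesgue_rV_translation.
have nuT : translation_invariant nu.
  move=> v B mB; rewrite nuE /pushforward.
  apply: etrans (lebT (v *m g^T) _ (measurable_preimage (measurable_mulmx g) mB)).
  congr (lebesgue_rV _); apply/seteqP; split => x /=;
  by rewrite mulmxDl gK'.
have mpb := @measurable_punctured_ball R n.
have /andP[b0 boo] := @lebesgue_punctured_ball R _ n0.
have bfin : lebesgue_rV (punctured_ball n : set 'rV[R]_n) \is a fin_num.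
  by rewrite ge0_fin_numE// ltW.
have pbE : (fun x : 'rV[R]_n => x *m g) @^-1` (-%R @^-1` punctured_ball n) =
    punctured_ball n.
  by apply/seteqP; split => x /=; rewrite /punctured_ball/= enormN enorm_orthogonal.
have := translation_invariant_swap lebT nuT mpb mA.
rewrite nuE /pushforward pbE [RHS]muleC => E.
by apply/eqP; rewrite eq_le -(lee_pmul2l bfin)// -[X in _ && X](lee_pmul2l bfin)//
  -eq_le; apply/eqP; exact: E.
Qed.

Definition normalize n (x : 'rV[R]_n) : 'rV[R]_n := (enorm x)^-1 *: x.

Lemma measurable_normalize n : measurable_fun setT (@normalize n).
Proof.
apply: measurable_scalerV; first exact: measurable_enormV.
exact: measurable_id.
Qed.

Let sm n : {measure set 'rV[R]_n -> \bar R} :=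
  mscale (n%:R%:nng : {nonneg R})
   (measure_function_pushforward__canonical__measure_function_Measure
     (mrestr (@lebesgue_rV R n) (@measurable_punctured_ball R n))
     (@measurable_normalize n)).

Let smE n : @surface_measure R n = sm n.
Proof.
apply/funext => A; rewrite /sm /= /mscale /= /pushforward /mrestr setIC.
by congr (_ * lebesgue_rV _)%E.
Qed.

Let sm0 n : @surface_measure R n set0 = 0%E.
Proof. by rewrite smE measure0. Qed.
Let sm_ge0 n A : (0 <= @surface_measure R n A)%E.
Proof. by rewrite smE. Qed.
Let sm_sigma_additive n : semi_sigma_additive (@surface_measure R n).
Proof. by rewrite smE; exact: measure_semi_sigma_additive. Qed.

HB.instance Definition _ n := isMeasure.Build _ _ _ (@surface_measure R n)
  (@sm0 n) (@sm_ge0 n) (@sm_sigma_additive n).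

Let sm_fin n : fin_num_fun (@surface_measure R n).
Proof.
move=> A mA; rewrite ge0_fin_numE; last exact: measure_ge0.
case: n A mA => [|n] A mA; first by rewrite /surface_measure mul0e ltry.
apply: (@le_lt_trans _ _ (n.+1%:R%:E * lebesgue_rV (punctured_ball n.+1))%E); last first.
  by rewrite lte_mul_pinfty// (andP (@lebesgue_punctured_ball R n.+1 _)).2.
rewrite lee_pmul// le_measure// ?inE.
- apply: measurableI; first exact: measurable_punctured_ball.
  by apply: measurable_preimage => //; exact: measurable_normalize.
- exact: measurable_punctured_ball.
- by move=> x [].
Qed.

HB.instance Definition _ n := Measure_isFinite.Build _ _ _
  (@surface_measure R n) (@sm_fin n).

Lemma surface_measure_sphere n : (0 < n)%N ->
  (0 < surface_measure (@sphere R n))%E.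
Proof.
move=> n0; rewrite /surface_measure mule_gt0 ?lte_fin ?ltr0n//.
rewrite (_ : mkset _ = punctured_ball n).
  by rewrite (andP (@lebesgue_punctured_ball R _ n0)).1.
apply/seteqP; split => x /=; first by case.
move=> h; split => //; apply: enorm_normalize; rewrite -enorm_gt0.
by case/andP: h.
Qed.

Lemma surface_measure_sphereC n : surface_measure (~` @sphere R n) = 0%E.
Proof.
rewrite /surface_measure (_ : mkset _ = set0) ?measure0 ?mule0//.
rewrite -subset0 => x /= [/andP[x0 _]]; apply; apply: enorm_normalize.
by rewrite -enorm_gt0.
Qed.

(** The map [x |-> x g] preserves the norm, so it maps the cone over [A g^-1]
    onto the cone over [A]. *)
Lemma surface_measure_orthogonal n (g : 'M[R]_n) A : (0 < n)%N ->
  orthogonalmx g -> measurable A ->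
  surface_measure ((fun x => x *m g) @^-1` A) = surface_measure A.
Proof.
move=> n0 og mA; rewrite /surface_measure; congr (_ * _)%E.
rewrite -[RHS](lebesgue_rV_orthogonal n0 og).
  congr (lebesgue_rV _); apply/seteqP; split => x /=;
  by rewrite enorm_orthogonal// scalemxAl.
apply: measurableI; first exact: measurable_punctured_ball.
by apply: measurable_preimage => //; exact: measurable_normalize.
Qed.

Lemma integral_sphere_orthogonal n (g : 'M[R]_n) (f : 'rV[R]_n -> \bar R) :
  (0 < n)%N -> orthogonalmx g -> measurable_fun (@sphere R n) f ->
  (\int[@surface_measure R n]_(x in @sphere R n) f (x *m g) =
   \int[@surface_measure R n]_(x in @sphere R n) f x)%E.
Proof.
move=> n0 og.
have sg : (fun x : 'rV[R]_n => x *m g) @^-1` @sphere R n = @sphere R n.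
  by apply/seteqP; split => x; rewrite /sphere/= enorm_orthogonal.
have ms := @measurable_sphere R n.
have ge0 (h : 'rV[R]_n -> \bar R) : measurable_fun (@sphere R n) h ->
    (forall x, 0 <= h x)%E ->
  (\int[@surface_measure R n]_(x in @sphere R n) h (x *m g) =
   \int[@surface_measure R n]_(x in @sphere R n) h x)%E.
  move=> mh h0; have := ge0_integral_pushforward (measurable_mulmx g)
    (@surface_measure R n) ms mh (fun x _ => h0 x).
  rewrite sg => <-; apply: eq_measure_integral; first exact: measurable_mulmx.
  by move=> mg A mA _; exact: surface_measure_orthogonal.
move=> mf; rewrite integralE [RHS]integralE; congr (_ - _)%E.
  apply: etrans (ge0 f^\+%E (measurable_funepos mf) (@funepos_ge0 _ _ f)).
  by apply: eq_integral => x _; rewrite !funeposE.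
apply: etrans (ge0 f^\-%E (measurable_funeneg mf) (@funeneg_ge0 _ _ f)).
by apply: eq_integral => x _; rewrite !funenegE.
Qed.

End surface_measure_orthogonal.

(** * Uniqueness of a law with given cosine transform *)

Section threshold.
Context {R : realType}.

(** Bernoulli's inequality, and its version for [1 - y] below; they control the
    powers that approximate a jump. *)
Lemma bernoulli_ge (y : R) m : 0 <= y -> 1 + m%:R * y <= (1 + y) ^+ m.
Proof.
move=> y0; elim: m => [|m IHm]; first by rewrite mul0r addr0 expr0.
rewrite exprS; apply: (@le_trans _ _ ((1 + y) * (1 + m%:R * y))).
  rewrite -natr1; have := ler0n R m; nra.
by rewrite ler_pM2l//; lra.
Qed.

Lemma bernoulli_le (y : R) m : 0 <= y <= 1 -> 1 - m%:R * y <= (1 - y) ^+ m.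
Proof.
move=> /andP[y0 y1]; elim: m => [|m IHm]; first by rewrite mul0r subr0 expr0.
rewrite exprS; apply: (@le_trans _ _ ((1 - y) * (1 - m%:R * y))).
  rewrite -natr1; have := ler0n R m; nra.
by rewrite ler_wpM2l//; lra.
Qed.

Lemma cvg_harmonic_natr : (fun k => (1 + k%:R)^-1 : R) @ \oo --> (0 : R).
Proof.
rewrite (_ : (fun k => _) = harmonic); first exact: cvg_harmonic.
by apply/funext => k; rewrite /harmonic nat1r.
Qed.

Lemma cvg_natr_geometric (r : R) : 0 <= r < 1 ->
  (fun k => k%:R * r ^+ k) @ \oo --> (0 : R).
Proof.
move=> /andP[r0 r1]; have [->|rn0] := eqVneq r 0.
  apply: cvg_near_cst; exists 1%N => // -[//|k _] /=.
  by rewrite expr0n mulr0.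
(* Half of the geometric decay absorbs the factor k. *)
pose p := Num.sqrt r.
have p0 : 0 < p by rewrite sqrtr_gt0 lt_def rn0.
have p1 : p < 1 by rewrite -sqrtr1 ltr_sqrt.
pose d := p^-1 - 1.
have d0 : 0 < d by rewrite subr_gt0 invf_gt1.
apply: (@squeeze_cvgr _ _ _ _ (fun=> 0) (fun k => d^-1 * p ^+ k)).
- apply: nearW => k; rewrite mulr_ge0 ?exprn_ge0//=.
  have -> : r = p * p by rewrite -expr2 sqr_sqrtr.
  rewrite exprMn mulrA ler_wpM2r ?exprn_ge0 ?(ltW p0)//.
  rewrite -ler_pdivlMr ?exprn_gt0// ler_pdivlMl//.
  rewrite -exprVn (_ : p^-1 = 1 + d); last by rewrite /d addrC subrK.
  by apply: le_trans (bernoulli_ge _ (ltW d0)); rewrite mulrC lerDr.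
- exact: cvg_cst.
- rewrite -(mulr0 d^-1); apply: cvgM; first exact: cvg_cst.
  by apply: cvg_expr; rewrite ger0_norm// ltW.
Qed.

(** Powers turn a function with values in [[0, 1]] into the indicator of
    [s < 1/2]: by Bernoulli's inequality [(1 - s^k)^(k 2^k)] is at least
    [1 - k (2 s)^k], and at most [1 / (1 + k (2 s)^k)]. The factor [k] in the
    exponent decides the case [s = 1/2]. *)
Lemma cvg_threshold (s : R) : 0 <= s <= 1 ->
  (fun k => (1 - s ^+ k) ^+ (k * 2 ^ k)%N) @ \oo --> ((s < 2^-1)%R%:R : R).
Proof.
move=> /andP[s0 s1]; have sk k : 0 <= s ^+ k <= 1.
  by rewrite exprn_ge0// exprn_ile1.
have q0 k : 0 <= (1 - s ^+ k) ^+ (k * 2 ^ k)%N.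
  by rewrite exprn_ge0// subr_ge0; have /andP[] := sk k.
have mE k : (k * 2 ^ k)%N%:R * s ^+ k = k%:R * (2 * s) ^+ k.
  by rewrite natrM natrX exprMn mulrA.
have [sl|sg] := ltP s.
  apply: (@squeeze_cvgr _ _ _ _ (fun k => 1 - k%:R * (2 * s) ^+ k) (fun=> 1)).
  - apply: nearW => k; rewrite -mE bernoulli_le//= exprn_ile1//.
      by rewrite subr_ge0; have /andP[] := sk k.
    by rewrite lerBlDr lerDl; have /andP[] := sk k.
  - rewrite -[X in _ --> X](subr0 1); apply: cvgB; first exact: cvg_cst.
    apply: cvg_natr_geometric; lra.
  - exact: cvg_cst.
apply: (@squeeze_cvgr _ _ _ _ (fun=> 0) (fun k => (1 + k%:R)^-1)).
- apply: nearW => k; rewrite q0/=.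
  have h : 1 + k%:R <= (1 + s ^+ k) ^+ (k * 2 ^ k).
    apply: le_trans (bernoulli_ge _ _); last by have /andP[] := sk k.
    rewrite lerD2l mE ler_peMr// exprn_ege1//; lra.
  have k1 : 0 < 1 + k%:R :> R by rewrite ltr_pwDl.
  apply: (@le_trans _ _ ((1 + s ^+ k) ^+ (k * 2 ^ k))^-1).
    rewrite -exprVn lerXn2r// ?nnegrE.
    + by rewrite subr_ge0; have /andP[] := sk k.
    + by rewrite invr_ge0 addr_ge0//; have /andP[] := sk k.
    + have /andP[u0 u1] := sk k; rewrite -[leRHS]mul1r ler_pdivlMr; nra.
  by rewrite lef_pV2// posrE (lt_le_trans k1).
- exact: cvg_cst.
- exact: cvg_harmonic_natr.
Qed.

End threshold.

Section bounded_measurable.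
Context d (T : measurableType d) (R : realType).
Implicit Types f g h : T -> R.

Definition bounded_measurable f :=
  measurable_fun setT f /\ exists M, forall x, `|f x| <= M.

Lemma bounded_measurable_integrable (mu : {finite_measure set T -> \bar R}) f :
  bounded_measurable f -> mu.-integrable setT (EFin \o f).
Proof.
move=> [mf [M fM]].
apply: (@le_integrable _ _ _ _ setT measurableT _ (EFin \o cst M)).
- exact/measurable_EFinP.
- move=> x _; rewrite /= lee_fin (le_trans (fM x))//.
  exact: ler_norm.
- exact: finite_measure_integrable_cst.
Qed.

Lemma bounded_measurable_cst (c : R) : bounded_measurable (fun=> c).
Proof. by split; [exact: measurable_cst|exists `|c|]. Qed.

Lemma bounded_measurableD f g : bounded_measurable f -> bounded_measurable g ->
  bounded_measurable (fun x => f x + g x).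
Proof.
move=> [mf [M fM]] [mg [N gN]]; split; first exact: measurable_funD.
by exists (M + N) => x; rewrite (le_trans (ler_normD _ _))// lerD.
Qed.

Lemma bounded_measurableM f g : bounded_measurable f -> bounded_measurable g ->
  bounded_measurable (fun x => f x * g x).
Proof.
move=> [mf [M fM]] [mg [N gN]]; split; first exact: measurable_funM.
by exists (M * N) => x; rewrite normrM ler_pM.
Qed.

Lemma bounded_measurable_lim (f_ : nat -> T -> R) f (M : R) :
  (forall k, measurable_fun setT (f_ k)) -> (forall k x, `|f_ k x| <= M) ->
  (forall x, f_ ^~ x @ \oo --> f x) -> bounded_measurable f.
Proof.
move=> mf fM fl; split.
  by apply: (measurable_fun_cvg mf) => x _; exact: fl.
exists M => x; apply: (cvgr_to_le (cvg_norm (fl x))).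
by apply: nearW => k /=.
Qed.

Lemma Rintegral_bounded_lim (mu : {finite_measure set T -> \bar R})
    (f_ : nat -> T -> R) f (M : R) :
  (forall k, measurable_fun setT (f_ k)) -> (forall k x, `|f_ k x| <= M) ->
  (forall x, f_ ^~ x @ \oo --> f x) ->
  (fun k => \int[mu]_x f_ k x) @ \oo --> \int[mu]_x f x.
Proof.
move=> mf fM fl; have bf := bounded_measurable_lim mf fM fl.
have [] := @dominated_convergence _ _ _ mu setT measurableT
  (fun k x => (f_ k x)%:E) (EFin \o f) (cst M%:E).
- by move=> k; exact/measurable_EFinP.
- by apply/measurable_EFinP; case: bf.
- by apply: aeW => x _; apply: cvg_EFin; [exact: nearW|exact: fl].
- exact: finite_measure_integrable_cst.
- by apply: aeW => x k _; rewrite /= lee_fin.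
move=> intf _ cvgf; apply: fine_cvg.
rewrite -[X in _ --> X]fineK// in cvgf.
exact: integrable_fin_num.
Qed.

End bounded_measurable.

Section wave.
Context {R : realType} (n : nat).

(** With the phase [th] free, the cosines stand for the real and the imaginary
    part of the complex exponential at once. *)
Definition wave (xi : 'rV[R]_n) (th : R) (x : 'rV[R]_n) : R :=
  cos (dot xi x + th).

Lemma measurable_dotr (xi : 'rV[R]_n) : measurable_fun setT (dot xi).
Proof.
apply: measurable_sum => i; apply: measurable_funM => //.
exact: measurable_coord.
Qed.

Lemma continuous_measurable_comp d (T : measurableType d) (g : R -> R) (f : T -> R) :
  continuous g -> measurable_fun setT f -> measurable_fun setT (g \o f).
Proof. by move=> cg; apply: measurableT_comp; exact: continuous_measurable_fun. Qed.

Lemma bounded_measurable_cos d (T : measurableType d) (f : T -> R) (th : R) :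
  measurable_fun setT f -> bounded_measurable (fun w => cos (f w + th)).
Proof.
move=> mf; split; last by exists 1 => w; exact: cos_max.
apply: (@continuous_measurable_comp _ _ cos (fun w => f w + th)).
  exact: continuous_cos.
exact: measurable_funD.
Qed.

Lemma bounded_measurable_wave xi th : bounded_measurable (wave xi th).
Proof. by apply: bounded_measurable_cos; exact: measurable_dotr. Qed.

(** Products of waves are combinations of waves, so waves can be used as
    multipliers below. *)
Lemma waveM xi th eta ph x : wave xi th x * wave eta ph x =
  2^-1 * wave (xi + eta) (th + ph) x + 2^-1 * wave (xi - eta) (th - ph) x.
Proof.
rewrite /wave !dotDl dotNl.
set a := dot xi x; set b := dot eta x.
rewrite (_ : a + b + _ = (a + th) + (b + ph)); last by ring.
rewrite (_ : a - b + _ = (a + th) - (b + ph)); last by ring.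
by move: (a + th) (b + ph) => A B; rewrite cosD cosB; field.
Qed.

End wave.

Section multipliers.
Context {R : realType} (n : nat).
Variables (mu nu : {finite_measure set 'rV[R]_n -> \bar R}).
Implicit Types f h : 'rV[R]_n -> R.

(** The functions that cannot tell [mu] from [nu], even after multiplication by
    any wave. *)
Definition agree f := bounded_measurable f /\
  forall xi th, \int[mu]_x (f x * wave xi th x) = \int[nu]_x (f x * wave xi th x).

(** Multipliers form an algebra closed under bounded pointwise limits that
    contains the waves. This is a monotone class argument in which stability
    under products is built into the definition. *)
Definition multiplier h := bounded_measurable h /\
  forall f, agree f -> agree (fun x => f x * h x).

Lemma agreeZD c f g : agree f -> agree g -> agree (fun x => c * f x + g x).
Proof.
move=> [bf fE] [bg gE]; split.
  by apply: bounded_measurableD => //; apply: bounded_measurableM => //;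
    exact: bounded_measurable_cst.
move=> xi th; have bw := bounded_measurable_wave xi th.
have E (m : {finite_measure set 'rV[R]_n -> \bar R}) :
    \int[m]_x ((c * f x + g x) * wave xi th x) =
    c * \int[m]_x (f x * wave xi th x) + \int[m]_x (g x * wave xi th x).
  rewrite -RintegralZl//; last exact/bounded_measurable_integrable/bounded_measurableM.
  rewrite -RintegralD//.
  - by apply: eq_Rintegral => x _; ring.
  - apply/bounded_measurable_integrable/bounded_measurableM.
      exact: bounded_measurable_cst.
    exact: bounded_measurableM.
  - exact/bounded_measurable_integrable/bounded_measurableM.
by rewrite !E fE gE.
Qed.

Lemma agree_lim (f_ : nat -> 'rV[R]_n -> R) f M :
  (forall k, agree (f_ k)) -> (forall k x, `|f_ k x| <= M) ->
  (forall x, f_ ^~ x @ \oo --> f x) -> agree f.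
Proof.
move=> af fM fl; have mf k : measurable_fun setT (f_ k) by case: (af k) => -[].
split; first exact: (bounded_measurable_lim mf fM fl).
move=> xi th; have [mw [N wN]] := bounded_measurable_wave xi th.
have E (m : {finite_measure set 'rV[R]_n -> \bar R}) :
    (fun k => \int[m]_x (f_ k x * wave xi th x)) @ \oo -->
    \int[m]_x (f x * wave xi th x).
  apply: (@Rintegral_bounded_lim _ _ _ _ (fun k x => f_ k x * wave xi th x) _ (M * N)).
  - by move=> k; exact: measurable_funM.
  - by move=> k x; rewrite normrM ler_pM.
  - by move=> x; apply: cvgM => //; exact: cvg_cst.
have Ek : (fun k => \int[mu]_x (f_ k x * wave xi th x)) =
    (fun k => \int[nu]_x (f_ k x * wave xi th x)).
  by apply/funext => k; exact: (af k).2.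
have := E mu; rewrite Ek => Emu.
exact: (cvg_unique _ Emu (E nu)).
Qed.

Lemma multiplier_agree h : agree (cst 1) -> multiplier h -> agree h.
Proof.
by move=> a1 [_ /(_ _ a1)]; rewrite (_ : (fun x => cst 1 x * h x) = h)//;
  apply/funext => x; rewrite mul1r.
Qed.

Lemma multiplier_cst c : multiplier (fun=> c).
Proof.
split; first exact: bounded_measurable_cst.
move=> f af; rewrite (_ : (fun x => f x * c) = fun x => (c - 1) * f x + f x).
  exact: agreeZD.
by apply/funext => x; ring.
Qed.

Lemma multiplierZD c h1 h2 : multiplier h1 -> multiplier h2 ->
  multiplier (fun x => c * h1 x + h2 x).
Proof.
move=> [b1 m1] [b2 m2]; split.
  by apply: bounded_measurableD => //; apply: bounded_measurableM => //;
    exact: bounded_measurable_cst.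
move=> f af; rewrite (_ : (fun x => _) =
    fun x => c * (f x * h1 x) + f x * h2 x); last by apply/funext => x; ring.
by apply: agreeZD; [exact: m1|exact: m2].
Qed.

Lemma multiplierM h1 h2 : multiplier h1 -> multiplier h2 ->
  multiplier (fun x => h1 x * h2 x).
Proof.
move=> [b1 m1] [b2 m2]; split; first exact: bounded_measurableM.
move=> f af; rewrite (_ : (fun x => _) = fun x => f x * h1 x * h2 x).
  by apply: m2; exact: m1.
by apply/funext => x; rewrite mulrA.
Qed.

Lemma multiplierB h : multiplier h -> multiplier (fun x => 1 - h x).
Proof.
move=> mh; rewrite (_ : (fun x => _) = fun x => (-1) * h x + 1).
  by apply: multiplierZD => //; exact: multiplier_cst.
by apply/funext => x; ring.
Qed.

Lemma multiplierX h k : multiplier h -> multiplier (fun x => h x ^+ k).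
Proof.
move=> mh; elim: k => [|k IHk].
  rewrite (_ : (fun x => _) = fun=> 1); first exact: multiplier_cst.
  by apply/funext => x; rewrite expr0.
rewrite (_ : (fun x => _) = fun x => h x * h x ^+ k); first exact: multiplierM.
by apply/funext => x; rewrite exprS.
Qed.

Lemma multiplier_lim (h_ : nat -> 'rV[R]_n -> R) h M :
  (forall k, multiplier (h_ k)) -> (forall k x, `|h_ k x| <= M) ->
  (forall x, h_ ^~ x @ \oo --> h x) -> multiplier h.
Proof.
move=> mh hM hl.
have mmh k : measurable_fun setT (h_ k) by case: (mh k) => -[].
split; first exact: (bounded_measurable_lim mmh hM hl).
move=> f af; have [[_ [N fN]] _] := af.
apply: (@agree_lim (fun k x => f x * h_ k x) _ (N * M)).
- by move=> k; exact: (mh k).2.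
- by move=> k x; rewrite normrM ler_pM.
- by move=> x; apply: cvgM => //; exact: cvg_cst.
Qed.

Lemma multiplier_wave eta ph : multiplier (wave eta ph).
Proof.
have bw := bounded_measurable_wave eta ph.
split=> // f [bf fE]; split; first exact: bounded_measurableM.
move=> xi th.
have E (m : {finite_measure set 'rV[R]_n -> \bar R}) :
    \int[m]_x (f x * wave eta ph x * wave xi th x) =
    2^-1 * \int[m]_x (f x * wave (eta + xi) (ph + th) x) +
    2^-1 * \int[m]_x (f x * wave (eta - xi) (ph - th) x).
  have i1 := bounded_measurable_integrable m
    (bounded_measurableM bf (bounded_measurable_wave (eta + xi) (ph + th))).
  have i2 := bounded_measurable_integrable m
    (bounded_measurableM bf (bounded_measurable_wave (eta - xi) (ph - th))).
  rewrite -!RintegralZl// -RintegralD//.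
  - by apply: eq_Rintegral => x _; rewrite -mulrA waveM; ring.
  - by have := integrableZl measurableT 2^-1 i1.
  - by have := integrableZl measurableT 2^-1 i2.
by rewrite !E !fE.
Qed.

(** The limit in [cvg_threshold] is taken inside the algebra of multipliers; it
    replaces the Weierstrass approximation theorem. *)
Lemma multiplier_threshold h : multiplier h -> (forall x, 0 <= h x <= 1) ->
  multiplier (fun x => (h x < 2^-1)%R%:R).
Proof.
move=> mh h01.
apply: (@multiplier_lim (fun k x => (1 - h x ^+ k) ^+ (k * 2 ^ k)%N) _ 1).
- by move=> k; apply: multiplierX; apply: multiplierB; exact: multiplierX.
- move=> k x; have /andP[h0 h1] := h01 x.
  have u0 : 0 <= 1 - h x ^+ k by rewrite subr_ge0 exprn_ile1.
  rewrite ger0_norm ?exprn_ge0// exprn_ile1//.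
  by rewrite lerBlDr lerDl exprn_ge0.
- by move=> x; exact: cvg_threshold.
Qed.

(** For small [c] the sign of [sin (c (x_i - t))] is that of [x_i - t], so the
    half-space is a limit of sets on which a wave is below a threshold. *)
Lemma multiplier_halfspace i (t : R) :
  multiplier (fun x : 'rV[R]_n => (x ord0 i < t)%R%:R).
Proof.
pose c (k : nat) : R := k.+1%:R^-1.
have c0 k : 0 < c k by rewrite invr_gt0 ltr0n.
(* [s k x] is [(1 + sin (c k (x_i - t))) / 2]. *)
pose s k (x : 'rV[R]_n) :=
  2^-1 * wave (c k *: delta_mx ord0 i) (- (c k * t) - pi / 2) x + 2^-1.
have sE k x : s k x = 2^-1 * sin (c k * (x ord0 i - t)) + 2^-1.
  rewrite /s /wave dotZl addrA cosBpihalf mulrBr; congr (_ * sin (_ * _ - _) + _).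
  by rewrite dotC dot_delta.
apply: (@multiplier_lim (fun k x => (s k x < 2^-1)%R%:R) _ 1).
- move=> k; apply: multiplier_threshold.
    by apply: multiplierZD; [exact: multiplier_wave|exact: multiplier_cst].
  move=> x; rewrite sE; have := sin_max (c k * (x ord0 i - t)).
  by rewrite ler_norml => /andP[]; lra.
- by move=> k x; case: (_ < _); rewrite (normr0, normr1).
- move=> x; set y := x ord0 i - t.
  have yt : (x ord0 i < t) = (y < 0) by rewrite subr_lt0.
  rewrite yt; apply: cvg_near_cst.
  have : \forall k \near \oo, `|y| < k.+1%:R * pi.
    near=> k; rewrite -ltr_pdivrMr ?pi_gt0//.
    near: k; exists (Num.truncn (`|y| / pi)) => // k /= nk.
    apply: (lt_le_trans (truncnS_gt _)); by rewrite ler_nat.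
  apply: filterS => k yk; congr ((nat_of_bool _)%:R); rewrite sE -/y.
  have : `|c k * y| < pi.
    by rewrite normrM gtr0_norm// /c ltr_pdivrMl ?ltr0n.
  rewrite ltr_norml => /andP[h1 h2].
  have [y0|y0|->] := ltgtP y 0.
  - have : 0 < sin (- (c k * y)).
      apply: sin_gt0_pi; rewrite ltrNl h1 andbT oppr_gt0.
      by rewrite pmulr_rlt0.
    rewrite sinN => h3.
    have h4 : 2^-1 * sin (c k * y) + 2^-1 < 2^-1 by lra.
    by rewrite h4.
  - have : 0 < sin (c k * y).
      by apply: sin_gt0_pi; rewrite h2 andbT mulr_gt0.
    move=> h3; apply/negbTE; rewrite -leNgt; lra.
  - by rewrite mulr0 sin0 mulr0 add0r ltxx.
Unshelve. all: by end_near. Qed.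

End multipliers.

Section charfun_unique.
Context {R : realType} (n : nat).
Variables (mu nu : {finite_measure set 'rV[R]_n -> \bar R}).

(** The sets whose indicator is a multiplier form a sigma-algebra that contains
    the coordinate half-spaces. *)
Lemma multiplier_indic (A : set 'rV[R]_n) : measurable A ->
  multiplier mu nu (\1_A : 'rV[R]_n -> R).
Proof.
move: A; pose S := [set A : set 'rV[R]_n | multiplier mu nu (\1_A : 'rV[R]_n -> R)].
have SC A : S A -> S (~` A).
  rewrite /S /= => mA; rewrite (_ : \1_(~` A) = fun x => 1 - \1_A x).
    exact: multiplierB.
  by apply/funext => x; rewrite !indicE in_setC; case: (x \in A); rewrite ?subrr ?subr0.
have SI A B : S A -> S B -> S (A `&` B).
  rewrite /S /= => mA mB; rewrite indicI; exact: multiplierM.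
have S0 : S set0.
  by rewrite /S /= indic0; exact: multiplier_cst.
have SU A B : S A -> S B -> S (A `|` B).
  by move=> sA sB; rewrite -(setCK (A `|` B)) setCU; apply: (SC); apply: SI; exact: (SC).
have Scup (F : (set 'rV[R]_n)^nat) : (forall k, S (F k)) -> S (\bigcup_k F k).
  move=> SF; have SFk k : S (\bigcup_(i < k) F i).
    elim: k => [|k IHk]; first by rewrite bigcup_mkord big_ord0.
    by rewrite bigcup_mkord big_ord_recr/= -bigcup_mkord; exact: SU.
  apply: (@multiplier_lim _ _ _ _
    (fun k => \1_(\bigcup_(i < k) F i) : 'rV[R]_n -> R) _ 1) => //.
    by move=> k x; rewrite indicE; case: (_ \in _); rewrite (normr0, normr1).
  move=> x; apply: cvg_near_cst.
  have [xF|xF] := pselect ((\bigcup_k F k) x); last first.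
    apply: nearW => k; rewrite !indicE !memNset//; apply: contra_not xF.
    by move=> [i _ Fi]; exists i.
  have [i _ Fi] := xF; exists i.+1 => // k /= ik.
  by rewrite !indicE !mem_set//; exists i.
have Shalf i t : S ((fun x : 'rV[R]_n => x ord0 i) @^-1` `]-oo, t[%classic).
  rewrite /S /= (_ : \1_ _ = fun x : 'rV[R]_n => (x ord0 i < t)%R%:R).
    exact: multiplier_halfspace.
  apply/funext => x; rewrite indicE; congr ((nat_of_bool _)%:R).
  by apply/idP/idP; rewrite inE/= in_itv.
have Scoord i (B : set R) : measurable B -> S ((fun x : 'rV[R]_n => x ord0 i) @^-1` B).
  move=> mB.
  pose G := [set B : set R | S ((fun x : 'rV[R]_n => x ord0 i) @^-1` B)].
  suff : measurable `<=` G by apply.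
  suff : <<s @RGenInftyO.G R >> `<=` G.
    by apply: subset_trans; rewrite -[X in _ `<=` X](RGenInftyO.measurableE R).
  apply: smallest_sub => [|_ [t ->]]; last exact: Shalf.
  split=> [|C|F] /=.
  - by rewrite /G /= preimage_set0.
  - by rewrite /G /= setTD preimage_setC; exact: SC.
  - by rewrite /G /= preimage_bigcup; exact: Scup.
suff : @measurable _ 'rV[R]_n `<=` S by [].
apply: smallest_sub => [|A].
  split=> [//|C|//]; rewrite setTD; exact: SC.
rewrite -bigcup_seq => -[i _ [B mB <-]]; rewrite setTI; exact: Scoord.
Qed.

(** A finite measure on R^n is determined by its cosine transform: as every
    indicator is a multiplier and the constant 1 does not separate [mu] from
    [nu], no indicator does. *)
Lemma charfun_unique :
  (forall xi th, \int[mu]_x wave xi th x = \int[nu]_x wave xi th x) ->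
  forall A, measurable A -> mu A = nu A.
Proof.
move=> E A mA.
have a1 : agree mu nu (cst 1).
  split; first exact: bounded_measurable_cst.
  move=> xi th; have := E xi th; congr (_ = _);
  by apply: eq_Rintegral => x _; rewrite mul1r.
have [_ /(_ 0 0)] := multiplier_agree a1 (multiplier_indic mA).
have I (m : {finite_measure set 'rV[R]_n -> \bar R}) :
    \int[m]_x (\1_A x * wave 0 0 x) = fine (m A).
  rewrite /Rintegral; congr fine.
  rewrite -[X in _ = m X]setIT -integral_indic//; apply: eq_integral => x _.
  by rewrite /wave -(scale0r (0 : 'rV[R]_n)) dotZl mul0r addr0 cos0 mulr1.
rewrite !I => h; rewrite -[LHS]fineK ?fin_num_measure// -[RHS]fineK ?fin_num_measure//.
by rewrite h.
Qed.

End charfun_unique.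

(** * Orthogonal matrices act transitively on spheres *)

Section transitivity.
Context {R : realType}.

(** Both sides come from a block triangular matrix with blocks
    [1 + u v], [1] and from one with blocks [1], [1 + v u], which differ by
    unimodular factors. *)
Lemma det_rank1_update n (u : 'cV[R]_n) (v : 'rV[R]_n) :
  \det (1%:M + u *m v) = 1 + (v *m u) ord0 ord0.
Proof.
have E : block_mx 1%:M 0 v 1%:M *m block_mx (1%:M + u *m v) u 0 1%:M *m
    block_mx 1%:M 0 (- v) 1%:M = block_mx 1%:M u 0 (1%:M + v *m u) :> 'M[R]_(n + 1).
  rewrite !mulmx_block !mul1mx !mulmx1 !mul0mx !mulmx0 !addr0 !add0r.
  rewrite mulmxN addrK mulmxDr mulmx1 mulmxN mulmxDl mul1mx mulmxA.
  by rewrite (addrC v) subrr (addrC 1%:M).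
have := congr1 determinant E.
rewrite !det_mulmx !det_lblock !det_ublock !det1 !mul1r !mulr1 => ->.
by rewrite det_mx11 !mxE eqxx.
Qed.

(** For [w = 0] the formula gives the identity matrix. *)
Definition reflection n (w : 'rV[R]_n) : 'M[R]_n :=
  1%:M + (- (2 / dot w w) *: w^T) *m w.

Lemma mul_reflection n (w x : 'rV[R]_n) :
  x *m reflection w = x - (2 * dot x w / dot w w) *: w.
Proof.
rewrite /reflection mulmxDr mulmx1; congr (_ + _).
set c := 2 / dot w w.
rewrite mulmxA -scalemxAr -scalemxAl [x *m w^T]mx11_scalar -dotE mul_scalar_mx.
rewrite scalerA (_ : - c * dot x w = - (2 * dot x w / dot w w)) ?scaleNr//.
by rewrite /c; ring.
Qed.

Lemma trmx_reflection n (w : 'rV[R]_n) : (reflection w)^T = reflection w.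
Proof.
by rewrite /reflection linearD/= trmx1 trmx_mul linearZ/= trmxK -scalemxAr scalemxAl.
Qed.

Lemma orthogonal_reflection n (w : 'rV[R]_n) :
  w != 0 -> orthogonalmx (reflection w).
Proof.
move=> w0; have dw : dot w w != 0 by rewrite dot_eq0.
rewrite /orthogonalmx trmx_reflection; apply/row_matrixP => i.
rewrite !rowE mulmxA mulmx1; set x := delta_mx _ _.
rewrite mul_reflection mul_reflection dotDl dotNl dotZl mulfVK//.
by rewrite -addrA -opprD -scalerDl -mulrDl [X in _ - X](_ : _ = 0) ?subr0//;
  rewrite (_ : _ + _ = 0) ?mul0r ?scale0r//; ring.
Qed.

Lemma det_reflection n (w : 'rV[R]_n) : w != 0 -> \det (reflection w) = -1.
Proof.
move=> w0; rewrite det_rank1_update -scalemxAr mxE -dotE mulNr mulfVK ?dot_eq0//.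
by ring.
Qed.

(** If [x] and [y] have the same norm, the reflection along [x - y] exchanges
    them. *)
Lemma orthogonal_transitive n (x y : 'rV[R]_n) : dot x x = dot y y ->
  exists2 g, orthogonalmx g & x *m g = y.
Proof.
move=> xy; have [->|xny] := eqVneq x y.
  by exists 1%:M; [exact: orthogonal1|rewrite mulmx1].
have w0 : x - y != 0 by rewrite subr_eq0.
exists (reflection (x - y)); first exact: orthogonal_reflection.
have dw : dot (x - y) (x - y) = 2 * dot x (x - y).
  by rewrite !(dotDl, dotDr, dotNl, dotNr) -xy (dotC y x); ring.
by rewrite mul_reflection -dw divff ?dot_eq0// scale1r opprB addrC subrK.
Qed.

Lemma det_orthogonal n (g : 'M[R]_n) :
  orthogonalmx g -> \det g = 1 \/ \det g = -1.
Proof.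
move=> og; have := congr1 determinant (og : g *m g^T = _).
by rewrite det_mulmx det_tr det1 -expr2 => /eqP; rewrite sqrf_eq1 => /orP[] /eqP; auto.
Qed.

Lemma exists_perp n (y : 'rV[R]_n) : (1 < n)%N ->
  exists2 z : 'rV[R]_n, z != 0 & dot y z = 0.
Proof.
case: n y => [|[|n]]// y _.
pose e0 : 'rV[R]_n.+2 := delta_mx ord0 ord0.
pose e1 : 'rV[R]_n.+2 := delta_mx ord0 (lift ord0 ord0).
have [y0|y0] := eqVneq (y ord0 ord0) 0.
  exists e0; last by rewrite dot_delta.
  by apply/eqP => /rowP/(_ ord0); rewrite !mxE !eqxx => /eqP; rewrite oner_eq0.
exists (y ord0 (lift ord0 ord0) *: e0 - y ord0 ord0 *: e1); last first.
  by rewrite dotDr dotNr !dotZr !dot_delta; ring.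
apply/eqP => /rowP/(_ (lift ord0 ord0)); rewrite !mxE !eqxx /=.
by rewrite mulr0 mulr1 add0r => /eqP; rewrite oppr_eq0; exact/negP.
Qed.

(** If the orthogonal matrix that maps [x] to [y] has determinant -1, it is
    followed by a reflection along a vector orthogonal to [y]. *)
Lemma SO_transitive n (x y : 'rV[R]_n) : (1 < n)%N -> dot x x = dot y y ->
  exists2 g, SO g & rotate g x = y.
Proof.
move=> n1 /orthogonal_transitive[h oh xh].
have [dh|dh] := det_orthogonal oh.
  exists h^T; last by rewrite /rotate trmxK.
  by split; [exact: orthogonalT|rewrite det_tr].
have [z z0 yz] := exists_perp y n1.
have og : orthogonalmx (h *m reflection z).
  by apply: orthogonalM => //; exact: orthogonal_reflection.
exists (h *m reflection z)^T; last first.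
  by rewrite /rotate trmxK mulmxA xh mul_reflection yz mulr0 mul0r scale0r subr0.
split; first exact: orthogonalT.
by rewrite det_tr det_mulmx dh det_reflection// mulrNN mulr1.
Qed.

Lemma sphere_orbit n (x y : 'rV[R]_n) : (1 < n)%N -> sphere x -> sphere y ->
  exists2 g, SO g & rotate g x = y.
Proof. by move=> n1 Sx Sy; apply: SO_transitive => //; rewrite !dot_sphere. Qed.

End transitivity.

(** * Spaces of antisymmetric matrices stable under conjugation *)

Section antisymmetric_mx.
Context {R : realType} (n : nat).
Implicit Types (x y : 'rV[R]_n) (A B : 'M[R]_n).

(** Subspaces are given by arbitrary propositions, since some of those used below
    are defined by integrals. *)
Definition linear_closed_prop (V : lmodType R) (S : V -> Prop) :=
  S 0 /\ forall c (x y : V), S x -> S y -> S (c *: x + y).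

Lemma linear_closedZ (V : lmodType R) (S : V -> Prop) c (x : V) :
  linear_closed_prop S -> S x -> S (c *: x).
Proof. by move=> [S0 SL] Sx; rewrite -[_ *: _]addr0; exact: SL. Qed.

Lemma linear_closedD (V : lmodType R) (S : V -> Prop) (x y : V) :
  linear_closed_prop S -> S x -> S y -> S (x + y).
Proof. by move=> [S0 SL] Sx Sy; rewrite -[x]scale1r; exact: SL. Qed.

Lemma linear_closedB (V : lmodType R) (S : V -> Prop) (x y : V) :
  linear_closed_prop S -> S x -> S y -> S (x - y).
Proof. by move=> [S0 SL] Sx Sy; rewrite addrC -scaleN1r; exact: SL. Qed.

Lemma linear_closed_sum (V : lmodType R) (S : V -> Prop) (I : Type) (r : seq I)
    (P : pred I) (F : I -> V) :
  linear_closed_prop S -> (forall i, P i -> S (F i)) ->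
  S (\sum_(i <- r | P i) F i).
Proof.
move=> Sl SF; apply: big_ind => //; first exact: Sl.1.
by move=> x y; exact: linear_closedD.
Qed.

(** A vector with two different coordinates minus its image by the transposition
    of these is a multiple of [e_i - e_j]. Its images by permutations are all
    the [e_k - e_l], and these together with [(1, ..., 1)] span the space. *)
Lemma permutation_module_full (S : 'rV[R]_n -> Prop) :
  linear_closed_prop S ->
  (forall x s, S x -> S (col_perm s x)) -> S (const_mx 1) ->
  forall c i j, S c -> c ord0 i != c ord0 j -> forall x, S x.
Proof.
move=> Sl Sp S1 c i j Sc cij x.
pose e k : 'rV[R]_n := delta_mx ord0 k.
have ij : i != j by apply: contraNneq cij => ->.
have eij : S (e i - e j).
  have := linear_closedB Sl Sc (Sp c (tperm i j) Sc).
  move=> /(linear_closedZ (c ord0 i - c ord0 j)^-1 Sl); congr S.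
  apply/rowP => k; rewrite !mxE eqxx/=.
  have [->|ki] := eqVneq k i; first by rewrite tpermL (negbTE ij) subr0 mulVf// subr_eq0.
  have [->|kj] := eqVneq k j.
    rewrite tpermR -[c _ j - _]opprB mulrN mulVf ?sub0r// subr_eq0//.
  by rewrite tpermD 1?eq_sym// subrr mulr0 subrr.
have ekl k l : S (e k - e l).
  have [->|kl] := eqVneq k l; first by rewrite subrr; exact: Sl.1.
  pose l' := tperm k i l.
  have l'i : i != l'.
    by rewrite -{1}(tpermL k i) (inj_eq perm_inj).
  pose s := (tperm k i * tperm l' j)%g.
  have sk : s k = i by rewrite permM tpermL tpermD// eq_sym.
  have sl : s l = j by rewrite permM tpermL.
  have := Sp _ s eij; congr S; apply/rowP => m; rewrite !mxE.
  by rewrite -{1}sk -{1}sl !(inj_eq perm_inj).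
rewrite (row_sum_delta x); apply: linear_closed_sum => // k _.
apply: linear_closedZ => //.
have n0 : n%:R != 0 :> R.
  by rewrite pnatr_eq0 -lt0n (leq_ltn_trans _ (ltn_ord k)).
rewrite (_ : delta_mx _ _ = n%:R^-1 *: (const_mx 1 + \sum_l (e k - e l))).
  by apply: linear_closedZ => //; apply: linear_closedD => //; exact: linear_closed_sum.
rewrite big_split/= sumr_const card_ord sumrN.
rewrite (_ : const_mx 1 = \sum_l e l); last first.
  rewrite (row_sum_delta (const_mx 1)); apply: eq_bigr => l _.
  by rewrite mxE scale1r.
by rewrite addrCA subrr addr0 -[e k *+ n]scaler_nat scalerA mulVf// scale1r.
Qed.

Definition wedge x y : 'M[R]_n := x^T *m y - y^T *m x.

Definition antisymmetric_mx A := A^T = - A.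

Lemma skewE A i j : antisymmetric_mx A -> A i j = - A j i.
Proof. by move=> /matrixP/(_ j i); rewrite !mxE. Qed.

Lemma skew_sum_wedge A : antisymmetric_mx A ->
  A = \sum_i wedge (delta_mx ord0 i) (2^-1 *: row i A).
Proof.
move=> sA; apply/matrixP => i j; rewrite summxE.
under eq_bigr => k _ do rewrite !mxE !big_ord1 !mxE eqxx/=.
rewrite sumrB (bigD1 i)//= eqxx mul1r big1 => [|k /negbTE ki]; last first.
  by rewrite eq_sym ki mul0r.
rewrite (bigD1 j)//= eqxx mulr1 big1 => [|k /negbTE kj]; last first.
  by rewrite eq_sym kj mulr0.
rewrite !addr0 (skewE j i sA); lra.
Qed.

Lemma wedgeDr x y z : wedge x (y + z) = wedge x y + wedge x z.
Proof. by rewrite /wedge mulmxDr [(y + z)^T]linearD/= mulmxDl opprD addrACA. Qed.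

Lemma wedgeZr c x y : wedge x (c *: y) = c *: wedge x y.
Proof. by rewrite /wedge -scalemxAr [(c *: y)^T]linearZ/= -scalemxAl scalerBr. Qed.

Lemma wedgeC x y : wedge x y = - wedge y x.
Proof. by rewrite /wedge opprB. Qed.

Lemma wedge_conj (g : 'M[R]_n) x y : g^T *m wedge x y *m g = wedge (x *m g) (y *m g).
Proof. by rewrite /wedge mulmxBr mulmxBl !trmx_mul !mulmxA. Qed.

Lemma wedge_linear_closed (L : 'M[R]_n -> Prop) :
  linear_closed_prop L ->
  linear_closed_prop (fun y => forall x, L (wedge x y)).
Proof.
move=> Ll; split=> [x|c y z Ly Lz x].
  by rewrite /wedge mulmx0 linear0 mul0mx subrr; exact: Ll.1.
by rewrite wedgeDr wedgeZr; exact: Ll.2.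
Qed.

Section invariant_skew_space.
Variables (H : 'M[R]_n -> Prop) (L : 'M[R]_n -> Prop).
Hypotheses (H_orth : forall g, H g -> orthogonalmx g)
  (H_tr : forall g, H g -> H g^T)
  (H_perm : forall s : 'S_n, H (perm_mx s))
  (L_lin : linear_closed_prop L)
  (L_skew : forall A, L A -> antisymmetric_mx A)
  (L_conj : forall g A, H g -> L A -> L (g^T *m A *m g)).

Let u : 'rV[R]_n := const_mx 1.

Lemma col_perm_mulmx (s : 'S_n) x : col_perm s x = x *m perm_mx s^-1.
Proof. by rewrite col_permE. Qed.

Lemma perm_conjE (s : 'S_n) A i j :
  ((perm_mx s^-1)^T *m A *m perm_mx s^-1) i j = A (s i) (s j).
Proof. by rewrite tr_perm_mx invgK -row_permE -col_permE !mxE. Qed.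

(** Averaging a matrix of [L] over the permutations that fix [i] yields a matrix
    of [L] invariant under them. Antisymmetry leaves no room for anything but a
    multiple of [wedge e_i u], and the multiple is not zero because row [i] of
    [A] does not sum to zero. *)
Lemma averaged_wedge i A : L A -> (u *m A) ord0 i != 0 ->
  L (wedge (delta_mx ord0 i) u).
Proof.
move=> LA uAi; have sA := L_skew LA.
(* Only the entries of row and column [i] survive in the average, and they are
   all equal up to sign. *)
pose M := \sum_(s : 'S_n | s i == i) (perm_mx s^-1)^T *m A *m perm_mx s^-1.
have LM : L M.
  apply: linear_closed_sum => // s _; apply: L_conj => //; exact: H_perm.
have ME a b : M a b = \sum_(s : 'S_n | s i == i) A (s a) (s b).
  by rewrite /M summxE; apply: eq_bigr => s _; rewrite perm_conjE.
have sM := L_skew LM.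
have Mtp a b k l : k != i -> l != i ->
    M a b = M (tperm k l a) (tperm k l b).
  move=> ki li; rewrite !ME (reindex_inj (mulgI (tperm k l))) /=.
  apply: eq_big => [s|s _]; last by rewrite !permM.
  by rewrite permM tpermD.
have M0 a b : a != i -> b != i -> M a b = 0.
  move=> ai bi; have := Mtp a b a b ai bi.
  by rewrite tpermL tpermR (skewE b a sM); lra.
have Mi a : a != i -> M i a = \sum_(s : 'S_n | s i == i) A i (s a).
  by move=> ai; rewrite ME; apply: eq_bigr => s /eqP ->.
have Mii : M i i = 0 by have := skewE i i sM; lra.
have Aii : A i i = 0 by have := skewE i i sA; lra.
have uA : (u *m A) ord0 i = - \sum_b A i b.
  rewrite mxE -sumrN; apply: eq_bigr => b _.
  by rewrite mxE mul1r (skewE b i sA).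
have [a ai Ma] : exists2 a, a != i & M i a != 0.
  apply: contrapT => h.
  have {}h b : M i b = 0.
    have [->//|bi] := eqVneq b i.
    by apply: contrapT => /eqP Mb; apply: h; exists b.
  have : \sum_b M i b = 0 by rewrite big1.
  under eq_bigr => b _.
    rewrite ME (eq_bigr (fun s : 'S_n => A i (s b))); last first.
      by move=> s /eqP ->.
    over.
  rewrite exchange_big/= (eq_bigr (fun=> \sum_b A i b)); last first.
    by move=> s _; rewrite [RHS](reindex_inj (@perm_inj _ s)).
  rewrite sumr_const -mulr_natr => /eqP; rewrite mulf_eq0 => /orP[|].
    by rewrite -oppr_eq0 -uA; apply/negP.
  apply/negP; rewrite pnatr_eq0 -lt0n; apply/card_gt0P; exists 1%g.
  by apply/eqP; rewrite perm1.
have := linear_closedZ (M i a)^-1 L_lin LM; congr L.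
have MiE b : b != i -> M i b = M i a.
  by move=> bi; rewrite (Mtp i a b a)// tpermR tpermD 1?eq_sym// eq_sym.
apply/matrixP => k l; rewrite !mxE !big_ord1 !mxE eqxx/= !mul1r mulr1.
have [->|ki] := eqVneq k i; have [->|li] := eqVneq l i.
- by rewrite Mii mulr0 subrr.
- by rewrite (MiE l)// mulVf//= mulr0n subr0.
- by rewrite (skewE k i sM) (MiE k)// mulrN mulVf//= mulr0n sub0r.
- by rewrite (M0 k l)// mulr0 subrr.
Qed.

(** Either some matrix of [L] does not kill [u = (1, ..., 1)]; then
    [averaged_wedge] puts [wedge x u] in [L] for all [x], and the set of the [y]
    with [wedge x y] in [L] for all [x] is an invariant subspace that contains
    [u] and [u g], hence everything. Or [u] belongs to the common kernel of
    [L]; this is an invariant subspace as well, so it is everything and [L] is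
    zero. *)
Lemma invariant_skew_space_full :
  (exists2 A, L A & A != 0) ->
  (exists g i j, H g /\ (u *m g) ord0 i != (u *m g) ord0 j) ->
  forall B, antisymmetric_mx B -> L B.
Proof.
move=> [A LA A0] [g [i [j [Hg gij]]]] B sB.
have [[C LC uC]|noC] := pselect (exists2 C, L C & u *m C != 0).
  pose W (y : 'rV[R]_n) := forall x, L (wedge x y).
  have Wl : linear_closed_prop W by exact: wedge_linear_closed.
  have WH (h : 'M[R]_n) y : H h -> W y -> W (y *m h).
    move=> Hh Wy x; have := L_conj Hh (Wy (x *m h^T)).
    by rewrite wedge_conj -mulmxA (orthogonalC (H_orth Hh)) mulmx1.
  have Wp y s : W y -> W (col_perm s y).
    by move=> Wy; rewrite col_perm_mulmx; apply: WH.
  have [k uCk] := rV0Pn _ uC.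
  have Wek l : L (wedge (delta_mx ord0 l) u).
    have := averaged_wedge LC uCk.
    move=> /(L_conj (H_perm (tperm k l))); rewrite wedge_conj; congr (L (wedge _ _)).
      apply/rowP => m; rewrite -rowE !mxE tpermL.
      by rewrite eqxx/= eq_sym.
    by rewrite -[tperm k l]invgK -col_perm_mulmx; apply/rowP => m; rewrite !mxE.
  have Wu : W u.
    move=> x; rewrite wedgeC -scaleN1r; apply: linear_closedZ => //.
    rewrite (row_sum_delta x).
    have := @linear_closed_sum _ (fun z => L (wedge u z)) _ (index_enum 'I_n) xpredT
      (fun l => x ord0 l *: delta_mx ord0 l).
    apply.
      split=> [|c y z Ly Lz]; first by rewrite /wedge mulmx0 linear0 mul0mx subrr; exact: L_lin.1.
      by rewrite wedgeDr wedgeZr; exact: L_lin.2.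
    move=> l _; rewrite wedgeZr; apply: linear_closedZ => //.
    by rewrite wedgeC -scaleN1r; exact: linear_closedZ.
  have Wall y : W y.
    exact: (permutation_module_full Wl Wp Wu (WH _ _ Hg Wu) gij).
  rewrite (skew_sum_wedge sB); apply: linear_closed_sum => // l _.
  exact: Wall.
pose K (y : 'rV[R]_n) := forall C, L C -> y *m C = 0.
have Kl : linear_closed_prop K.
  split=> [C _|c y z Ky Kz C LC]; first by rewrite mul0mx.
  by rewrite mulmxDl -scalemxAl Ky// Kz// scaler0 addr0.
have KH (h : 'M[R]_n) y : H h -> K y -> K (y *m h).
  move=> Hh Ky C LC; have := Ky _ (L_conj (H_tr Hh) LC).
  rewrite trmxK => /(congr1 (fun z => z *m h)); rewrite mul0mx.
  by rewrite !mulmxA -(mulmxA _ h^T) (orthogonalC (H_orth Hh)) mulmx1.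
have Kp y s : K y -> K (col_perm s y).
  by move=> Ky; rewrite col_perm_mulmx; apply: KH.
have Ku : K u.
  by move=> C LC; apply: contrapT => /eqP uC; apply: noC; exists C.
have Kall := permutation_module_full Kl Kp Ku (KH _ _ Hg Ku) gij.
move/eqP : A0; case; apply/row_matrixP => k.
by rewrite rowE Kall// row0.
Qed.

End invariant_skew_space.

End antisymmetric_mx.

(** * Differentiability from continuous partial derivatives *)

Section sup_norm.
Context {R : realType} (n : nat).
Implicit Types x y : 'rV[R]_n.

Lemma coord_le_norm x i : `|x ord0 i| <= `|x|.
Proof.
rewrite [leRHS]/Num.norm /= mx_normrE.
by apply: (le_bigmax_cond _ (fun ij : 'I_1 * 'I_n => `|x ij.1 ij.2|) (j := (ord0, i))).
Qed.

Lemma norm_le_coord x (r : R) :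
  0 <= r -> (forall i, `|x ord0 i| <= r) -> `|x| <= r.
Proof.
move=> r0 xr; rewrite [leLHS]/Num.norm /= mx_normrE.
by apply/bigmax_leP; split => // -[i j] _ /=; rewrite ord1.
Qed.

Lemma norm_le_sum x : `|x| <= \sum_i `|x ord0 i|.
Proof.
apply: norm_le_coord => [|i]; first exact: sumr_ge0.
by rewrite (bigD1 i)//= lerDl sumr_ge0.
Qed.

End sup_norm.

Section partial_derivatives.
Context {R : realType} (n : nat).
Implicit Types (G : 'rV[R]_n -> R) (x y z p : 'rV[R]_n).

Let e (j : 'I_n) : 'rV[R]_n := delta_mx ord0 j.

Lemma is_derive_line G p v (t : R) : derivable G (p + t *: v) v ->
  is_derive t 1 (fun s : R => G (p + s *: v)) ('D_v G (p + t *: v)).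
Proof.
move=> dG.
have E : (fun h : R => h^-1 *: (((fun s : R => G (p + s *: v)) \o shift t) (h *: 1) -
      G (p + t *: v))) =
    (fun h : R => h^-1 *: ((G \o shift (p + t *: v)) (h *: v) - G (p + t *: v))).
  apply/funext => h; congr (_ *: (G _ - _)).
  by rewrite /shift/= scalerDl addrCA [h *: 1]mulr1.
by split; rewrite /derivable /derive E.
Qed.

(** The mean value theorem along a coordinate line. *)
Lemma coordinate_increment G (c eps : R) p j (s : R) :
  (forall t, `|t| <= `|s| -> derivable G (p + t *: e j) (e j) /\
     `|'D_(e j) G (p + t *: e j) - c| <= eps) ->
  `|G (p + s *: e j) - G p - c * s| <= eps * `|s|.
Proof.
move=> dG; pose f (t : R) := G (p + t *: e j).
pose df (t : R) : R := 'D_(e j) G (p + t *: e j).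
have fd (t : R) : `|t| <= `|s| -> is_derive t 1 f (df t).
  by move=> ts; apply: is_derive_line; have [] := dG t ts.
have mvt (a b : R) : a <= b -> (forall t, t \in `[a, b] -> `|t| <= `|s|) ->
    exists2 t, `|t| <= `|s| & f b - f a = df t * (b - a).
  move=> ab abs; have [||t tab ->] := @MVT_segment _ f df a b ab.
  - by move=> t /subset_itv_oo_cc/abs; exact: fd.
  - by apply: derivable_within_continuous => t /abs/fd[].
  by exists t => //; exact: abs.
have fp : G p = f 0 by rewrite /f scale0r addr0.
have [t ts E] : exists2 t, `|t| <= `|s| & f s - f 0 = df t * s.
  have [s0|s0] := leP 0 s.
    have [|t ts E] := mvt 0 s s0; last by exists t; rewrite // E subr0.
    by move=> t; rewrite in_itv/= => /andP[t0 ts]; rewrite !ger0_norm// (le_trans t0).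
  have [|t ts E] := mvt s 0 (ltW s0).
    move=> t; rewrite in_itv/= => /andP[st t0].
    by rewrite !ler0_norm// ?lerN2// ltW.
  by exists t => //; rewrite -opprB E; ring.
rewrite fp -/(f s) E -mulrBl normrM ler_wpM2r//.
by have [] := dG t ts.
Qed.

(** The segment from [x] to [x + z] is replaced by a path along the coordinate
    axes, which stays in the same ball for the sup norm. *)
Lemma increment_bound G x (c : 'I_n -> R) (eps delta : R) :
  (forall y, `|y - x| < delta -> forall j, derivable G y (e j) /\
     `|'D_(e j) G y - c j| <= eps) ->
  forall z, `|z| < delta ->
    `|G (x + z) - G x - \sum_j c j * z ord0 j| <= eps * \sum_j `|z ord0 j|.
Proof.
move=> dG z zd.
pose zk (k : nat) : 'rV[R]_n := \row_(j < n) (if (j < k)%N then z ord0 j else 0).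
have H k : (k <= n)%N ->
  `|G (x + zk k) - G x - \sum_(j < n | (j < k)%N) c j * z ord0 j| <=
   eps * \sum_(j < n | (j < k)%N) `|z ord0 j|.
  elim: k => [_|k IHk kn].
    rewrite !big_pred0// subr0 mulr0 (_ : zk 0%N = 0) ?addr0 ?subrr ?normr0//.
    by apply/rowP => j; rewrite !mxE.
  pose k' := Ordinal kn.
  have sumk (f : 'I_n -> R) : \sum_(j < n | (j < k.+1)%N) f j =
      f k' + \sum_(j < n | (j < k)%N) f j.
    rewrite (bigD1 k')//=; congr (_ + _); apply: eq_bigl => j.
    by rewrite ltnS leq_eqVlt -val_eqE /=; case: ltngtP.
  rewrite !sumk mulrDr.
  have zkS : zk k.+1 = zk k + z ord0 k' *: e k'.
    apply/rowP => j; rewrite !mxE eqxx/= ltnS leq_eqVlt -val_eqE/=.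
    case: ltngtP => [jk|jk|jk]; rewrite ?mulr0 ?addr0//.
    by rewrite mulr1 add0r; congr (z _ _); exact/val_inj.
  have step : `|G (x + zk k + z ord0 k' *: e k') - G (x + zk k) - c k' * z ord0 k'|
      <= eps * `|z ord0 k'|.
    apply: coordinate_increment => t tz; apply: dG.
    apply: le_lt_trans zd.
    rewrite -[x + _ + _]addrA [x + _]addrC addrK.
    apply: norm_le_coord => // j; rewrite !mxE eqxx/=.
    apply: le_trans (coord_le_norm z j).
    have [->|jk] := eqVneq j k'; first by rewrite ltnn add0r mulr1.
    rewrite mulr0 addr0; case: ifP => // _; by rewrite normr0.
  rewrite zkS addrA.
  rewrite (_ : _ - _ = (G (x + zk k + z ord0 k' *: e k') - G (x + zk k) - c k' * z ord0 k') +
    (G (x + zk k) - G x - \sum_(j < n | (j < k)%N) c j * z ord0 j)); last by ring.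
  by rewrite (le_trans (ler_normD _ _))// lerD// IHk// ltnW.
have := H n (leqnn n).
rewrite (_ : zk n = z); last by apply/rowP => j; rewrite !mxE ltn_ord.
have sumn (f : 'I_n -> R) : \sum_(j < n | (j < n)%N) f j = \sum_j f j.
  by apply: eq_bigl => j; rewrite ltn_ord.
by rewrite !sumn.
Qed.

Lemma partials_near G x (eps : R) : 0 < eps ->
  (\forall y \near x, forall j, derivable G y (e j)) ->
  (forall j, {for x, continuous ('D_(e j) G)}) ->
  exists2 delta, 0 < delta & forall y, `|y - x| < delta -> forall j,
    derivable G y (e j) /\ `|'D_(e j) G y - 'D_(e j) G x| <= eps.
Proof.
move=> eps0 dG cdG.
have H j : \forall y \near x, `|'D_(e j) G y - 'D_(e j) G x| <= eps.
  by have /cvgr_distC_le := cdG j; apply.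
have HF : \forall y \near x, forall j, `|'D_(e j) G y - 'D_(e j) G x| <= eps.
  exact: (filter_forall (nbhs_filter x) H).
have : \forall y \near x, forall j, derivable G y (e j) /\
    `|'D_(e j) G y - 'D_(e j) G x| <= eps.
  by apply: filterS2 dG HF => y dGy Gy j; split; [exact: dGy|exact: Gy].
move=> /nbhs_ballP[delta /= d0 xd].
by exists delta => // y yx; apply: xd; rewrite -ball_normE /= distrC.
Qed.

Lemma partials_continuous G x :
  (\forall y \near x, forall j, derivable G y (e j)) ->
  (forall j, {for x, continuous ('D_(e j) G)}) -> {for x, continuous G}.
Proof.
move=> dG cdG.
have [delta d0 xd] := partials_near ltr01 dG cdG.
pose K := \sum_j `|'D_(e j) G x| + n%:R.
have K0 : 0 <= K by rewrite addr_ge0// sumr_ge0.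
have lip z : `|z| < delta -> `|G (x + z) - G x| <= K * `|z|.
  move=> zd; have := increment_bound xd zd; rewrite mul1r => H.
  rewrite -[G (x + z) - G x](subrK (\sum_j 'D_(e j) G x * z ord0 j)).
  rewrite (le_trans (ler_normD _ _))// /K mulrDl addrC lerD//.
    rewrite (le_trans (ler_norm_sum _ _ _))// mulr_suml ler_sum// => j _.
    by rewrite normrM ler_wpM2l// coord_le_norm.
  rewrite (le_trans H)// -[n in n%:R]card_ord mulr_natl -sumr_const ler_sum// => j _.
  exact: coord_le_norm.
apply/(@cvgrPdist_le _ _ _ _ (nbhs_filter x)) => eps eps0; apply/nbhs_ballP.
exists (Num.min delta (eps / (K + 1))) => /=.
  by rewrite lt_min d0 divr_gt0// ltr_wpDl.
move=> y; rewrite -ball_normE /= distrC lt_min => /andP[yd ye].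
have := lip _ yd; rewrite (addrC x) subrK distrC => /le_trans; apply.
apply: (@le_trans _ _ ((K + 1) * `|y - x|)).
  by rewrite ler_wpM2r// lerDl.
by rewrite mulrC -ler_pdivlMr ?ltr_wpDl// ltW.
Qed.

(** The chain rule with a linear map calls for derivatives along vectors that are
    not coordinate vectors, of which [C2_on] does not speak. *)
Lemma is_derive_partials G x v :
  (\forall y \near x, forall j, derivable G y (e j)) ->
  (forall j, {for x, continuous ('D_(e j) G)}) ->
  is_derive x v G (\sum_j v ord0 j * 'D_(e j) G x).
Proof.
move=> dG cdG; set D := \sum_j _.
have E : (fun h : R => h^-1 *: ((G \o shift x) (h *: v) - G x)) @ 0^' --> D.
  pose S := \sum_j `|v ord0 j| + 1.
  have S0 : 0 < S by rewrite ltr_wpDl// sumr_ge0.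
  apply/cvgrPdist_le => eps eps0.
  have [delta d0 xd] := partials_near (divr_gt0 eps0 S0) dG cdG.
  apply/nbhs_ballP; exists (delta / S) => /=; first by rewrite divr_gt0.
  move=> h; rewrite -ball_normE /= sub0r normrN => hd h0.
  have hv : `|h *: v| < delta.
    rewrite normrZ; apply: (@le_lt_trans _ _ (`|h| * S)).
      by rewrite ler_wpM2l// (le_trans (norm_le_sum v))// lerDl.
    by rewrite -ltr_pdivlMr.
  have := increment_bound xd hv.
  have -> : \sum_j 'D_(e j) G x * (h *: v) ord0 j = h * D.
    by rewrite /D mulr_sumr; apply: eq_bigr => j _; rewrite mxE; ring.
  have -> : \sum_j `|(h *: v) ord0 j| = `|h| * \sum_j `|v ord0 j|.
    by rewrite mulr_sumr; apply: eq_bigr => j _; rewrite mxE normrM.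
  move=> H; rewrite distrC.
  rewrite (_ : _ - D = h^-1 * (G (x + h *: v) - G x - h * D)); last first.
    by rewrite [RHS]mulrBr mulKf// (addrC x).
  rewrite normrM normfV ler_pdivrMl ?normr_gt0//; apply: (le_trans H).
  rewrite mulrCA ler_wpM2l// mulrAC ler_pdivrMr// ler_wpM2l ?(ltW eps0)//.
  by rewrite lerDl.
by split; [apply/cvg_ex; exists D|exact: cvg_lim].
Qed.

End partial_derivatives.

Section punctured_space.
Context {R : realType} (n : nat).

Lemma near_punctured (x : 'rV[R]_n) : x != 0 -> \forall y \near x, y != 0.
Proof.
move=> x0; apply/nbhs_ballP; exists `|x| => /=; first by rewrite normr_gt0.
move=> y; rewrite -ball_normE /=; apply: contraTneq => ->.
by rewrite subr0 ltxx.
Qed.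

Lemma derive_comp_linear (G : 'rV[R]_n -> R) (h : 'M[R]_n) x v D :
  is_derive (x *m h) (v *m h) G D -> is_derive x v (fun y => G (y *m h)) D.
Proof.
move=> dG.
have E : (fun t : R => t^-1 *: (((fun y => G (y *m h)) \o shift x) (t *: v) -
      G (x *m h))) =
    (fun t : R => t^-1 *: ((G \o shift (x *m h)) (t *: (v *m h)) - G (x *m h))).
  by apply/funext => t; rewrite /= /shift /= mulmxDl -scalemxAl.
by case: dG => dG DG; split; rewrite /derivable /derive E.
Qed.

Lemma continuous_mulmx (h : 'M[R]_n) (x : 'rV[R]_n) :
  {for x, continuous (fun y : 'rV[R]_n => y *m h)}.
Proof.
pose K := \sum_j \sum_i `|h i j| + 1.
have K0 : 0 < K by rewrite ltr_wpDl// sumr_ge0// => j _; rewrite sumr_ge0.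
apply/(@cvgrPdist_le _ _ _ _ (nbhs_filter x)) => eps eps0; apply/nbhs_ballP.
exists (eps / K) => /=; first by rewrite divr_gt0.
move=> y; rewrite -ball_normE /= => xy.
rewrite -mulmxBl; set z := x - y in xy *.
apply: (@le_trans _ _ (K * `|z|)); last first.
  by rewrite mulrC -ler_pdivlMr// ltW.
apply: norm_le_coord => [|j]; first by rewrite mulr_ge0// ltW.
rewrite mxE (le_trans (ler_norm_sum _ _ _))//.
apply: (@le_trans _ _ ((\sum_i `|h i j|) * `|z|)).
  rewrite mulr_suml ler_sum// => i _; rewrite normrM mulrC ler_wpM2l//.
  exact: coord_le_norm.
rewrite ler_wpM2r// /K [leRHS](_ : _ = \sum_i `|h i j| + (\sum_(k | k != j) \sum_i `|h i k| + 1)); last first.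
  by rewrite (bigD1 j)//= -addrA.
rewrite lerDl addr_ge0// sumr_ge0// => k _.
by rewrite sumr_ge0.
Qed.

Lemma continuous_sum_at (T : topologicalType) (I : finType) (f : I -> T -> R) (x : T) :
  (forall i, {for x, continuous (f i)}) ->
  {for x, continuous (fun y => \sum_i f i y)}.
Proof.
move=> fc; elim: (index_enum I) => [|i r IHr].
  rewrite (_ : (fun y => _) = cst 0); first exact: cst_continuous.
  by apply/funext => y; rewrite big_nil.
rewrite (_ : (fun y => _) = fun y => f i y + \sum_(j <- r) f j y).
  by apply: continuousD => //; exact: fc.
by apply/funext => y; rewrite big_cons.
Qed.

(** The trace of [h G h^T], with the sums in the order in which the chain rule
    produces them. *)
Lemma trace_orthogonal (G : 'I_n -> 'I_n -> R) (h : 'M[R]_n) :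
  orthogonalmx h ->
  \sum_i \sum_j h i j * (\sum_m h i m * G m j) = \sum_j G j j.
Proof.
move=> oh; rewrite exchange_big/=; apply: eq_bigr => j _.
under eq_bigr => i _ do rewrite mulr_sumr.
rewrite exchange_big/= (bigD1 j)//=.
have hh m : \sum_i h i j * h i m = (j == m)%:R.
  have /matrixP/(_ j m) := orthogonalC oh; rewrite !mxE => <-.
  by apply: eq_bigr => i _; rewrite mxE.
have hE m : \sum_i h i j * (h i m * G m j) = (j == m)%:R * G m j.
  by rewrite -hh mulr_suml; apply: eq_bigr => i _; rewrite mulrA.
rewrite hE eqxx mul1r big1 ?addr0// => m mj.
by rewrite hE eq_sym (negbTE mj) mul0r.
Qed.

End punctured_space.

(** * Spherical harmonics and rotations *)

Section harmonics.
Context {R : realType}.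
Implicit Types (F f : 'rV[R]_3 -> R) (x y : 'rV[R]_3) (h : 'M[R]_3).

Let U : set 'rV[R]_3 := [set x | x != 0].

(** The definition of [C2_on] asks for continuity of the second derivatives only;
    that of the lower ones follows. *)
Lemma C2_partial_continuous F x i :
  C2_on U F -> x != 0 -> {for x, continuous (partial i F)}.
Proof.
move=> C2F x0; apply: partials_continuous => [|j].
  near=> y => j; have y0 : U y by near: y; exact: near_punctured.
  by have [_ d _] := C2F y y0 i j; exact: d.
by have [_ _ d] := C2F x x0 i j; exact: d.
Unshelve. all: by end_near. Qed.

Lemma C2_continuous F x : C2_on U F -> x != 0 -> {for x, continuous F}.
Proof.
move=> C2F x0; apply: partials_continuous => [|j].
  near=> y => j; have y0 : U y by near: y; exact: near_punctured.
  by have [d _ _] := C2F y y0 j j; exact: d.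
exact: C2_partial_continuous.
Unshelve. all: by end_near. Qed.

Lemma C2_is_derive F x v : C2_on U F -> x != 0 ->
  is_derive x v F (\sum_j v ord0 j * partial j F x).
Proof.
move=> C2F x0; apply: is_derive_partials => [|j]; last exact: C2_partial_continuous.
near=> y => j; have y0 : U y by near: y; exact: near_punctured.
by have [d _ _] := C2F y y0 j j; exact: d.
Unshelve. all: by end_near. Qed.

Lemma C2_is_derive_partial F x v i : C2_on U F -> x != 0 ->
  is_derive x v (partial i F) (\sum_j v ord0 j * partial j (partial i F) x).
Proof.
move=> C2F x0; apply: is_derive_partials => [|j].
  near=> y => j; have y0 : U y by near: y; exact: near_punctured.
  by have [_ d _] := C2F y y0 i j; exact: d.
by have [_ _ d] := C2F x x0 i j; exact: d.
Unshelve. all: by end_near. Qed.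

Lemma delta_mulmx h (i j : 'I_3) : (delta_mx ord0 i *m h : 'rV[R]_3) ord0 j = h i j.
Proof. by rewrite -rowE mxE. Qed.

Lemma mulmx_orthogonal_neq0 h x : orthogonalmx h -> x != 0 -> x *m h != 0.
Proof. by move=> oh; rewrite -!enorm_gt0 enorm_orthogonal. Qed.

Section compose.
Variables (F : 'rV[R]_3 -> R) (h : 'M[R]_3).
Hypotheses (C2F : C2_on U F) (oh : orthogonalmx h).

Let Fh x := F (x *m h).

Let is_derive_Fh x i : x != 0 ->
  is_derive x (delta_mx ord0 i) Fh (\sum_j h i j * partial j F (x *m h)).
Proof.
move=> x0; apply: derive_comp_linear.
under eq_bigr => j _ do rewrite -delta_mulmx.
by apply: C2_is_derive => //; exact: mulmx_orthogonal_neq0.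
Qed.

Let partial_Fh x i : x != 0 ->
  partial i Fh x = \sum_j h i j * partial j F (x *m h).
Proof. by move=> x0; rewrite /partial; have [] := is_derive_Fh i x0. Qed.

Let is_derive_partial_Fh x i k : x != 0 ->
  is_derive x (delta_mx ord0 k) (partial i Fh)
    (\sum_j h i j * \sum_m h k m * partial m (partial j F) (x *m h)).
Proof.
move=> x0.
apply: (@near_eq_is_derive _ _ _ (fun y => \sum_j h i j * partial j F (y *m h))).
  near=> y; rewrite partial_Fh//; near: y; exact: near_punctured.
rewrite (_ : (fun y => _) = \sum_(j < 3) (fun y => h i j * partial j F (y *m h))).
  apply: is_derive_sum => j.
  apply: is_deriveZ; apply: derive_comp_linear.
  under eq_bigr => m _ do rewrite -delta_mulmx.
  by apply: C2_is_derive_partial => //; exact: mulmx_orthogonal_neq0.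
by apply/funext => y; rewrite fct_sumE.
Unshelve. all: by end_near. Qed.

Let partial2_Fh x i k : x != 0 -> partial k (partial i Fh) x =
  \sum_j h i j * \sum_m h k m * partial m (partial j F) (x *m h).
Proof.
by move=> x0; rewrite {1}/partial; have [] := is_derive_partial_Fh i k x0.
Qed.

Lemma C2_on_mulmx : C2_on U (fun x => F (x *m h)).
Proof.
move=> x x0 i j; split.
- by have [d _] := is_derive_Fh i x0; exact: d.
- by have [d _] := is_derive_partial_Fh i j x0; exact: d.
- pose Q j0 m y := partial m (partial j0 F) (y *m h).
  have cQ j0 m : {for x, continuous (Q j0 m)}.
    apply: continuous_comp; first exact: continuous_mulmx.
    by have [_ _ d] := C2F (mulmx_orthogonal_neq0 oh x0) j0 m; exact: d.
  have cS : {for x, continuous (fun y => \sum_k h i k * \sum_m h j m * Q k m y)}.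
    apply: continuous_sum_at => k; apply: continuousM; first exact: cst_continuous.
    apply: continuous_sum_at => m; apply: continuousM; first exact: cst_continuous.
    exact: cQ.
  suff : partial j (partial i Fh) y @[y --> x] --> partial j (partial i Fh) x by exact.
  rewrite (partial2_Fh i j x0).
  apply: cvg_trans cS.
  apply: (@near_eq_cvg _ _ _ (nbhs_filter x)).
  apply: filterS (near_punctured x0) => y y0.
  exact/esym/partial2_Fh.
Qed.

(** The Laplacian is the trace of the Hessian, which an orthogonal change of
    variables conjugates. *)
Lemma laplacian_mulmx x : x != 0 ->
  \sum_(i < 3) partial i (partial i (fun x => F (x *m h))) x =
  \sum_(i < 3) partial i (partial i F) (x *m h).
Proof.
move=> x0; transitivity (\sum_(i < 3) \sum_j h i j *
    \sum_m h i m * partial m (partial j F) (x *m h)).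
  apply: eq_bigr => i _; exact: (partial2_Fh i i x0).
exact: (trace_orthogonal (fun m j => partial m (partial j F) (x *m h)) oh).
Qed.

End compose.

Lemma hom0_ext_mulmx f h : orthogonalmx h ->
  hom0_ext (fun x => f (x *m h)) = fun x => hom0_ext f (x *m h).
Proof.
by move=> oh; apply/funext => x; rewrite /hom0_ext enorm_orthogonal// scalemxAl.
Qed.

Lemma spherical_harmonic_mulmx l f h : orthogonalmx h ->
  spherical_harmonic l f -> spherical_harmonic l (fun x => f (x *m h)).
Proof.
move=> oh [C2f Lf]; have E := hom0_ext_mulmx f oh.
split.
  by rewrite E; exact: (C2_on_mulmx C2f oh).
move=> x xS; have x0 : x != 0 by rewrite -enorm_gt0 xS.
rewrite /laplace_beltrami E (laplacian_mulmx C2f oh x0).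
by apply: Lf; rewrite /sphere /= enorm_orthogonal.
Qed.

End harmonics.

(** * Harmonics with finitely many values *)

Section finite_range.
Context {R : realType} (n : nat).

(** Where the difference quotients converge the function is continuous along the
    line, and, its values being isolated, constant near the point. *)
Lemma derive_finite_range (G : 'rV[R]_n -> R) x v :
  finite_set (range G) -> derivable G x v -> 'D_v G x = 0.
Proof.
move=> fG dG; pose q (h : R) := h^-1 *: ((G \o shift x) (h *: v) - G x).
pose V := range G `\ G x.
have oV : open (~` V).
  apply: closed_openC; have acc := hausdorff_accessible (@norm_hausdorff _ R).
  move/accessible_finite_set_closed : acc; apply.
  exact: finite_setD.
have cG : G (h *: v + x) @[h --> 0^'] --> G x.
  have : h * q h + G x @[h --> 0^'] --> 0 * 'D_v G x + G x.
    apply: cvgD; last exact: cvg_cst.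
    apply: cvgM; last exact: dG.
    exact: (@nbhs_dnbhs _ (0 : R)).
  rewrite mul0r add0r; apply: cvg_trans; apply: near_eq_cvg.
  near=> h; rewrite /q /GRing.scale/= mulVKf ?subrK//.
  by near: h; exact: nbhs_dnbhs_neq.
have q0 : \forall h \near 0^', q h = 0.
  have : \forall h \near 0^', (~` V) (G (h *: v + x)).
    have nV : nbhs (G x) (~` V) by apply: open_nbhs_nbhs; split => // -[_]; apply.
    exact: (cG _ nV).
  apply: filterS => h nV; rewrite /q (_ : (G \o shift x) (h *: v) = G x).
    by rewrite subrr scaler0.
  by apply: contrapT => GG; apply: nV; split => //; exists (h *: v + x).
by apply: cvg_lim => //; apply: cvg_near_cst.
Unshelve. all: by end_near. Qed.

End finite_range.

Section harmonics_finite_range.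
Context {R : realType}.

(** The homogeneous extension takes finitely many values too, so its first and
    second derivatives vanish, and the eigenvalue [l (l + 1)] is not zero. *)
Lemma harmonic_finite_range l (f : 'rV[R]_3 -> R) : (0 < l)%N ->
  spherical_harmonic l f -> finite_set (f @` @sphere R 3) ->
  forall x, sphere x -> f x = 0.
Proof.
move=> l0 [C2f Lf] ff x xS.
have x0 : x != 0 by rewrite -enorm_gt0 xS.
set F := hom0_ext f in C2f.
have rF : finite_set (range F).
  apply: (@sub_finite_set _ _ (f @` @sphere R 3 `|` [set f 0])); last first.
    by rewrite finite_setU; split => //; exact: finite_set1.
  move=> _ [y _ <-]; have [->|y0] := eqVneq y 0.
    by right; rewrite /F /hom0_ext scaler0.
  by left; exists ((enorm y)^-1 *: y) => //; exact: enorm_normalize.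
have dF y i : y != 0 -> partial i F y = 0.
  move=> y0; have [d _ _] := C2f y y0 i i.
  exact: derive_finite_range.
have d2F i : partial i (partial i F) x = 0.
  rewrite /partial; rewrite (@near_eq_derive _ _ _ _ (cst 0)) ?derive_cst//.
  by apply: filterS (near_punctured x0) => y y0; exact: dF.
have := Lf x xS; rewrite /laplace_beltrami big1//.
move=> /esym/eqP; rewrite mulf_eq0 oppr_eq0 pnatr_eq0 muln_eq0/= orbF.
by rewrite (gtn_eqF l0)/= => /eqP.
Qed.

End harmonics_finite_range.

(** * Measurability and linearity of harmonics *)

Section open_measurable.
Context {R : realType} (n : nat).

(** Every point of an open set lies in a cube with rational centre and radius
    [1/k] contained in it, and there are countably many such cubes. *)
Lemma open_measurable_rV (U : set 'rV[R]_n) : open U -> measurable U.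
Proof.
move=> oU.
pose box (q : 'rV[rat]_n) (k : nat) : set 'rV[R]_n :=
  \bigcap_(i in [set: 'I_n])
    ((fun y : 'rV[R]_n => y ord0 i) @^-1` `](ratr (q ord0 i) - k.+1%:R^-1), (ratr (q ord0 i) + k.+1%:R^-1)[%classic).
have mbox q k : measurable (box q k).
  apply: fin_bigcap_measurable => // i _.
  by apply: measurable_preimage => //; exact: measurable_coord.
pose I := ('rV[rat]_n * nat)%type.
have -> : U = \bigcup_(i in [set i : I | box i.1 i.2 `<=` U]) box i.1 i.2.
  apply/seteqP; split=> [y Uy|y [i /=]]; last exact.
  have /nbhs_ballP[d /= d0 dU] : nbhs y U by exact: open_nbhs_nbhs.
  pose k := Num.truncn (2 / d).
  have k0 : 0 < k.+1%:R^-1 :> R by rewrite invr_gt0 ltr0n.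
  have kd : 2 * k.+1%:R^-1 < d.
    rewrite ltr_pdivrMr ?ltr0n// mulrC -ltr_pdivrMr//.
    exact: truncnS_gt.
  pose r : R := k.+1%:R^-1.
  have qex i : exists q : rat, (y ord0 i - r < ratr q < y ord0 i + r).
    have [|q qi] := @rat_in_itvoo R (y ord0 i - r) (y ord0 i + r).
      by rewrite ltrBlDr -addrA ltrDl addr_gt0.
    by exists q; move: qi; rewrite in_itv.
  have [q Hq] := choice qex.
  exists (\row_i q i, k) => /=; last first.
    move=> i _ /=; rewrite mxE in_itv/= -/r.
    by have /andP[h1 h2] := Hq i; apply/andP; split; lra.
  move=> z zb; apply: dU; rewrite -ball_normE /=.
  apply: le_lt_trans kd; apply: norm_le_coord => [|i]; first by rewrite mulr_ge0// ltW.
  have := zb i Logic.I; have := Hq i; rewrite /= !mxE !in_itv/= -/r => /andP[h1 h2] /andP[h3 h4].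
  rewrite ler_norml; apply/andP; split; lra.
rewrite bigcup_mkcond; apply: countable_bigcupT_measurable => [|i].
  exact: countableP.
by case: ifP.
Qed.

Lemma measurable_fun_continuous_on (D : set 'rV[R]_n) (f : 'rV[R]_n -> R) :
  open D -> (forall x, D x -> {for x, continuous f}) -> measurable_fun D f.
Proof.
move=> oD cf; apply: (@measurability _ _ _ _ D f _ (RGenOpens.measurableE R)) => _ [_ [a [b ->]] <-].
apply: open_measurable_rV; rewrite openE => x [Dx Vx].
apply: filterI; first exact: open_nbhs_nbhs.
by apply: (cf x Dx); apply: open_nbhs_nbhs; split => //; exact: itv_open.
Qed.

End open_measurable.

Section harmonic_space.
Context {R : realType} (l : nat).
Implicit Types f g : 'rV[R]_3 -> R.

Let U : set 'rV[R]_3 := [set x | x != 0].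

Lemma hom0_ext_sphere f x : sphere x -> hom0_ext f x = f x.
Proof. by rewrite /sphere /hom0_ext /= => ->; rewrite invr1 scale1r. Qed.

Lemma harmonic_measurable f : spherical_harmonic l f -> measurable_fun (@sphere R 3) f.
Proof.
move=> [C2f _].
have mU : measurable_fun U (hom0_ext f).
  apply: measurable_fun_continuous_on => [|x x0].
    rewrite openE => x x0; exact: near_punctured.
  exact: (C2_continuous C2f).
apply: (eq_measurable_fun (hom0_ext f)).
  by move=> x; rewrite inE; exact: hom0_ext_sphere.
apply: measurable_funS mU.
  by apply: open_measurable_rV; rewrite openE => x x0; exact: near_punctured.
by move=> x xS; rewrite /U /= -enorm_gt0 xS.
Qed.

Let is_derive_ZD a (F G : 'rV[R]_3 -> R) x v DF DG :
  is_derive x v F DF -> is_derive x v G DG ->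
  is_derive x v (fun y => a * F y + G y) (a * DF + DG).
Proof. by move=> dF dG; exact: is_deriveD. Qed.

Lemma spherical_harmonicZD a f g : spherical_harmonic l f ->
  spherical_harmonic l g -> spherical_harmonic l (fun x => a * f x + g x).
Proof.
move=> [C2f Lf] [C2g Lg].
pose F := hom0_ext f; pose G := hom0_ext g.
have pE x i : x != 0 ->
    partial i (fun y => a * F y + G y) x = a * partial i F x + partial i G x.
  move=> x0; have [df _ _] := C2f x x0 i i; have [dg _ _] := C2g x x0 i i.
  have [_] := is_derive_ZD a (DeriveDef df erefl) (DeriveDef dg erefl).
  exact.
have dpE x i j : x != 0 -> is_derive x (delta_mx ord0 j)
    (partial i (fun y => a * F y + G y))
    (a * partial j (partial i F) x + partial j (partial i G) x).
  move=> x0; have [_ df _] := C2f x x0 i j; have [_ dg _] := C2g x x0 i j.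
  have := is_derive_ZD a (DeriveDef df erefl) (DeriveDef dg erefl).
  apply: near_eq_is_derive; apply: filterS (near_punctured x0) => y y0.
  exact/esym/pE.
have ppE x i j : x != 0 -> partial j (partial i (fun y => a * F y + G y)) x =
    a * partial j (partial i F) x + partial j (partial i G) x.
  by move=> x0; have [_ d] := dpE x i j x0; exact: d.
split.
  move=> x x0 i j; split.
  - have [df _ _] := C2f x x0 i i; have [dg _ _] := C2g x x0 i i.
    have [d _] := is_derive_ZD a (DeriveDef df erefl) (DeriveDef dg erefl).
    exact: d.
  - by have [d _] := dpE x i j x0; exact: d.
  - have [_ _ cf] := C2f x x0 i j; have [_ _ cg] := C2g x x0 i j.
    have cS : {for x, continuous
        (fun y => a * partial j (partial i F) y + partial j (partial i G) y)}.
      apply: continuousD; last exact: cg.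
      by apply: continuousM; [exact: cst_continuous|exact: cf].
    suff : partial j (partial i (fun y => a * F y + G y)) y @[y --> x] -->
      partial j (partial i (fun y => a * F y + G y)) x by exact.
    rewrite (ppE x i j x0); apply: cvg_trans cS.
    apply: (@near_eq_cvg _ _ _ (nbhs_filter x)).
    by apply: filterS (near_punctured x0) => y y0; exact/esym/ppE.
move=> x xS; have x0 : x != 0 by rewrite -enorm_gt0 xS.
have -> : laplace_beltrami (fun x => a * f x + g x) x =
    a * laplace_beltrami f x + laplace_beltrami g x.
  rewrite /laplace_beltrami mulr_sumr -big_split/=; apply: eq_bigr => i _.
  exact: ppE.
by rewrite Lf// Lg//; ring.
Qed.

Lemma spherical_harmonic0 : spherical_harmonic l (fun _ : 'rV[R]_3 => 0).
Proof.
have pE i : partial i (cst 0 : 'rV[R]_3 -> R) = cst 0.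
  by apply/funext => x; exact: derive_cst.
split.
  move=> x x0 i j; rewrite (_ : hom0_ext _ = cst 0)// !pE; split.
  - exact: derivable_cst.
  - exact: derivable_cst.
  - exact: cst_continuous.
move=> x xS; rewrite /laplace_beltrami (_ : hom0_ext _ = cst 0)// mulr0.
by rewrite big1// => i _; rewrite !pE.
Qed.

End harmonic_space.

Section Rintegral_sum.
Context d (T : measurableType d) (R : realType) (mu : {measure set T -> \bar R}).
Context (D : set T) (mD : measurable D) (I : finType).

Let sum_aux (f : I -> T -> R) : (forall i, mu.-integrable D (EFin \o f i)) ->
  mu.-integrable D (EFin \o (fun x => \sum_i f i x)) /\
  \int[mu]_(x in D) (\sum_i f i x) = \sum_i \int[mu]_(x in D) f i x.
Proof.
move=> fi; elim: (index_enum I) => [|i r [IH1 IH2]].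
  rewrite (_ : EFin \o _ = cst 0%E); last first.
    by apply/funext => x; rewrite /= big_nil.
  split; first exact: integrable0.
  rewrite (@eq_Rintegral _ _ _ _ _ (fun=> 0)) ?Rintegral_cst ?mul0r ?big_nil//.
  by move=> x _; rewrite big_nil.
have E0 : (fun x => \sum_(j <- i :: r) f j x) =
    (fun x => f i x + \sum_(j <- r) f j x).
  by apply/funext => x; rewrite big_cons.
rewrite E0 big_cons -IH2 -RintegralD//; split => //.
exact: (integrableD mD (fi i) IH1).
Qed.

Lemma integrable_sum_fin (f : I -> T -> R) :
  (forall i, mu.-integrable D (EFin \o f i)) ->
  mu.-integrable D (EFin \o (fun x => \sum_i f i x)).
Proof. by move=> fi; have [] := sum_aux fi. Qed.

Lemma Rintegral_sum (f : I -> T -> R) :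
  (forall i, mu.-integrable D (EFin \o f i)) ->
  \int[mu]_(x in D) (\sum_i f i x) = \sum_i \int[mu]_(x in D) f i x.
Proof. by move=> fi; have [] := sum_aux fi. Qed.

End Rintegral_sum.

Section harmonic_basis.
Context {R : realType} (l : nat) (Y : 'I_(2 * l).+1 -> 'rV[R]_3 -> R).
Hypothesis hY : orthonormal_harmonic_basis l Y.

Local Notation n := (2 * l).+1.
Local Notation sigma := (@surface_measure R 3).
Local Notation S := (@sphere R 3).

Definition harmonic_vector (x : 'rV[R]_3) : 'rV[R]_n := \row_m Y m x.

Let mS : measurable S := @measurable_sphere R 3.

Lemma measurable_basis m : measurable_fun S (Y m).
Proof. by case: hY => H _ _; exact: harmonic_measurable (H m). Qed.

Lemma integrable_basis m : sigma.-integrable S (EFin \o (fun x => Y m x * Y m x)).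
Proof.
apply/integrableP; split.
  by apply/measurable_EFinP; apply: measurable_funM; exact: measurable_basis.
have [_ + _] := hY => /(_ m m); rewrite eqxx => E.
rewrite (eq_integral (fun x => (Y m x * Y m x)%:E)).
  by rewrite E ltry.
by move=> x _; rewrite /= ger0_norm// -expr2 sqr_ge0.
Qed.

Lemma integrable_basisM m m' : sigma.-integrable S (EFin \o (fun x => Y m x * Y m' x)).
Proof.
have := integrableD mS (integrable_basis m) (integrable_basis m').
apply: le_integrable => //.
  by apply/measurable_EFinP; apply: measurable_funM; exact: measurable_basis.
move=> x _; rewrite /= lee_fin.
rewrite (ger0_norm (_ : 0 <= Y m x * Y m x + Y m' x * Y m' x)); last first.
  by rewrite addr_ge0// -expr2 sqr_ge0.
by rewrite ler_norml; apply/andP; split; nra.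
Qed.

Lemma Rintegral_basisM m m' : \int[sigma]_(x in S) (Y m x * Y m' x) = (m == m')%:R.
Proof. by case: hY => _ H _; rewrite /Rintegral H. Qed.

Lemma Rintegral_basis_comb (a b : 'rV[R]_n) :
  \int[sigma]_(x in S) (dot a (harmonic_vector x) * dot b (harmonic_vector x)) = dot a b.
Proof.
have E x : dot a (harmonic_vector x) * dot b (harmonic_vector x) =
    \sum_m \sum_m' a ord0 m * b ord0 m' * (Y m x * Y m' x).
  rewrite /dot mulr_suml; apply: eq_bigr => m _.
  by rewrite mulr_sumr; apply: eq_bigr => m' _; rewrite !mxE; ring.
have int2 m m' : sigma.-integrable S
    (EFin \o (fun x => a ord0 m * b ord0 m' * (Y m x * Y m' x))).
  by have := integrableZl mS (a ord0 m * b ord0 m') (integrable_basisM m m').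
have int1 m : sigma.-integrable S
    (EFin \o (fun x => \sum_m' a ord0 m * b ord0 m' * (Y m x * Y m' x))).
  exact: (integrable_sum_fin mS (int2 m)).
rewrite (@eq_Rintegral _ _ _ _ _ (fun x => \sum_m \sum_m' a ord0 m * b ord0 m' * (Y m x * Y m' x))); last first.
  by move=> x _; rewrite E.
rewrite (Rintegral_sum mS int1); apply: eq_bigr => m _.
rewrite (Rintegral_sum mS (int2 m)) (bigD1 m)//=.
rewrite RintegralZl//; last exact: integrable_basisM.
rewrite Rintegral_basisM eqxx mulr1 big1 ?addr0// => m' m'm.
rewrite RintegralZl//; last exact: integrable_basisM.
by rewrite Rintegral_basisM eq_sym (negbTE m'm) mulr0.
Qed.

(** The functions [Y_m (x g)] are harmonics, so they have coordinates in the
    basis; the matrix of these is orthogonal since both families are orthonormal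
    in the same inner product, by invariance of the surface measure. *)
Lemma rotation_matrix (g : 'M[R]_3) : orthogonalmx g ->
  exists2 D : 'M[R]_n, orthogonalmx D &
    forall x, sphere x -> harmonic_vector (x *m g) = harmonic_vector x *m D.
Proof.
move=> og; have [Ysh Yon Ysp] := hY.
have /choice[c Hc] : forall m, exists c : 'I_n -> R,
    forall x, sphere x -> Y m (x *m g) = \sum_k c k * Y k x.
  by move=> m; apply: Ysp; exact: spherical_harmonic_mulmx.
pose D : 'M[R]_n := \matrix_(k, m) c m k.
have DE x : sphere x -> harmonic_vector (x *m g) = harmonic_vector x *m D.
  move=> xS; apply/rowP => m; rewrite !mxE Hc//; apply: eq_bigr => k _.
  by rewrite !mxE mulrC.
exists D => //; rewrite -[D]trmxK; apply: orthogonalT; rewrite /orthogonalmx trmxK.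
apply/matrixP => m m'; rewrite [RHS]mxE -Rintegral_basisM.
have -> : (D^T *m D) m m' = dot (row m D^T) (row m' D^T).
  by rewrite mxE; apply: eq_bigr => k _; rewrite !mxE.
rewrite -Rintegral_basis_comb /Rintegral; congr fine.
rewrite -[RHS](integral_sphere_orthogonal (g := g))//; last first.
  by apply/measurable_EFinP; apply: measurable_funM; exact: measurable_basis.
apply: eq_integral => x; rewrite inE => xS; congr EFin.
have rowE k : Y k (x *m g) = dot (row k D^T) (harmonic_vector x).
  have /rowP/(_ k) := DE x xS; rewrite !mxE => ->.
  by apply: eq_bigr => j _; rewrite !mxE mulrC.
by rewrite -!rowE.
Qed.

(** A weak form of the addition theorem: the value at one point is carried to
    every other point by the orthogonal matrices above. *)
Lemma harmonic_vector_norm : exists2 K : R, 0 <= K &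
  forall x, sphere x -> dot (harmonic_vector x) (harmonic_vector x) = K.
Proof.
pose x0 : 'rV[R]_3 := delta_mx ord0 ord0.
exists (dot (harmonic_vector x0) (harmonic_vector x0)); first exact: dot_ge0.
move=> x xS.
have x0S : sphere x0 by exact: sphere_delta.
have [g [og _] <-] := sphere_orbit (isT : (1 < 3)%N) x0S xS.
have [D oD DE] := rotation_matrix (orthogonalT og).
by rewrite /rotate DE// dot_orthogonal.
Qed.

Lemma harmonic_comb (c : 'rV[R]_n) :
  spherical_harmonic l (fun x => dot c (harmonic_vector x)).
Proof.
have [Ysh _ _] := hY.
rewrite (_ : (fun x => _) = fun x => \sum_m c ord0 m * Y m x); last first.
  by apply/funext => x; apply: eq_bigr => m _; rewrite mxE.
elim: (index_enum _) => [|m r IHr].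
  rewrite (_ : (fun x => _) = fun=> 0); first exact: spherical_harmonic0.
  by apply/funext => x; rewrite big_nil.
rewrite (_ : (fun x => _) = fun x => c ord0 m * Y m x + \sum_(j <- r) c ord0 j * Y j x).
  exact: spherical_harmonicZD.
by apply/funext => x; rewrite big_cons.
Qed.

(** Otherwise the combination would vanish on the sphere, but its square
    integrates to [dot c c]. *)
Lemma harmonic_comb_infinite_range (c : 'rV[R]_n) : (0 < l)%N -> c != 0 ->
  ~ finite_set ((fun x => dot c (harmonic_vector x)) @` S).
Proof.
move=> l0 c0 fr.
have Z := harmonic_finite_range l0 (harmonic_comb c) fr.
have := Rintegral_basis_comb c c.
rewrite (@eq_Rintegral _ _ _ _ _ (fun=> 0)); last first.
  by move=> x; rewrite inE => xS; rewrite Z// mulr0.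
by rewrite Rintegral_cst// mul0r => /esym/eqP; rewrite dot_eq0; exact/negP.
Qed.

End harmonic_basis.

(** * Elementary estimates *)

Section quadratic_estimates.
Context {R : realType}.

Lemma cauchy_schwarz n (x y : 'rV[R]_n) : dot x y ^+ 2 <= dot x x * dot y y.
Proof.
have [->|y0] := eqVneq y 0.
  by rewrite -(scale0r (0 : 'rV[R]_n)) !dotZr !mul0r mulr0 expr0n.
have yy : 0 < dot y y by rewrite lt_def dot_eq0 y0 dot_ge0.
have := dot_ge0 (x - (dot x y / dot y y) *: y).
rewrite !(dotDl, dotDr, dotNl, dotNr, dotZl, dotZr) (dotC y x).
set a := dot x x; set b := dot x y; set c := dot y y in yy *.
have -> : a - b / c * b + (- (b / c * b) - b / c * - (b / c * c)) = a - b ^+ 2 / c.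
  by field; rewrite gt_eqF.
by rewrite subr_ge0 ler_pdivrMr.
Qed.

Lemma mvt_bound (f df : R -> R) (K t d : R) :
  (forall x : R, is_derive x 1 f (df x)) -> (forall x, `|x - t| <= `|d| -> `|df x| <= K) ->
  `|f (t + d) - f t| <= K * `|d|.
Proof.
move=> fd dfK.
have H (a b : R) : a <= b -> (forall x, x \in `[a, b] -> `|x - t| <= `|d|) ->
    `|f b - f a| <= K * `|b - a|.
  move=> ab abt; have [|x xab ->] := @MVT_segment _ f df a b ab.
    by apply: derivable_within_continuous => x _; have [] := fd x.
  by rewrite normrM ler_wpM2r// dfK// abt.
have [d0|d0] := leP 0 d.
  have := H t (t + d); rewrite lerDl => /(_ d0); rewrite addrAC subrr add0r; apply.
  by move=> x; rewrite in_itv/= (ger0_norm d0) ler_norml => /andP[h1 h2]; apply/andP; split; lra.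
have := H (t + d) t; rewrite gerDl => /(_ (ltW d0)); rewrite distrC.
rewrite (_ : t - (t + d) = - d); last by ring.
rewrite normrN; apply.
by move=> x; rewrite in_itv/= (ltr0_norm d0) ler_norml => /andP[h1 h2]; apply/andP; split; lra.
Qed.

Lemma sin_lipschitz (t d : R) : `|sin (t + d) - sin t| <= `|d|.
Proof.
rewrite -[leRHS]mul1r; apply: (@mvt_bound _ cos) => x _; exact: cos_max.
Qed.

Lemma cos_lipschitz (t d : R) : `|cos (t + d) - cos t| <= `|d|.
Proof.
rewrite -[leRHS]mul1r; apply: (@mvt_bound _ (fun x => - sin x)) => x _.
by rewrite normrN; exact: sin_max.
Qed.

(** The function [s |-> cos s + s sin t] has derivative [sin t - sin s], which is
    at most [|d|] between [t] and [t + d]. *)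
Lemma cos_taylor1 (t d : R) : `|cos (t + d) - cos t + d * sin t| <= d ^+ 2.
Proof.
pose f s := cos s + s * sin t.
rewrite (_ : _ + _ = f (t + d) - f t); last by rewrite /f; ring.
rewrite -[d ^+ 2]real_normK ?num_real// expr2.
apply: (@mvt_bound _ (fun s => - sin s + sin t)) => x.
  rewrite /f; apply: is_deriveD.
  have := is_deriveZ (sin t) (is_derive_id x (1 : R)).
  by rewrite (_ : sin t \*: id = (fun s => s * sin t)) ?[_ *: 1]mulr1//;
    apply/funext => s /=; rewrite mulrC.
move=> xt; apply: le_trans xt; rewrite addrC distrC.
by have := sin_lipschitz t (x - t); rewrite (addrC t) subrK.
Qed.

Lemma cos_sub1 (h : R) : `|cos h - 1| <= h ^+ 2.
Proof. by have := cos_taylor1 0 h; rewrite add0r cos0 sin0 mulr0 addr0. Qed.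

(** Increments bounded by a square: cut the interval into [N] pieces and let [N]
    grow. *)
Lemma quadratic_cst (f : R -> R) (C : R) :
  (forall t h, `|f (t + h) - f t| <= C * h ^+ 2) -> forall a, f a = f 0.
Proof.
move=> fC a.
have step N (h : R) : `|f (N%:R * h) - f 0| <= N%:R * (C * h ^+ 2).
  elim: N => [|N IHN]; first by rewrite !mul0r subrr normr0.
  rewrite -natr1 !mulrDl !mul1r.
  rewrite -[f _ - f 0](subrKA (f (N%:R * h))) addrC.
  by rewrite (le_trans (ler_normD _ _))// lerD// .
apply/eqP; rewrite -subr_eq0 -normr_le0; apply/ler_addgt0Pl => eps eps0.
rewrite addr0.
pose N := (Num.truncn (`|C| * a ^+ 2 / eps)).+1.
have N0 : 0 < N%:R :> R by rewrite ltr0n.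
have := step N (a / N%:R); rewrite mulrCA divff ?mulr1 ?gt_eqF// => /le_trans; apply.
rewrite (_ : N%:R * _ = C * a ^+ 2 / N%:R); last by field; rewrite gt_eqF.
rewrite ler_pdivrMr//.
apply: (@le_trans _ _ (`|C| * a ^+ 2)).
  by rewrite ler_wpM2r ?sqr_ge0// ler_norm.
by rewrite [leRHS]mulrC -ler_pdivrMr// ltW// truncnS_gt.
Qed.

Lemma quadratic_zero (a C : R) : (forall h, 0 < h -> `|h * a| <= C * h ^+ 2) -> a = 0.
Proof.
move=> aC; apply/eqP; rewrite -normr_le0; apply/ler_addgt0Pl => eps eps0.
rewrite addr0; pose h := eps / (`|C| + 1).
have C0 : 0 < `|C| + 1 by rewrite ltr_wpDl.
have h0 : 0 < h by rewrite divr_gt0.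
have := aC h h0; rewrite normrM (gtr0_norm h0) expr2 mulrCA ler_pM2l//.
move=> /le_trans; apply; rewrite /h mulrA ler_pdivrMr// mulrC ler_pM2l//.
by rewrite (le_trans (ler_norm C))// lerDl.
Qed.

End quadratic_estimates.

(** * Tangent directions of an infinite set of orthogonal matrices *)

Section tangent.
Context {R : realType} (n : nat).
Implicit Types (A B g h : 'M[R]_n).

(** Submultiplicative, unlike the sup norm of the matrix space. *)
Definition l1norm A : R := \sum_i \sum_j `|A i j|.

Lemma l1norm_ge0 A : 0 <= l1norm A.
Proof. by rewrite sumr_ge0// => i _; rewrite sumr_ge0. Qed.

Lemma entry_le_l1norm A i j : `|A i j| <= l1norm A.
Proof.
rewrite /l1norm (bigD1 i)//= (bigD1 j)//= -addrA lerDl addr_ge0// sumr_ge0// => k _.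
by rewrite sumr_ge0.
Qed.

Lemma l1normZ c A : l1norm (c *: A) = `|c| * l1norm A.
Proof.
rewrite /l1norm mulr_sumr; apply: eq_bigr => i _; rewrite mulr_sumr.
by apply: eq_bigr => j _; rewrite mxE normrM.
Qed.

Lemma l1normD A B : l1norm (A + B) <= l1norm A + l1norm B.
Proof.
rewrite /l1norm -big_split/= ler_sum// => i _; rewrite -big_split/= ler_sum// => j _.
by rewrite mxE ler_normD.
Qed.

Lemma l1norm_eq0 A : (l1norm A == 0) = (A == 0).
Proof.
apply/idP/idP => [/eqP A0|/eqP ->].
  apply/eqP/matrixP => i j; rewrite mxE; apply/eqP; rewrite -normr_le0 -A0.
  exact: entry_le_l1norm.
by rewrite /l1norm big1// => i _; rewrite big1// => j _; rewrite mxE normr0.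
Qed.

Lemma l1norm_le A (r : R) : (forall i j, `|A i j| <= r) -> l1norm A <= (n * n)%:R * r.
Proof.
move=> Ar; apply: (@le_trans _ _ (\sum_(i < n) \sum_(j < n) r)).
  by rewrite ler_sum// => i _; rewrite ler_sum.
by rewrite !sumr_const card_ord -mulrnA mulr_natl.
Qed.

Lemma l1normM A B : l1norm (A *m B) <= l1norm A * l1norm B.
Proof.
rewrite {2}/l1norm mulr_suml {1}/l1norm ler_sum// => i _; rewrite mulr_suml.
apply: (@le_trans _ _ (\sum_j \sum_k `|A i k| * `|B k j|)).
  rewrite ler_sum// => j _; rewrite mxE (le_trans (ler_norm_sum _ _ _))// ler_sum// => k _.
  by rewrite normrM.
rewrite exchange_big/= ler_sum// => k _; rewrite -mulr_sumr ler_wpM2l//.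
by rewrite /l1norm [leRHS](bigD1 k)//= lerDl sumr_ge0// => m _; rewrite sumr_ge0.
Qed.

Lemma orthogonal_entry g i j : orthogonalmx g -> `|g i j| <= 1.
Proof.
move=> og; rewrite -(@ler_pXn2r _ 2%N)// ?nnegrE// expr1n real_normK ?num_real//.
have E : \sum_k g i k * g^T k i = 1.
  by have /matrixP/(_ i i) := (og : g *m g^T = _); rewrite !mxE eqxx.
rewrite -E.
rewrite (bigD1 j)//= mxE -expr2 lerDl sumr_ge0// => k _.
by rewrite mxE -expr2 sqr_ge0.
Qed.

Lemma l1norm_orthogonal g : orthogonalmx g -> l1norm g <= (n * n)%:R.
Proof.
by move=> og; rewrite -[leRHS]mulr1; apply: l1norm_le => i j; exact: orthogonal_entry.
Qed.

(** Bounded sequences of matrices have cluster points, since the matrix space is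
    R^(n^2). *)
Lemma l1norm_cluster (f : nat -> 'M[R]_n) (r : R) : (forall k, l1norm (f k) <= r) ->
  exists A, forall eps N, 0 < eps -> exists2 k, (N <= k)%N & l1norm (f k - A) < eps.
Proof.
move=> fr; pose b k := mxvec (f k).
pose K := [set x : 'rV[R]_(n * n) | `|x| <= r].
have r0 : 0 <= r := le_trans (l1norm_ge0 (f 0%N)) (fr 0%N).
have Kb k : K (b k).
  apply: norm_le_coord => // i; case/mxvec_indexP: i => i j.
  by rewrite mxvecE (le_trans _ (fr k))// entry_le_l1norm.
have cK : compact K.
  apply: bounded_closed_compact.
    by exists r; split; [exact: num_real|move=> M rM x /le_trans; apply; exact: ltW].
  rewrite (_ : K = (fun x => `|x|) @^-1` [set t | t <= r])//.
  by apply: closed_comp; [move=> x _; exact: norm_continuous|exact: closed_le].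
have [|a [_ ca]] := cK (b @ \oo) _.
  by exists 0%N => // k _; exact: Kb.
exists (vec_mx a) => eps N eps0.
pose d := eps / (n * n).+1%:R.
have d0 : 0 < d by rewrite divr_gt0// ltr0n.
have F1 : (b @ \oo) [set x | exists2 k, (N <= k)%N & x = b k].
  by exists N => // k /= Nk; exists k.
have [_ [[k Nk ->]]] := ca _ _ F1 (nbhsx_ballx a d d0).
rewrite -ball_normE /= => abk; exists k => //.
apply: (@le_lt_trans _ _ ((n * n)%:R * d)).
  apply: l1norm_le => i j.
  have -> : (f k - vec_mx a) i j = (b k - a) ord0 (mxvec_index i j).
    by rewrite !mxE mxvecE -[a in RHS]vec_mxK mxvecE mxE.
  by rewrite (le_trans (coord_le_norm _ _))// distrC ltW.
by rewrite /d mulrA ltr_pdivrMr ?ltr0n// mulrC ltr_pM2l// ltr_nat.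
Qed.

Lemma linear_bounded (phi : 'M[R]_n -> R) :
  (forall c A B, phi (c *: A + B) = c * phi A + phi B) ->
  exists2 C, 0 <= C & forall A, `|phi A| <= C * l1norm A.
Proof.
move=> lin.
have phi0 : phi 0 = 0.
  by have := lin 1 0 0; rewrite scaler0 addr0; lra.
have phisum (I : Type) (r : seq I) (F : I -> 'M[R]_n) :
    phi (\sum_(i <- r) F i) = \sum_(i <- r) phi (F i).
  elim: r => [|i r IHr]; first by rewrite !big_nil.
  by rewrite !big_cons -IHr -[F i]scale1r lin mul1r scale1r.
have phiZ c A : phi (c *: A) = c * phi A.
  by rewrite -[c *: A]addr0 lin phi0 addr0.
pose C := \sum_i \sum_j `|phi (delta_mx i j)|.
exists C; first by rewrite sumr_ge0// => i _; rewrite sumr_ge0.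
move=> A; rewrite {1}[A]matrix_sum_delta phisum.
rewrite (le_trans (ler_norm_sum _ _ _))// mulrC /l1norm mulr_suml ler_sum// => i _.
rewrite phisum (le_trans (ler_norm_sum _ _ _))// mulr_suml ler_sum// => j _.
rewrite phiZ normrM ler_wpM2l// /C (bigD1 i)//= (bigD1 j)//= -addrA lerDl.
by rewrite addr_ge0// sumr_ge0// => k _; rewrite sumr_ge0.
Qed.

Lemma dot_mulmx_l1norm xi : exists C, forall B : 'M[R]_n,
  dot (xi *m B) (xi *m B) <= C * l1norm B ^+ 2.
Proof.
pose s := \sum_i `|xi ord0 i|; exists (n%:R * s ^+ 2) => B.
have s0 : 0 <= s by exact: sumr_ge0.
have bnd j : `|(xi *m B) ord0 j| <= s * l1norm B.
  rewrite mxE (le_trans (ler_norm_sum _ _ _))// mulr_suml ler_sum// => i _.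
  by rewrite normrM ler_wpM2l// entry_le_l1norm.
apply: (@le_trans _ _ (\sum_(j < n) (s * l1norm B) ^+ 2)).
  rewrite ler_sum// => j _; rewrite -expr2 -[leLHS]real_normK ?num_real//.
  by rewrite ler_pXn2r// nnegrE// mulr_ge0// l1norm_ge0.
by rewrite sumr_const card_ord -[leLHS]mulr_natl exprMn mulrA.
Qed.

Lemma l1normT (B : 'M[R]_n) : l1norm B^T = l1norm B.
Proof.
rewrite /l1norm exchange_big/=; apply: eq_bigr => i _; apply: eq_bigr => j _.
by rewrite mxE.
Qed.

(** An infinite set of orthogonal matrices has pairs of distinct elements [g], [h]
    that are arbitrarily close, so [k = g^T h] tends to 1 without reaching it;
    [A] is a limit of the normalized differences [(k - 1) / |k - 1|]. A linear
    form which is of second order along [H] is then arbitrarily small near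
    [A]. *)
Lemma exists_tangent (H : set 'M[R]_n) :
  (forall g, H g -> orthogonalmx g) ->
  (forall g h, H g -> H h -> H (g^T *m h)) -> infinite_set H ->
  exists2 A, A != 0 & forall phi : 'M[R]_n -> R,
    (forall c A B, phi (c *: A + B) = c * phi A + phi B) ->
    (exists C, forall k, H k -> `|phi (k - 1%:M)| <= C * l1norm (k - 1%:M) ^+ 2) ->
    phi A = 0.
Proof.
move=> oH HtM infH.
have [f Hf finj] : exists2 f : nat -> 'M[R]_n, (forall k, H (f k)) & injective f.
  move/infiniteP/pcard_leP : infH => [f].
  exists f => [k|k k' ff]; first exact: funS.
  by apply: (@inj _ _ _ f) => //; rewrite inE.
have [h0 close] := l1norm_cluster (fun k => l1norm_orthogonal (oH _ (Hf k))).
have small eps : 0 < eps -> exists k, [/\ H k, k != 1%:M & l1norm (k - 1%:M) < eps].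
  move=> eps0; pose m := (n * n).+1%:R : R.
  have m0 : 0 < m by rewrite ltr0n.
  pose d := eps / (m * 2).
  have d0 : 0 < d by rewrite divr_gt0// mulr_gt0.
  have [a _ fa] := close d 0%N d0; have [b ab fb] := close d a.+1 d0.
  exists ((f a)^T *m f b); split; first exact: HtM.
    apply: contraNneq (_ : f a != f b) => [E|].
      by rewrite -[f b]mul1mx -(oH _ (Hf a) : f a *m (f a)^T = _) -mulmxA E mulmx1.
    by apply/eqP => /finj E; move: ab; rewrite E ltnn.
  have -> : (f a)^T *m f b - 1%:M = (f a)^T *m (f b - f a).
    by rewrite mulmxBr (orthogonalC (oH _ (Hf a))).
  apply: (le_lt_trans (l1normM _ _)).
  have fba : l1norm (f b - f a) <= d + d.
    rewrite -(subrKA h0) (le_trans (l1normD _ _))// lerD ?(ltW fb)//.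
    by rewrite -(opprB (f a)) -scaleN1r l1normZ normrN1 mul1r ltW.
  have lo : l1norm (f a)^T <= (n * n)%:R by exact/l1norm_orthogonal/orthogonalT/oH.
  apply: (@le_lt_trans _ _ ((n * n)%:R * (d + d))).
    by apply: ler_pM => //; exact: l1norm_ge0.
  rewrite (_ : d + d = eps / m); last by rewrite /d; field; rewrite gt_eqF.
  by rewrite mulrA ltr_pdivrMr// mulrC ltr_pM2l// ltr_nat.
have /choice[k Hk] : forall j : nat, exists k, [/\ H k, k != 1%:M &
    l1norm (k - 1%:M) < j.+1%:R^-1].
  by move=> j; apply: small; rewrite invr_gt0 ltr0n.
pose t j := l1norm (k j - 1%:M).
have t0 j : 0 < t j.
  by rewrite lt_def l1norm_eq0 l1norm_ge0 subr_eq0 andbT; have [] := Hk j.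
pose B j := (t j)^-1 *: (k j - 1%:M).
have B1 j : l1norm (B j) = 1.
  by rewrite l1normZ gtr0_norm ?invr_gt0// mulVf// gt_eqF.
have [A HA] : exists A, forall eps N, 0 < eps ->
    exists2 j, (N <= j)%N & l1norm (B j - A) < eps.
  by apply: (@l1norm_cluster B 1) => j; rewrite B1.
exists A.
  apply/eqP => A0; have [j _] := HA 1 0%N ltr01.
  by rewrite A0 subr0 B1 ltxx.
move=> phi lin [C HC].
have [K K0 phiK] := linear_bounded lin.
have phiB X Y : phi (X - Y) = phi X - phi Y.
  by rewrite addrC -scaleN1r lin mulN1r addrC.
apply/eqP; rewrite -normr_le0; apply/ler_addgt0Pl => eps eps0; rewrite addr0.
pose M := `|C| + K + 1.
have M0 : 0 < M by rewrite ltr_wpDl// addr_ge0.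
pose e := eps / M; have e0 : 0 < e by rewrite divr_gt0.
have [j jN AB] := HA e (Num.truncn e^-1) e0.
have tj : t j < e.
  have [_ _ h] := Hk j; apply: (lt_le_trans h).
  rewrite -[leRHS]invrK lef_pV2 ?posrE ?invr_gt0 ?ltr0n//.
  by rewrite (le_trans (ltW (truncnS_gt _)))// ler_nat.
have phiBj : `|phi (B j)| <= `|C| * t j.
  have [Hkj _ _] := Hk j; have := HC _ Hkj; rewrite -/(t j).
  have -> : k j - 1%:M = t j *: B j by rewrite scalerA divff ?scale1r// gt_eqF.
  rewrite -[t j *: B j]addr0 lin (_ : phi 0 = 0) ?addr0; last first.
    by have := lin 1 0 0; rewrite scaler0 addr0; lra.
  rewrite normrM (gtr0_norm (t0 j)) expr2 mulrCA ler_pM2l// => /le_trans; apply.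
  by rewrite ler_wpM2r ?ler_norm// ltW.
have -> : phi A = phi (B j) - phi (B j - A) by rewrite phiB; ring.
rewrite (le_trans (ler_normB _ _))//.
apply: (@le_trans _ _ (`|C| * e + K * e)).
  rewrite lerD//; first by rewrite (le_trans phiBj)// ler_wpM2l// (ltW tj).
  by rewrite (le_trans (phiK _))// ler_wpM2l// ltW.
by rewrite -mulrDl /e mulrA ler_pdivrMr// mulrC ler_pM2l// lerDl.
Qed.

End tangent.

Lemma integrable_normr {R : realType} d (Omega : measurableType d)
    (mu : {measure set Omega -> \bar R}) (f : Omega -> R) :
  mu.-integrable setT (EFin \o f) ->
  mu.-integrable setT (EFin \o (fun w => `|f w|)).
Proof. by move=> /integrable_abse; apply: eq_integrable. Qed.

(** * Cosine transform and its derivative *)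

Section charfun.
Context {R : realType} d (Omega : measurableType d) (P : probability Omega R).
Context (n : nat) (X : Omega -> 'rV[R]_n).
Hypothesis mX : measurable_fun setT X.
Hypothesis X2 : P.-integrable setT (EFin \o (fun w => dot (X w) (X w))).

(** The cosine transform of the law of [X]. *)
Definition charfun (xi : 'rV[R]_n) (th : R) : R := \int[P]_w cos (dot xi (X w) + th).

(** The opposite of the derivative of [charfun] at [xi] in the direction [v]. *)
Definition dcharfun (xi : 'rV[R]_n) (th : R) (v : 'rV[R]_n) : R :=
  \int[P]_w (sin (dot xi (X w) + th) * dot v (X w)).

Let M2 := \int[P]_w dot (X w) (X w).

Let mdot v : measurable_fun setT (fun w => dot v (X w)).
Proof. by apply: (measurableT_comp (measurable_dotr v)). Qed.

Let mphase xi th : measurable_fun setT (fun w => dot xi (X w) + th).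
Proof. by apply: measurable_funD => //; exact: mdot. Qed.

Let mcos xi th : measurable_fun setT (fun w => cos (dot xi (X w) + th)).
Proof. by have [] := bounded_measurable_cos th (mdot xi). Qed.

Let msin xi th : measurable_fun setT (fun w => sin (dot xi (X w) + th)).
Proof.
apply: (@continuous_measurable_comp _ _ _ sin (fun w => dot xi (X w) + th)) => //.
exact: continuous_sin.
Qed.

Let int_cst (c : R) : P.-integrable setT (EFin \o (fun=> c)).
Proof. exact: finite_measure_integrable_cst. Qed.

Let int_cos xi th : P.-integrable setT (EFin \o (fun w => cos (dot xi (X w) + th))).
Proof. by apply: bounded_measurable_integrable; exact: bounded_measurable_cos. Qed.

Let int_quad (c : R) : P.-integrable setT (EFin \o (fun w => c * dot (X w) (X w))).
Proof. by have := integrableZl measurableT c X2. Qed.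

Let int_sin xi th v :
  P.-integrable setT (EFin \o (fun w => sin (dot xi (X w) + th) * dot v (X w))).
Proof.
have := integrableD measurableT (int_cst 1) (int_quad (dot v v)).
apply: le_integrable => //.
  by apply/measurable_EFinP; apply: measurable_funM.
move=> w _; rewrite /= lee_fin.
have h := cauchy_schwarz v (X w).
rewrite [leRHS]ger0_norm; last by rewrite addr_ge0// mulr_ge0// dot_ge0.
rewrite normrM (@le_trans _ _ `|dot v (X w)|)//.
  by rewrite -[leRHS]mul1r ler_wpM2r// sin_max.
set a := dot v (X w) in h *.
by rewrite ler_norml; apply/andP; split; nra.
Qed.

Lemma dcharfun_linear xi th c v v' :
  dcharfun xi th (c *: v + v') = c * dcharfun xi th v + dcharfun xi th v'.
Proof.
rewrite /dcharfun -RintegralZl// -RintegralD//.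
  by apply: eq_Rintegral => w _; rewrite dotDl dotZl; ring.
by have := integrableZl measurableT c (int_sin xi th v).
Qed.

Lemma dcharfunZ xi th c v : dcharfun xi th (c *: v) = c * dcharfun xi th v.
Proof.
have d0 : dcharfun xi th 0 = 0.
  by have := dcharfun_linear xi th 1 0 0; rewrite scaler0 addr0; lra.
by rewrite -[c *: v]addr0 dcharfun_linear d0 addr0.
Qed.

Lemma charfun_taylor xi th v :
  `|charfun (xi + v) th - charfun xi th + dcharfun xi th v| <= M2 * dot v v.
Proof.
rewrite /charfun /dcharfun.
have i1 := integrableB measurableT (int_cos (xi + v) th) (int_cos xi th).
rewrite -RintegralB// -RintegralD//.
apply: le_trans (le_normr_Rintegral _ _) _ => //.
  exact: (integrableD measurableT i1 (int_sin xi th v)).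
rewrite /M2 mulrC -RintegralZl//; apply: le_Rintegral => //.
- apply: integrable_normr.
  exact: (integrableD measurableT i1 (int_sin xi th v)).
- move=> w _; rewrite dotDl.
  have := cos_taylor1 (dot xi (X w) + th) (dot v (X w)).
  rewrite (addrAC (dot xi _)) [dot v _ * _]mulrC => /le_trans; apply.
  exact: cauchy_schwarz.
Qed.

Lemma dcharfun_bound xi th v : `|dcharfun xi th v| <= 1 + M2 * dot v v.
Proof.
rewrite /dcharfun.
apply: le_trans (le_normr_Rintegral _ _) _ => //.
have -> : 1 + M2 * dot v v = \int[P]_w (1 + dot v v * dot (X w) (X w)).
  rewrite RintegralD//.
  rewrite RintegralZl// (_ : \int[P]_(_ in setT) 1 = 1); last first.
    by rewrite Rintegral_cst// mul1r (congr1 fine (probability_setT P)).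
  by rewrite [M2 * _]mulrC.
apply: le_Rintegral => //.
- by apply: integrable_normr; exact: int_sin.
- exact: (integrableD measurableT (int_cst 1) (int_quad (dot v v))).
move=> w _; have h := cauchy_schwarz v (X w).
rewrite normrM (@le_trans _ _ `|dot v (X w)|)//.
  by rewrite -[leRHS]mul1r ler_wpM2r// sin_max.
set a := dot v (X w) in h *.
by rewrite ler_norml; apply/andP; split; nra.
Qed.


Let M2_ge0 : 0 <= M2.
Proof. by apply: Rintegral_ge0 => w _; exact: dot_ge0. Qed.

Definition charfun_invariant : set 'M[R]_n :=
  [set g | orthogonalmx g /\ forall xi th, charfun (xi *m g) th = charfun xi th].

Lemma charfun_invariant_orthogonal g : charfun_invariant g -> orthogonalmx g.
Proof. by case. Qed.

Lemma charfun_invariantT g : charfun_invariant g -> charfun_invariant g^T.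
Proof.
move=> [og gc]; split=> [|xi th]; first exact: orthogonalT.
by rewrite -gc -mulmxA (orthogonalC og) mulmx1.
Qed.

Lemma charfun_invariantM g h :
  charfun_invariant g -> charfun_invariant h -> charfun_invariant (g *m h).
Proof.
move=> [og gc] [oh hc]; split=> [|xi th]; first exact: orthogonalM.
by rewrite mulmxA hc gc.
Qed.

(** Differentiate the invariance of [charfun] in the form
    [charfun ((xi + h v) g) = charfun (xi + h v)]. *)
Lemma dcharfun_invariant g xi th v : charfun_invariant g ->
  dcharfun (xi *m g) th (v *m g) = dcharfun xi th v.
Proof.
move=> [og gc]; apply/eqP; rewrite -subr_eq0; apply/eqP.
apply: (@quadratic_zero _ _ (2 * M2 * dot v v)) => h h0.
have A := charfun_taylor xi th (h *: v).
have B := charfun_taylor (xi *m g) th (h *: v *m g).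
rewrite -mulmxDl !gc dot_orthogonal// -scalemxAl in B.
rewrite !dcharfunZ dotZl dotZr in A B.
set a := charfun (xi + _) _ in A B; set b := charfun xi _ in A B.
set p := dcharfun _ _ _ in A *; set q := dcharfun _ _ _ in B *.
have -> : h * (q - p) = (a - b + h * q) - (a - b + h * p) by ring.
rewrite (le_trans (ler_normB _ _))// (le_trans (lerD B A))//.
by rewrite le_eqVlt; apply/orP; left; apply/eqP; ring.
Qed.

Definition charfun_stationary (A : 'M[R]_n) :=
  antisymmetric_mx A /\ forall xi th, dcharfun xi th (xi *m A) = 0.

Lemma charfun_stationary_linear_closed : linear_closed_prop charfun_stationary.
Proof.
split; first split=> [|xi th].
- by rewrite /antisymmetric_mx trmx0 oppr0.
- by rewrite mulmx0 -(scale0r 0) dcharfunZ mul0r.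
move=> c A B [sA zA] [sB zB]; split=> [|xi th].
  by rewrite /antisymmetric_mx linearD/= linearZ/= sA sB opprD scalerN.
by rewrite mulmxDr -scalemxAr dcharfun_linear zA zB mulr0 addr0.
Qed.

Lemma charfun_stationary_conj g A : charfun_invariant g ->
  charfun_stationary A -> charfun_stationary (g^T *m A *m g).
Proof.
move=> Hg [sA zA]; have og := Hg.1; split=> [|xi th].
  by rewrite /antisymmetric_mx !trmx_mul trmxK sA mulNmx mulmxN mulmxA.
have -> : xi *m (g^T *m A *m g) = (xi *m g^T *m A) *m g by rewrite !mulmxA.
have -> : dcharfun xi th = dcharfun (xi *m g^T *m g) th.
  by rewrite -mulmxA (orthogonalC og) mulmx1.
by rewrite dcharfun_invariant.
Qed.

(** The tangent direction of the symmetries is antisymmetric because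
    [B + B^T = - B B^T] for [B = k - 1], [k] orthogonal, and it makes the
    derivative vanish because [charfun (xi k) = charfun xi]; both errors are of
    second order in [B]. *)
Lemma exists_charfun_stationary : infinite_set charfun_invariant ->
  exists2 A, charfun_stationary A & A != 0.
Proof.
move=> infH.
have HtM g h : charfun_invariant g -> charfun_invariant h -> charfun_invariant (g^T *m h).
  by move=> Hg Hh; apply: charfun_invariantM => //; exact: charfun_invariantT.
have [A A0 tA] := exists_tangent charfun_invariant_orthogonal HtM infH.
exists A => //; split=> [|xi th].
  apply/matrixP => i j; rewrite !mxE; apply/eqP; rewrite -addr_eq0; apply/eqP.
  apply: (tA (fun A => A j i + A i j)) => [c B B'|]; first by rewrite !mxE; ring.
  exists 1 => k [ok _]; rewrite mul1r; set B := k - 1%:M.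
  have kB : k = 1%:M + B by rewrite /B addrC subrK.
  have BB : B^T + B = - (B *m B^T).
    have := ok; rewrite /orthogonalmx kB linearD/= trmx1 mulmxDl !mulmxDr !mul1mx.
    rewrite mulmx1 -addrA -[RHS]addr0 => /addrI.
    by rewrite addrA => /eqP; rewrite addr_eq0 => /eqP.
  have -> : B j i + B i j = (B^T + B) i j by rewrite !mxE.
  rewrite BB mxE normrN (le_trans (entry_le_l1norm _ _ _))//.
  by rewrite (le_trans (l1normM _ _))// l1normT expr2.
apply: (tA (fun A => dcharfun xi th (xi *m A))) => [c B B'|].
  by rewrite mulmxDr -scalemxAr dcharfun_linear.
have [C xiC] := dot_mulmx_l1norm xi; exists (M2 * C) => k [_ kc].
have := charfun_taylor xi th (xi *m (k - 1%:M)).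
rewrite {1}mulmxBr mulmx1 [xi + _]addrC subrK kc subrr add0r => /le_trans; apply.
by rewrite -mulrA ler_wpM2l.
Qed.

(** [charfun] is constant on the great circle through [x] and [y], as its
    increments there are of second order. *)
Lemma perp_charfun_cst x y th :
  (forall v, dot x x = dot v v -> forall v', dot v v' = 0 -> dcharfun v th v' = 0) ->
  dot x y = 0 -> dot x x = dot y y -> charfun x th = charfun y th.
Proof.
move=> dperp xy xxyy; set r := dot x x in xxyy.
pose c (t : R) := cos t *: x + sin t *: y.
pose c' (t : R) := cos t *: y - sin t *: x.
have yx : dot y x = 0 by rewrite dotC.
have cE (t h : R) : c (t + h) = c t + ((cos h - 1) *: c t + sin h *: c' t).
  rewrite /c /c' cosD sinD; apply/rowP => i; rewrite !mxE; ring.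
have cc (t : R) : dot (c t) (c t) = r.
  rewrite /c !(dotDl, dotDr, dotZl, dotZr) xy yx -xxyy -/r.
  by rewrite -[RHS]mul1r -(cos2Dsin2 t); ring.
have c'c' (t : R) : dot (c' t) (c' t) = r.
  rewrite /c' !(dotDl, dotDr, dotZl, dotZr, dotNl, dotNr) xy yx -xxyy -/r.
  by rewrite -[RHS]mul1r -(cos2Dsin2 t); ring.
have cc' (t : R) : dot (c t) (c' t) = 0.
  rewrite /c /c' !(dotDl, dotDr, dotZl, dotZr, dotNl, dotNr) xy yx -xxyy -/r.
  by ring.
have r0 : 0 <= r by exact: dot_ge0.
have key (t h : R) :
    `|charfun (c (t + h)) th - charfun (c t) th| <= (2 * M2 * r + (1 + M2 * r)) * h ^+ 2.
  have A := charfun_taylor (c t) th ((cos h - 1) *: c t + sin h *: c' t).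
  rewrite -cE dcharfun_linear dcharfunZ (dperp _ _ _ (cc' t)) ?cc// in A.
  rewrite mulr0 addr0 in A.
  have nE : dot ((cos h - 1) *: c t + sin h *: c' t) ((cos h - 1) *: c t + sin h *: c' t)
      = r * (2 * (1 - cos h)).
    move: (cc t) (c'c' t) (cc' t); move: (c t) (c' t) => u u' uu u'u' uu'.
    rewrite !(dotDl, dotDr, dotZl, dotZr) uu u'u' [dot u' u]dotC uu'.
    transitivity (r * ((cos h ^+ 2 + sin h ^+ 2) + 1 - 2 * cos h)); first by ring.
    by rewrite cos2Dsin2; ring.
  rewrite nE in A.
  have B := dcharfun_bound (c t) th (c t); rewrite cc in B.
  have C := cos_sub1 h; set q := charfun (c (t + h)) th - _ in A *.
  set p := dcharfun _ _ _ in A B.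
  have -> : q = (q + (cos h - 1) * p) - (cos h - 1) * p by ring.
  rewrite (le_trans (ler_normB _ _))// [leRHS]mulrDl lerD//; last first.
    by rewrite normrM mulrC ler_pM.
  apply: (le_trans A); rewrite -subr_ge0.
  rewrite (_ : _ - _ = M2 * r * (2 * (h ^+ 2 - (1 - cos h)))); last by ring.
  rewrite !mulr_ge0// subr_ge0 (le_trans _ C)//.
  by rewrite -normrN opprB ler_norm.
have := quadratic_cst key (pi / 2).
by rewrite /c cos_pihalf sin_pihalf cos0 sin0 !scale0r !scale1r add0r addr0 => ->.
Qed.

(** The matrix [wedge v v'] maps [v] to a multiple of [v'] when these are
    orthogonal, so the derivative of [charfun] at [v] vanishes in all directions
    orthogonal to [v]. In dimension at least 3 some vector is orthogonal to both
    [x] and [y], and two quarters of great circles lead from [x] to [y]. *)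
Lemma charfun_radial : (2 < n)%N -> infinite_set charfun_invariant ->
  (forall s : 'S_n, charfun_invariant (perm_mx s)) ->
  (exists g i j, charfun_invariant g /\
    ((const_mx 1 : 'rV[R]_n) *m g) ord0 i != ((const_mx 1 : 'rV[R]_n) *m g) ord0 j) ->
  forall x y th, dot x x = dot y y -> charfun x th = charfun y th.
Proof.
move=> n2 infH Hperm Hnc x y th xxyy.
have full := invariant_skew_space_full charfun_invariant_orthogonal
  charfun_invariantT Hperm charfun_stationary_linear_closed (fun A (LA : charfun_stationary A) => LA.1)
  (fun g A => @charfun_stationary_conj g A) (exists_charfun_stationary infH) Hnc.
have [x0|x0] := eqVneq x 0.
  suff -> : y = 0 by rewrite x0.
  by apply/eqP; rewrite -dot_eq0 -xxyy x0 dot_eq0.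
have xx0 : dot x x != 0 by rewrite dot_eq0.
have dperp v : dot x x = dot v v -> forall v', dot v v' = 0 -> dcharfun v th v' = 0.
  move=> xv v' vv'.
  have [] := full (wedge v v').
    by rewrite /antisymmetric_mx /wedge linearB/= !trmx_mul !trmxK opprB.
  move=> _ /(_ v th).
  have -> : v *m wedge v v' = dot v v *: v'.
    rewrite /wedge mulmxBr !mulmxA [v *m v^T]mx11_scalar [v *m v'^T]mx11_scalar.
    by rewrite -!dotE vv' mul_scalar_mx raddf0 mul0mx subr0.
  by rewrite dcharfunZ -xv => /eqP; rewrite mulf_eq0 (negbTE xx0) => /eqP.
have [z z0 [xz yz]] : exists2 z, z != 0 & dot x z = 0 /\ dot y z = 0.
  pose M := row_mx x^T y^T.
  have /rowV0Pn[z zM z0] : kermx M != 0.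
    rewrite -mxrank_eq0 mxrank_ker subn_eq0 -ltnNge.
    by apply: leq_ltn_trans n2; exact: rank_leq_col.
  exists z => //; move/sub_kermxP: zM; rewrite mul_mx_row -[RHS]row_mx0 => /eq_row_mx[xz yz].
  by rewrite ![dot _ z]dotC !dotE xz yz !mxE.
pose s := Num.sqrt (dot x x / dot z z).
have zz0 : 0 < dot z z by rewrite lt_def dot_eq0 z0 dot_ge0.
have szz : dot (s *: z) (s *: z) = dot x x.
  by rewrite dotZl dotZr mulrA -expr2 sqr_sqrtr ?divr_ge0 ?dot_ge0// divfK ?gt_eqF.
transitivity (charfun (s *: z) th).
  by apply: perp_charfun_cst => //; rewrite dotZr xz mulr0.
apply/esym/perp_charfun_cst; first by rewrite -xxyy.
  by rewrite dotZr yz mulr0.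
by rewrite szz.
Qed.

End charfun.

(** * Approximation of integrals by averages over samples *)

Section square_integrable.
Context {R : realType} d (S : measurableType d) (mu : {finite_measure set S -> \bar R}).
Implicit Types h : S -> R.

Let M := fine (mu setT).

Let muE : mu setT = M%:E.
Proof. by rewrite fineK// fin_num_measure. Qed.

Let int_cst (c : R) : mu.-integrable setT (EFin \o (fun=> c)).
Proof. exact: finite_measure_integrable_cst. Qed.

Lemma square_integrable_integrable h : measurable_fun setT h ->
  mu.-integrable setT (EFin \o (fun x => h x ^+ 2)) -> mu.-integrable setT (EFin \o h).
Proof.
move=> mh h2; have := integrableD measurableT (int_cst 1) h2.
apply: le_integrable => //; first exact/measurable_EFinP.
move=> x _; rewrite /= lee_fin [leRHS]ger0_norm ?addr_ge0 ?sqr_ge0//.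
by rewrite ler_norml; apply/andP; split; nra.
Qed.

(** The function [M h - F] has integral zero, so adding a constant [s] to it
    increases the integral of its square by [M s^2] exactly. *)
Lemma Rintegral_square_centered h (s : R) : measurable_fun setT h ->
  mu.-integrable setT (EFin \o (fun x => h x ^+ 2)) ->
  let F := \int[mu]_x h x in
  mu.-integrable setT (EFin \o (fun x => (s + (M * h x - F)) ^+ 2)) /\
  \int[mu]_x (s + (M * h x - F)) ^+ 2 =
    M * (s ^+ 2 - F ^+ 2) + M ^+ 2 * \int[mu]_x (h x ^+ 2).
Proof.
move=> mh h2 F; have h1 := square_integrable_integrable mh h2.
have E : (fun x => (s + (M * h x - F)) ^+ 2) =
    (fun x => M ^+ 2 * h x ^+ 2 + (2 * M * (s - F)) * h x + (s - F) ^+ 2).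
  by apply/funext => x; ring.
have i2 := integrableZl measurableT (M ^+ 2) h2.
have i1 := integrableZl measurableT (2 * M * (s - F)) h1.
have i12 := integrableD measurableT i2 i1.
rewrite E; split; first exact: (integrableD measurableT i12 (int_cst ((s - F) ^+ 2))).
rewrite RintegralD//.
rewrite RintegralD// !RintegralZl// -/F Rintegral_cst// -/M; ring.
Qed.

(** The integral of [(M h - F)^2] is nonnegative. *)
Lemma sqr_Rintegral_le h : 0 < M -> measurable_fun setT h ->
  mu.-integrable setT (EFin \o (fun x => h x ^+ 2)) ->
  (\int[mu]_x h x) ^+ 2 <= M * \int[mu]_x (h x ^+ 2).
Proof.
move=> M0 mh h2; have [_] := Rintegral_square_centered 0 mh h2.
set F := \int[mu]_x h x; set Q := \int[mu]_x (h x ^+ 2) => E.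
have : 0 <= M * (0 ^+ 2 - F ^+ 2) + M ^+ 2 * Q.
  by rewrite -E; apply: Rintegral_ge0 => x _; exact: sqr_ge0.
rewrite (_ : _ + _ = M * (M * Q - F ^+ 2)); last by ring.
by rewrite pmulr_rge0// subr_ge0.
Qed.

(** The slack 1 allows to argue by contradiction with non-strict inequalities only. *)
Lemma exists_le_mean (D : set S) (Phi : S -> \bar R) (r : R) : 0 < M ->
  measurable D -> mu (~` D) = 0%E ->
  (forall x, 0 <= Phi x)%E -> measurable_fun setT Phi ->
  (\int[mu]_x Phi x <= (M * r)%:E)%E -> exists2 x, D x & (Phi x <= (r + 1)%:E)%E.
Proof.
move=> M0 mD D0 Phi0 mPhi IPhi; apply: contrapT => noX.
have muD : mu D = M%:E.
  have : mu setT = (mu D + mu (~` D))%E.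
    rewrite -(setvU D) setUC measureU//; first exact: measurableC.
    by rewrite setICr.
  by rewrite D0 adde0 muE.
suff : ((M * (r + 1))%:E <= (M * r)%:E)%E.
  by rewrite lee_fin ler_pM2l// gerDl ler10.
apply: le_trans IPhi.
have [r0|r0] := leP 0 (r + 1); last first.
  apply: (@le_trans _ _ 0%E); last by apply: integral_ge0 => x _.
  by rewrite lee_fin mulr_ge0_le0// ltW.
apply: (@le_trans _ _ (\int[mu]_(x in D) Phi x)%E); last first.
  by apply: ge0_subset_integral.
rewrite mulrC EFinM -muD -integral_cst//; apply: ge0_le_integral => //.
- exact: measurable_funTS.
- move=> x Dx; rewrite leNgt; apply/negP => lx; apply: noX; exists x => //.
  exact: ltW.
Qed.

End square_integrable.

Section sampling.
Context {R : realType} d d' (Omega : measurableType d) (S : measurableType d').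
Context (P : probability Omega R) (mu : {finite_measure set S -> \bar R}).

Let M := fine (mu setT).

Section field.
Variable f : Omega -> S -> R.
Hypothesis mf : measurable_fun setT (fun z : Omega * S => f z.1 z.2).

(** The integral of a random field over the parameter space; it is 0 by
    convention for the exceptional [w] whose path is not integrable. *)
Definition pathwise_integral w := \int[mu]_x f w x.

Let mfw w : measurable_fun setT (f w).
Proof. exact: (measurableT_comp mf (pair1_measurable w)). Qed.

Lemma measurable_sample x : measurable_fun setT (f ^~ x).
Proof. exact: (measurableT_comp mf (pair2_measurable x)). Qed.

Lemma measurable_pathwise_integral : measurable_fun setT pathwise_integral.
Proof.
apply: measurableT_comp => //.
under eq_fun do rewrite integralE.
apply: emeasurable_funB.
- rewrite (_ : (fun w => _) =
      fubini_F mu (EFin \o (fun z : Omega * S => f z.1 z.2))^\+%E); last first.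
    by apply/funext => w; apply: eq_integral => x _; rewrite !funeposE.
  apply: measurable_fun_fubini_tonelli_F => //.
  by apply: measurable_funepos; exact/measurable_EFinP.
- rewrite (_ : (fun w => _) =
      fubini_F mu (EFin \o (fun z : Omega * S => f z.1 z.2))^\-%E); last first.
    by apply/funext => w; apply: eq_integral => x _; rewrite !funenegE.
  apply: measurable_fun_fubini_tonelli_F => //.
  by apply: measurable_funeneg; exact/measurable_EFinP.
Qed.

Hypothesis f2 : (\int[P]_w \int[mu]_x (f w x ^+ 2)%:E < +oo)%E.

Let mf2 : measurable_fun setT (fun z : Omega * S => (f z.1 z.2 ^+ 2)%:E).
Proof. by apply/measurable_EFinP; exact: measurable_funX. Qed.

Let mI2 : measurable_fun setT (fun w => \int[mu]_x (f w x ^+ 2)%:E)%E.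
Proof.
apply: (@measurable_fun_fubini_tonelli_F _ _ _ _ _ mu (fun z : Omega * S => (f z.1 z.2 ^+ 2)%:E)) => //.
by move=> z; rewrite lee_fin sqr_ge0.
Qed.

Let I2_ge0 w : (0 <= \int[mu]_x (f w x ^+ 2)%:E)%E.
Proof. by apply: integral_ge0 => x _; rewrite lee_fin sqr_ge0. Qed.

Lemma ae_square_integrable :
  {ae P, forall w, mu.-integrable setT (EFin \o (fun x => f w x ^+ 2))}.
Proof.
have I : P.-integrable setT (fun w => \int[mu]_x (f w x ^+ 2)%:E)%E.
  apply/integrableP; split => //.
  by under eq_integral do rewrite gee0_abs//.
have := integrable_ae measurableT I; apply: filterS => w /(_ Logic.I) fin.
apply/integrableP; split; first by apply/measurable_EFinP; exact: measurable_funX.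
under eq_integral do rewrite /= ger0_norm ?sqr_ge0//.
by rewrite ltey_eq fin.
Qed.

Hypothesis M0 : 0 < M.

Let IE w (s : R) : mu.-integrable setT (EFin \o (fun x => f w x ^+ 2)) ->
  (\int[mu]_x ((s + (M * f w x - pathwise_integral w)) ^+ 2)%:E <=
   M%:E * (s ^+ 2)%:E + (M ^+ 2)%:E * \int[mu]_x (f w x ^+ 2)%:E)%E.
Proof.
move=> fw2; have [i1 e1] := Rintegral_square_centered s (mfw w) fw2.
rewrite -[leLHS]fineK ?(integrable_fin_num _ i1)// [fine _]e1.
rewrite -[X in (_ <= _ + _ * X)%E]fineK ?(integrable_fin_num _ fw2)//.
rewrite -!EFinM -EFinD lee_fin lerD2r ler_pM2l// gerBl sqr_ge0//.
Qed.

Lemma pathwise_integral_square :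
  (\int[P]_w (pathwise_integral w ^+ 2)%:E < +oo)%E.
Proof.
apply: (@le_lt_trans _ _ (\int[P]_w (M%:E * \int[mu]_x (f w x ^+ 2)%:E))%E); last first.
  by rewrite ge0_integralZl_EFin ?(ltW M0)// lte_mul_pinfty// lee_fin ltW.
apply: ae_ge0_le_integral => //.
- by move=> w _; rewrite lee_fin sqr_ge0.
- by apply/measurable_EFinP; apply: measurable_funX; exact: measurable_pathwise_integral.
- by move=> w _; rewrite mule_ge0// lee_fin ltW.
- exact: measurable_funeM.
have := ae_square_integrable; apply: filterS => w fw2 _.
rewrite -[X in (_ <= _ * X)%E]fineK ?(integrable_fin_num _ fw2)// -EFinM lee_fin.
exact: sqr_Rintegral_le.
Qed.

Lemma measurable_centered (s : Omega -> R) : measurable_fun setT s ->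
  measurable_fun setT (fun z : Omega * S =>
    ((s z.1 + (M * f z.1 z.2 - pathwise_integral z.1)) ^+ 2)%:E).
Proof.
move=> ms; apply/measurable_EFinP; apply: measurable_funX; apply: measurable_funD.
  exact: (measurableT_comp ms measurable_fst).
apply: measurable_funB; first exact: measurable_funM.
exact: (measurableT_comp measurable_pathwise_integral measurable_fst).
Qed.

(** Adding one sample point to a sum [s] of deviations increases its mean square,
    on average over that point, by at most a constant: the cross term vanishes
    pathwise because the deviation has mean zero. *)
Lemma sample_mean_square (s : Omega -> R) : measurable_fun setT s ->
  (\int[mu]_x \int[P]_w ((s w + (M * f w x - pathwise_integral w)) ^+ 2)%:E <=
   M%:E * (\int[P]_w (s w ^+ 2)%:E) +
   (M ^+ 2)%:E * \int[P]_w \int[mu]_x (f w x ^+ 2)%:E)%E.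
Proof.
move=> ms; have mc := measurable_centered ms.
rewrite -(@fubini_tonelli _ _ _ _ _ P mu _ mc); last by move=> z; rewrite lee_fin sqr_ge0.
have ms2 : measurable_fun setT (fun w => (s w ^+ 2)%:E).
  by apply/measurable_EFinP; exact: measurable_funX.
rewrite -!ge0_integralZl_EFin ?sqr_ge0 ?(ltW M0)//; last first.
  by move=> w _; rewrite lee_fin sqr_ge0.
have c0 w : (0 <= M%:E * (s w ^+ 2)%:E)%E.
  by rewrite mule_ge0// lee_fin ?sqr_ge0// ltW.
have d0 w : (0 <= (M ^+ 2)%:E * \int[mu]_x (f w x ^+ 2)%:E)%E.
  by rewrite mule_ge0// lee_fin sqr_ge0.
have mc1 := measurable_funeM M%:E ms2.
have mc2 := measurable_funeM (M ^+ 2)%:E mI2.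
rewrite -ge0_integralD//; apply: ae_ge0_le_integral => //.
- by move=> w _; apply: integral_ge0 => x _; rewrite lee_fin sqr_ge0.
- apply: (@measurable_fun_fubini_tonelli_F _ _ _ _ _ mu) mc _ => z.
  by rewrite lee_fin sqr_ge0.
- by move=> w _; rewrite adde_ge0.
- exact: emeasurable_funD.
have := ae_square_integrable; apply: filterS => w fw2 _; exact: (IE (s w) fw2).
Qed.

End field.
(** When [xs] has [N] points this is [N] times the error made in approximating
    the integral by [M / N] times the sum of the [f w x]. *)
Definition sample_deviation (f : Omega -> S -> R) (xs : seq S) w : R :=
  \sum_(x <- xs) (M * f w x - pathwise_integral f w).

Lemma measurable_sample_deviation f xs :
  measurable_fun setT (fun z : Omega * S => f z.1 z.2) ->
  measurable_fun setT (sample_deviation f xs).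
Proof.
move=> mf; apply: measurable_sum => x; apply: measurable_funB.
  by apply: measurable_funM => //; exact: measurable_sample.
exact: measurable_pathwise_integral.
Qed.

Lemma measurable_sample_sum (f : Omega -> S -> R) xs c :
  measurable_fun setT (fun z : Omega * S => f z.1 z.2) ->
  measurable_fun setT (fun w => c * \sum_(x <- xs) f w x).
Proof.
move=> mf; apply: measurable_funM => //; apply: measurable_sum => x.
exact: measurable_sample.
Qed.

(** The sample is chosen greedily: by [sample_mean_square] and [exists_le_mean]
    some next point increases the mean square by at most a constant. No
    independence is involved. Both fields are treated at once so that they share
    the sample. *)
Lemma exists_sample (f g : Omega -> S -> R) (D : set S) :
  measurable_fun setT (fun z : Omega * S => f z.1 z.2) ->
  measurable_fun setT (fun z : Omega * S => g z.1 z.2) ->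
  (\int[P]_w \int[mu]_x (f w x ^+ 2)%:E < +oo)%E ->
  (\int[P]_w \int[mu]_x (g w x ^+ 2)%:E < +oo)%E ->
  0 < M -> measurable D -> mu (~` D) = 0%E ->
  exists C : R, forall N, exists xs : seq S,
    [/\ size xs = N, forall x, x \in xs -> D x &
     (\int[P]_w (sample_deviation f xs w ^+ 2)%:E +
      \int[P]_w (sample_deviation g xs w ^+ 2)%:E <= (N%:R * C)%:E)%E].
Proof.
move=> mf mg f2 g2 M0 mD D0.
pose I2 (h : Omega -> S -> R) := (\int[P]_w \int[mu]_x (h w x ^+ 2)%:E)%E.
have I2_ge0 h : (0 <= I2 h)%E.
  by apply: integral_ge0 => w _; apply: integral_ge0 => x _; rewrite lee_fin sqr_ge0.
have I2E h : (I2 h < +oo)%E -> exists i : R, I2 h = i%:E.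
  by move=> hoo; exists (fine (I2 h)); rewrite fineK// ge0_fin_numE.
have [i I2f] := I2E f f2; have [j I2g] := I2E g g2.
pose C := M * (i + j); exists (C + 1).
elim=> [|N [xs [sxs Dxs Exs]]].
  exists [::]; split => //; rewrite mul0r /sample_deviation.
  by rewrite !integral0_eq ?adde0// => w _; rewrite big_nil expr0n.
pose dev h := (\int[P]_w (sample_deviation h xs w ^+ 2)%:E)%E.
have dev_ge0 h : (0 <= dev h)%E.
  by apply: integral_ge0 => w _; rewrite lee_fin sqr_ge0.
pose Phi h x := (\int[P]_w ((sample_deviation h xs w +
  (M * h w x - pathwise_integral h w)) ^+ 2)%:E)%E.
have Phi_ge0 h x : (0 <= Phi h x)%E.
  by apply: integral_ge0 => w _; rewrite lee_fin sqr_ge0.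
have mPhi h : measurable_fun setT (fun z : Omega * S => h z.1 z.2) ->
    measurable_fun setT (Phi h).
  move=> mh; have := measurable_centered mh (measurable_sample_deviation xs mh).
  move=> /measurable_fun_fubini_tonelli_G; apply => z.
  by rewrite lee_fin sqr_ge0.
have IPhi h : measurable_fun setT (fun z : Omega * S => h z.1 z.2) -> (I2 h < +oo)%E ->
    (\int[mu]_x Phi h x <= M%:E * dev h + (M ^+ 2)%:E * I2 h)%E.
  by move=> mh h2; apply: sample_mean_square => //; exact: measurable_sample_deviation.
have devfg : (dev f + dev g)%E \is a fin_num.
  rewrite ge0_fin_numE ?(adde_ge0 (dev_ge0 f) (dev_ge0 g))//.
  exact: (le_lt_trans Exs (ltry _)).
have [a [b [devf devg]]] : exists a b : R, dev f = a%:E /\ dev g = b%:E.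
  move: devfg; rewrite fin_numD => /andP[df dg].
  by exists (fine (dev f)), (fine (dev g)); split; exact: (esym (fineK _)).
pose r := a + b + C.
have [|x Dx xr] := @exists_le_mean _ _ _ mu D (fun x => Phi f x + Phi g x)%E r M0 mD D0
    (fun x => adde_ge0 (Phi_ge0 f x) (Phi_ge0 g x)) (emeasurable_funD (mPhi f mf) (mPhi g mg)).
  rewrite ge0_integralD//; [|exact: mPhi|exact: mPhi].
  apply: (le_trans (leeD (IPhi f mf f2) (IPhi g mg g2))).
  rewrite I2f I2g devf devg -/M /r /C -!EFinM -!EFinD lee_fin.
  by rewrite le_eqVlt; apply/orP; left; apply/eqP; ring.
have {}Exs : a + b <= N%:R * (C + 1).
  by rewrite -lee_fin EFinD -devf -devg; exact: Exs.
exists (rcons xs x); split.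
- by rewrite size_rcons sxs.
- by move=> y; rewrite mem_rcons inE => /orP[/eqP -> //|/Dxs].
have E h : (\int[P]_w (sample_deviation h (rcons xs x) w ^+ 2)%:E = Phi h x)%E.
  by apply: eq_integral => w _; rewrite /sample_deviation -cats1 big_cat big_seq1.
by rewrite !E (le_trans xr)// lee_fin -natr1 mulrDl mul1r /r -addrA lerD2r.
Qed.

(** [|cos s - cos t|] is at most [|s - t|], which is at most
    [e + (s - t)^2 / e]. *)
Lemma Rintegral_cos_le (A B : Omega -> R) (th e v : R) :
  measurable_fun setT A -> measurable_fun setT B -> 0 < e ->
  (\int[P]_w ((A w - B w) ^+ 2)%:E <= v%:E)%E ->
  `|\int[P]_w cos (A w + th) - \int[P]_w cos (B w + th)| <= e + v / e.
Proof.
move=> mA mB e0 IAB.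
have i2 : P.-integrable setT (EFin \o (fun w => (A w - B w) ^+ 2)).
  apply/integrableP; split.
    by apply/measurable_EFinP; apply: measurable_funX; exact: measurable_funB.
  under eq_integral do rewrite /= ger0_norm ?sqr_ge0//.
  by rewrite (le_lt_trans IAB)// ltry.
have icos (h : Omega -> R) : measurable_fun setT h ->
    P.-integrable setT (EFin \o (fun w => cos (h w + th))).
  by move=> mh; apply: bounded_measurable_integrable; exact: bounded_measurable_cos.
have ic := integrableB measurableT (icos _ mA) (icos _ mB).
have ie : P.-integrable setT (EFin \o (fun=> e)) by exact: finite_measure_integrable_cst.
have i2e := integrableZl measurableT e^-1 i2.
rewrite -RintegralB//; [|exact: icos|exact: icos].
apply: le_trans (le_normr_Rintegral _ ic) _ => //.
apply: (@le_trans _ _ (\int[P]_w (e + e^-1 * (A w - B w) ^+ 2))).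
  apply: le_Rintegral => //; first exact: (integrable_normr ic).
    exact: (integrableD measurableT ie i2e).
  move=> w _; have := cos_lipschitz (B w + th) (A w - B w).
  rewrite (_ : B w + th + (A w - B w) = A w + th); last by ring.
  move=> /le_trans; apply; set a := A w - B w.
  rewrite -(ler_pM2l e0) mulrDr mulrA mulfV ?gt_eqF// mul1r.
  rewrite -[X in _ + X]real_normK ?num_real//.
  have := normr_ge0 a; move: `|a| => t t0; nra.
rewrite RintegralD// RintegralZl//.
rewrite (_ : \int[P]_(_ in setT) e = e); last first.
  by rewrite Rintegral_cst// (congr1 fine (probability_setT P)) mulr1.
rewrite lerD2l mulrC ler_wpM2r ?invr_ge0 ?(ltW e0)//.
by rewrite -lee_fin fineK// (integrable_fin_num _ i2).
Qed.

(** Equality of the laws of finite sums passes to the integrals, which are mean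
    square limits of such sums along common samples. *)
Lemma pathwise_integral_same_cos (f g : Omega -> S -> R) (D : set S) (th : R) :
  measurable_fun setT (fun z : Omega * S => f z.1 z.2) ->
  measurable_fun setT (fun z : Omega * S => g z.1 z.2) ->
  (\int[P]_w \int[mu]_x (f w x ^+ 2)%:E < +oo)%E ->
  (\int[P]_w \int[mu]_x (g w x ^+ 2)%:E < +oo)%E ->
  0 < M -> measurable D -> mu (~` D) = 0%E ->
  (forall (xs : seq S) (c : R), (forall x, x \in xs -> D x) ->
    \int[P]_w cos (c * (\sum_(x <- xs) f w x) + th) =
    \int[P]_w cos (c * (\sum_(x <- xs) g w x) + th)) ->
  \int[P]_w cos (pathwise_integral f w + th) = \int[P]_w cos (pathwise_integral g w + th).
Proof.
move=> mf mg f2 g2 M0 mD D0 fg.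
have [C HC] := exists_sample mf mg f2 g2 M0 mD D0.
apply/eqP; rewrite -subr_eq0 -normr_le0; apply/ler_addgt0Pl => eps eps0; rewrite addr0.
pose e := eps / 4; have e0 : 0 < e by rewrite divr_gt0.
(* For this N the bound e + (C / N) / e of [Rintegral_cos_le] is at most 2 e. *)
pose N := (Num.truncn (C / e ^+ 2)).+1.
have N0 : 0 < N%:R :> R by rewrite ltr0n.
have [xs [sxs Dxs Exs]] := HC N.
pose c := M / N%:R.
have key h : measurable_fun setT (fun z : Omega * S => h z.1 z.2) ->
    (\int[P]_w (sample_deviation h xs w ^+ 2)%:E <= (N%:R * C)%:E)%E ->
    `|\int[P]_w cos (pathwise_integral h w + th) -
      \int[P]_w cos (c * (\sum_(x <- xs) h w x) + th)| <= 2 * e.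
  move=> mh Eh.
  apply: (@le_trans _ _ (e + (C / N%:R) / e)); last first.
    rewrite mulr_natl mulr2n lerD2l ler_pdivrMr// ler_pdivrMr//.
    rewrite mulrC -ler_pdivrMr ?mulr_gt0// -expr2.
    by apply/ltW; exact: truncnS_gt.
  apply: Rintegral_cos_le => //.
  - exact: measurable_pathwise_integral.
  - exact: measurable_sample_sum.
  have E w : ((pathwise_integral h w - c * \sum_(x <- xs) h w x) ^+ 2)%:E =
      ((N%:R^-1 ^+ 2)%:E * (sample_deviation h xs w ^+ 2)%:E)%E.
    rewrite -EFinM -exprMn -sqrrN; congr (_ ^+ 2)%:E.
    rewrite /sample_deviation sumrB -mulr_sumr.
    rewrite big_const_seq count_predT sxs iter_addr_0 -[pathwise_integral h w *+ N]mulr_natl.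
    rewrite /c mulrBr [N%:R^-1 * (N%:R * _)]mulrA mulVf ?gt_eqF// mul1r opprB.
    by congr (_ - _); ring.
  under eq_integral do rewrite E.
  rewrite ge0_integralZl_EFin ?sqr_ge0//.
  - apply: (le_trans (lee_wpmul2l _ Eh)); first by rewrite lee_fin sqr_ge0.
    rewrite -EFinM lee_fin expr2 -!mulrA [N%:R^-1 * (N%:R * _)]mulrA mulVf ?gt_eqF// mul1r.
    by rewrite mulrC.
  - by move=> w _; rewrite lee_fin sqr_ge0.
  - by apply/measurable_EFinP; apply: measurable_funX; exact: measurable_sample_deviation.
have d0 h : (0 <= \int[P]_w (sample_deviation h xs w ^+ 2)%:E)%E.
  by apply: integral_ge0 => w _; rewrite lee_fin sqr_ge0.
have Kf := key f mf (le_trans (leeDl _ (d0 g)) Exs).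
have Kg := key g mg (le_trans (leeDr _ (d0 f)) Exs).
rewrite (fg xs c Dxs) in Kf; move: Kf Kg.
set a := Rintegral _ _ _; set b := Rintegral _ _ _; set b' := Rintegral _ _ _.
move=> Kf Kg; have -> : a - b' = (a - b) - (b' - b) by ring.
apply: (le_trans (ler_normB _ _)); rewrite (le_trans (lerD Kf Kg))//.
by rewrite /e le_eqVlt; apply/orP; left; apply/eqP; field.
Qed.

End sampling.

(** * Isotropic fields on the sphere *)

Section same_law.
Context {R : realType} d1 d2 d (T1 : measurableType d1) (T2 : measurableType d2)
  (E : measurableType d).
Context (P : probability T1 R) (X : T1 -> E) (Q : probability T2 R) (Y : T2 -> E).
Hypothesis mX : measurable_fun setT X.
Hypothesis mY : measurable_fun setT Y.
Hypothesis XY : same_law P X Q Y.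

Lemma same_law_ge0_integral (h : E -> \bar R) : measurable_fun setT h ->
  (forall x, 0 <= h x)%E -> (\int[P]_w h (X w) = \int[Q]_w h (Y w))%E.
Proof.
move=> mh h0.
have := ge0_integral_pushforward mX P measurableT mh (fun x _ => h0 x).
have := ge0_integral_pushforward mY Q measurableT mh (fun x _ => h0 x).
rewrite !preimage_setT => <- <-.
by apply: eq_measure_integral => A mA _; exact: XY.
Qed.

Lemma same_law_Rintegral (h : E -> R) : measurable_fun setT h ->
  P.-integrable setT (EFin \o (fun w => h (X w))) ->
  Q.-integrable setT (EFin \o (fun w => h (Y w))) ->
  \int[P]_w h (X w) = \int[Q]_w h (Y w).
Proof.
move=> mh iX iY.
have mEh : measurable_fun setT (EFin \o h) by exact/measurable_EFinP.
congr fine.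
have := @integral_pushforward _ _ _ _ _ _ mX P setT _ mEh.
have := @integral_pushforward _ _ _ _ _ _ mY Q setT _ mEh.
rewrite !preimage_setT => /(_ iY measurableT) <- /(_ iX measurableT) <-.
by apply: eq_measure_integral => A mA _; exact: XY.
Qed.

Lemma same_law_bounded_Rintegral (h : E -> R) : bounded_measurable h ->
  \int[P]_w h (X w) = \int[Q]_w h (Y w).
Proof.
move=> [mh [B hB]]; apply: same_law_Rintegral => //;
  apply: bounded_measurable_integrable; split;
  by [exact: measurableT_comp|exists B].
Qed.

End same_law.

Section isotropic_field.
Context {R : realType} d (Omega : measurableType d) (P : probability Omega R).
Context (T : Omega -> 'rV[R]_3 -> R).
Hypotheses (mT : jointly_measurable T) (vT : finite_variance P T) (iT : isotropic P T).

Local Notation S := (@sphere R 3).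
Local Notation sigma := (@surface_measure R 3).

Let mS : measurable S := @measurable_sphere R 3.

(** Extension by zero, so that measurability and integrals can be taken over the
    whole space. *)
Definition sphere_cut (f : 'rV[R]_3 -> R) x : R := if x \in S then f x else 0.

Lemma sphere_cutE f x : S x -> sphere_cut f x = f x.
Proof. by rewrite /sphere_cut => /mem_set ->. Qed.

Lemma sphere_cut0 f x : ~ S x -> sphere_cut f x = 0.
Proof. by rewrite /sphere_cut => nSx; case: ifPn => // /set_mem. Qed.

Lemma measurable_sphere_cut f : measurable_fun S f -> measurable_fun setT (sphere_cut f).
Proof. by move=> mf; apply/(measurable_restrictT _ mS). Qed.

Definition field_cut w x := sphere_cut (T w) x.

Lemma measurable_field_cut :
  measurable_fun setT (fun z : Omega * 'rV[R]_3 => field_cut z.1 z.2).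
Proof.
have mD : measurable ([set: Omega] `*` S) by exact: measurableX.
have /(measurable_restrictT _ mD) := mT.
apply: eq_measurable_fun => -[w x] _; rewrite patchE /field_cut /sphere_cut/=.
by rewrite in_setX/= in_setT.
Qed.

Lemma measurable_field_at x : S x -> measurable_fun setT (fun w => T w x).
Proof.
move=> Sx; have := measurable_sample measurable_field_cut x.
by apply: eq_measurable_fun => w _; rewrite /field_cut sphere_cutE.
Qed.

Lemma Rintegral_sphere_cut (h h' : 'rV[R]_3 -> R) : (forall x, S x -> h x = h' x) ->
  (forall x, ~ S x -> h' x = 0) -> \int[sigma]_(x in S) h x = \int[sigma]_x h' x.
Proof.
move=> hS h0; rewrite Rintegral_mkcond; apply: eq_Rintegral => x _.
rewrite patchE; case: ifPn => [/set_mem/hS //|/negP xS].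
by rewrite h0// => /mem_set.
Qed.

Lemma sphere_rotate (g : 'M[R]_3) x : orthogonalmx g -> S (x *m g) <-> S x.
Proof. by move=> og; rewrite /sphere/= enorm_orthogonal. Qed.

(** A finite linear combination of values of the field is measurable for the
    product sigma-algebra on which isotropy compares the laws. *)
Lemma isotropic_comb (g : 'M[R]_3) (xs : seq 'rV[R]_3) (c : 'rV[R]_3 -> R) :
  SO g -> (forall x, x \in xs -> S x) ->
  same_law P (fun w => \sum_(x <- xs) c x * T w (rotate g x)) P
           (fun w => \sum_(x <- xs) c x * T w x).
Proof.
move=> SOg Sxs B mB.
apply: (iT SOg (B := [set f | B (\sum_(x <- xs) c x * f x)])).
pose G := [set B : set ('rV[R]_3 -> R) | exists x (A : set R),
  [/\ S x, measurable A & B = [set f | A (f x)]]].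
have mcoord x : S x -> measurable_fun [set: g_sigma_algebraType G] (fun f => f x).
  move=> Sx _ A mA; rewrite setTI; apply: sub_sigma_algebra.
  by exists x, A.
have msum : measurable_fun [set: g_sigma_algebraType G]
    (fun f => \sum_(x <- xs) c x * f x).
  elim: xs Sxs => [_|x xs IH Sxs].
    by apply: (eq_measurable_fun (fun _ : g_sigma_algebraType G => 0 : R)) => // f _; rewrite big_nil.
  apply: (eq_measurable_fun (fun f : g_sigma_algebraType G =>
    c x * f x + \sum_(x <- xs) c x * f x)) => [f _|]; first by rewrite big_cons.
  apply: measurable_funD; last first.
    by apply: IH => y yxs; apply: Sxs; rewrite inE yxs orbT.
  apply: measurable_funM => //; apply: mcoord.
  by apply: Sxs; rewrite inE eqxx.
by have := msum measurableT B mB; rewrite setTI.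
Qed.


(** Isotropy makes the second moment constant on the sphere. *)
Lemma field_second_moment : exists K : R, forall x,
  (\int[P]_w (field_cut w x ^+ 2)%:E <= K%:E)%E.
Proof.
pose x0 : 'rV[R]_3 := delta_mx ord0 ord0.
have Sx0 : S x0 by exact: sphere_delta.
have := vT Sx0; rewrite unlock => Vfin.
set V := (\int[P]_w _)%E in Vfin.
have V0 : (0 <= V)%E by apply: integral_ge0 => w _; rewrite lee_fin sqr_ge0.
exists (fine V) => x; rewrite fineK ?ge0_fin_numE//.
have [Sx|Sx] := pselect (S x); last first.
  by under eq_integral do rewrite /field_cut sphere_cut0// expr0n/=; rewrite integral0.
have [g SOg gx0] := sphere_orbit (isT : (1 < 3)%N) Sx0 Sx.
have L : same_law P (fun w => T w x) P (fun w => T w x0).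
  move=> B mB; have S1 y : y \in [:: x0] -> S y by rewrite inE => /eqP ->.
  have := isotropic_comb (fun=> 1) SOg S1 mB.
  under eq_fun do rewrite big_seq1 mul1r gx0.
  move=> ->; congr (pushforward P _ B).
  by apply/funext => w; rewrite big_seq1 mul1r.
have h0 : measurable_fun setT (fun t : R => (t ^+ 2)%:E).
  by apply/measurable_EFinP; exact: measurable_funX.
have := same_law_ge0_integral (measurable_field_at Sx) (measurable_field_at Sx0) L h0.
have -> : (\int[P]_w (field_cut w x ^+ 2)%:E = \int[P]_w (T w x ^+ 2)%:E)%E.
  by apply: eq_integral => w _; rewrite /field_cut sphere_cutE.
by move=> ->// t; rewrite lee_fin sqr_ge0.
Qed.

(** For [g = 1] its integral is a coefficient of the field, for [g] a rotation one
    of the rotated field. *)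
Definition weighted_field (g : 'M[R]_3) (y : 'rV[R]_3 -> R) w x : R :=
  field_cut w (x *m g) * sphere_cut y x.

Lemma measurable_weighted_field g y : measurable_fun S y ->
  measurable_fun setT (fun z : Omega * 'rV[R]_3 => weighted_field g y z.1 z.2).
Proof.
move=> my; apply: measurable_funM; last first.
  exact: (measurableT_comp (measurable_sphere_cut my) measurable_snd).
apply: (measurableT_comp measurable_field_cut
  (g := fun z : Omega * 'rV[R]_3 => (z.1, z.2 *m g))).
apply/measurable_fun_pairP; split => /=; first exact: measurable_fst.
exact: (measurableT_comp (measurable_mulmx g) measurable_snd).
Qed.

(** Tonelli: the second moment of the field is bounded, and so is the weight. *)
Lemma weighted_field_square g (y : 'rV[R]_3 -> R) B : measurable_fun S y ->
  (forall x, S x -> y x ^+ 2 <= B) ->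
  (\int[P]_w \int[sigma]_x (weighted_field g y w x ^+ 2)%:E < +oo)%E.
Proof.
move=> my yB; have [K EK] := field_second_moment.
have mF2 : measurable_fun setT (fun z : Omega * 'rV[R]_3 =>
    (weighted_field g y z.1 z.2 ^+ 2)%:E).
  by apply/measurable_EFinP; apply: measurable_funX; exact: measurable_weighted_field.
rewrite (@fubini_tonelli _ _ _ _ _ P sigma _ mF2); last first.
  by move=> z; rewrite lee_fin sqr_ge0.
have B0 : 0 <= Num.max B 0 by rewrite le_max lexx orbT.
apply: (@le_lt_trans _ _ (\int[sigma]_x (Num.max B 0 * K)%:E)%E); last first.
  rewrite integral_cst// ltey_eq fin_numM//; exact: fin_num_measure.
apply: ge0_le_integral => //.
- by move=> x _; apply: integral_ge0 => w _; rewrite lee_fin sqr_ge0.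
- apply: (@measurable_fun_fubini_tonelli_G _ _ _ _ _ P _ mF2) => z.
  by rewrite lee_fin sqr_ge0.
move=> x _; rewrite /weighted_field/=.
under eq_integral do rewrite exprMn mulrC EFinM.
have sy0 : sphere_cut y x ^+ 2 <= Num.max B 0.
  have [Sx|Sx] := pselect (S x).
    by rewrite sphere_cutE// le_max yB.
  by rewrite sphere_cut0// expr0n.
have mFx : measurable_fun setT (fun w => (field_cut w (x *m g) ^+ 2)%:E).
  apply/measurable_EFinP; apply: measurable_funX.
  exact: (measurable_sample measurable_field_cut).
rewrite ge0_integralZl_EFin ?sqr_ge0//; last first.
  by move=> w _; rewrite lee_fin sqr_ge0.
have K0 : 0 <= K.
  rewrite -lee_fin (le_trans _ (EK x))//.
  by apply: integral_ge0 => w _; rewrite lee_fin sqr_ge0.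
apply: (le_trans (lee_wpmul2l _ (EK _))); first by rewrite lee_fin sqr_ge0.
by rewrite -EFinM lee_fin ler_wpM2r.
Qed.

Lemma surface_measure_mass_gt0 : 0 < fine (sigma setT).
Proof.
rewrite fine_gt0//; apply/andP; split; last first.
  by rewrite ltey_eq fin_num_measure.
apply: (lt_le_trans (@surface_measure_sphere R 3 isT)).
by apply: le_measure => //; rewrite inE.
Qed.

(** Isotropy gives the hypothesis of [pathwise_integral_same_cos]. *)
Lemma rotated_field_same_cos g (y : 'rV[R]_3 -> R) B th : SO g -> measurable_fun S y ->
  (forall x, S x -> y x ^+ 2 <= B) ->
  \int[P]_w cos (pathwise_integral sigma (weighted_field g^T y) w + th) =
  \int[P]_w cos (pathwise_integral sigma (weighted_field 1%:M y) w + th).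
Proof.
move=> SOg my yB; have mw g' := measurable_weighted_field g' my.
apply: (@pathwise_integral_same_cos _ _ _ _ _ P sigma _ _ S th) => //.
- exact: weighted_field_square my yB.
- exact: weighted_field_square my yB.
- exact: surface_measure_mass_gt0.
- exact: surface_measure_sphereC.
move=> xs c Sxs.
have L := isotropic_comb (fun x => c * y x) SOg Sxs.
have og : orthogonalmx g^T by apply: orthogonalT; case: SOg.
have msum (g' : 'M[R]_3) : orthogonalmx g' ->
    measurable_fun setT (fun w => \sum_(x <- xs) c * y x * T w (x *m g')).
  move=> og'; elim: xs Sxs {L} => [_|x xs IH Sxs].
    by under eq_fun do rewrite big_nil; exact: measurable_cst.
  under eq_fun do rewrite big_cons.
  apply: measurable_funD; last first.
    by apply: IH => x' x'xs; apply: Sxs; rewrite inE x'xs orbT.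
  apply: measurable_funM => //; apply: measurable_field_at; apply/sphere_rotate => //.
  by apply: Sxs; rewrite inE eqxx.
have sumE (g' : 'M[R]_3) w : orthogonalmx g' ->
    c * \sum_(x <- xs) weighted_field g' y w x = \sum_(x <- xs) c * y x * T w (x *m g').
  move=> og'; rewrite mulr_sumr !big_seq; apply: eq_bigr => x /Sxs Sx.
  rewrite /weighted_field /field_cut !sphere_cutE//; last exact/sphere_rotate.
  by rewrite -mulrA [y x * _]mulrC.
have bc : bounded_measurable (fun t : R => cos (t + th)).
  exact: (@bounded_measurable_cos _ _ _ id).
have m1 := msum _ og; have o1 : orthogonalmx (1%:M : 'M[R]_3) by exact: orthogonal1.
have m2 : measurable_fun setT (fun w => \sum_(x <- xs) c * y x * T w x).
  by have := msum _ o1; under eq_fun do under eq_bigr do rewrite mulmx1.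
have := same_law_bounded_Rintegral m1 m2 L bc.
rewrite (_ : \int[P]_w _ = \int[P]_w cos (c * \sum_(x <- xs) weighted_field g^T y w x + th)).
  move=> ->; apply: eq_Rintegral => w _; rewrite sumE//.
  by under [in RHS]eq_bigr do rewrite mulmx1.
by apply: eq_Rintegral => w _; rewrite sumE.
Qed.

(** * Symmetries of the law of the coefficients *)

Section coefficients.
Context (l : nat) (Y : 'I_(2 * l).+1 -> 'rV[R]_3 -> R).
Hypothesis hY : orthonormal_harmonic_basis l Y.

Local Notation n := (2 * l).+1.
Local Notation a := (harmonic_coef T Y).
Local Notation hv := (harmonic_vector Y).

Lemma harmonic_coefE w m :
  a w ord0 m = pathwise_integral sigma (weighted_field 1%:M (Y m)) w.
Proof.
rewrite mxE; apply: Rintegral_sphere_cut => x Sx; rewrite /weighted_field mulmx1.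
  by rewrite /field_cut !sphere_cutE.
by rewrite (sphere_cut0 (Y m))// mulr0.
Qed.

Lemma measurable_harmonic_coef : measurable_fun setT a.
Proof.
apply: measurable_fun_rV => m; under eq_fun do rewrite harmonic_coefE.
apply: measurable_pathwise_integral; apply: measurable_weighted_field.
exact: measurable_basis hY m.
Qed.

Lemma basis_bounded : exists B, forall m x, S x -> Y m x ^+ 2 <= B.
Proof.
have [K K0 hK] := harmonic_vector_norm hY; exists K => m x Sx; rewrite -(hK x Sx).
by rewrite /dot (bigD1 m)//= mxE -expr2 lerDl sumr_ge0// => i _; rewrite -expr2 sqr_ge0.
Qed.

Lemma measurable_basis_comb xi : measurable_fun S (fun x => dot xi (hv x)).
Proof.
apply: measurable_sum => m; apply: measurable_funM => //.
under eq_fun do rewrite mxE; exact: measurable_basis hY m.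
Qed.

(** Linearity of the integral, which only holds for the paths that are
    integrable against every basis function. *)
Lemma dot_harmonic_coef xi : {ae P, forall w, dot xi (a w) =
  pathwise_integral sigma (weighted_field 1%:M (fun x => dot xi (hv x))) w}.
Proof.
have [B YB] := basis_bounded.
have mY m := measurable_basis hY m.
have good m : {ae P, forall w, sigma.-integrable setT
    (EFin \o (fun x => weighted_field 1%:M (Y m) w x ^+ 2))}.
  apply: ae_square_integrable; first exact: measurable_weighted_field.
  by apply: weighted_field_square => //; exact: YB.
have := filter_forall (ae_filter_ringOfSetsType P) good; apply: filterS => w gw.
have iw m : sigma.-integrable setT (EFin \o (weighted_field 1%:M (Y m) w)).
  apply: square_integrable_integrable (gw m).
  exact: (measurableT_comp (measurable_weighted_field 1%:M (mY m)) (pair1_measurable w)).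
rewrite /dot; under eq_bigr do rewrite harmonic_coefE.
rewrite /pathwise_integral; under eq_bigr do rewrite -RintegralZl//.
rewrite -Rintegral_sum//; last first.
  by move=> m; have := integrableZl measurableT (xi ord0 m) (iw m).
apply: eq_Rintegral => x _; rewrite /weighted_field /sphere_cut; case: ifPn => _.
  by rewrite mulr_sumr; apply: eq_bigr => m _; rewrite mxE mulrCA.
by rewrite mulr0 big1// => m _; rewrite !mulr0.
Qed.

Lemma charfun_coefE xi th : charfun P a xi th = \int[P]_w cos
  (pathwise_integral sigma (weighted_field 1%:M (fun x => dot xi (hv x))) w + th).
Proof.
have mc (h : Omega -> R) : measurable_fun setT h ->
    measurable_fun setT (fun w => (cos (h w + th))%:E).
  by move=> mh; apply/measurable_EFinP; case: (bounded_measurable_cos th mh).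
congr fine; apply: ae_eq_integral => //.
- by apply: mc; apply: (measurableT_comp (measurable_dotr xi)); exact: measurable_harmonic_coef.
- apply: mc; apply: measurable_pathwise_integral; apply: measurable_weighted_field.
  exact: measurable_basis_comb.
by have := dot_harmonic_coef xi; apply: filterS => w -> _.
Qed.

Lemma integrable_coef_square :
  P.-integrable setT (EFin \o (fun w => dot (a w) (a w))).
Proof.
have [B YB] := basis_bounded.
rewrite /dot; apply: integrable_sum_fin => // m.
have my := measurable_basis hY m.
apply/integrableP; split.
  by apply/measurable_EFinP; apply: measurable_funM;
    apply: measurable_fun_coord; exact: measurable_harmonic_coef.
under eq_integral do rewrite /= harmonic_coefE -expr2 ger0_norm ?sqr_ge0//.
apply: pathwise_integral_square; first exact: measurable_weighted_field.
  by apply: weighted_field_square => //; exact: YB.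
exact: surface_measure_mass_gt0.
Qed.

(** Rotating the field amounts to rotating the weight back, by invariance of the
    surface measure; the weight [<xi, Y(x)>] becomes [<xi D^T, Y(x)>]. *)
Lemma rotation_charfun_invariant g (D : 'M[R]_n) : SO g -> orthogonalmx D ->
  (forall x, S x -> hv (x *m g) = hv x *m D) -> charfun_invariant P a D.
Proof.
move=> SOg oD gD; rewrite -[D]trmxK; apply: charfun_invariantT.
have og : orthogonalmx g by case: SOg.
split=> [|xi th]; first exact: orthogonalT.
have [K K0 hK] := harmonic_vector_norm hY.
rewrite !charfun_coefE.
have yB x : S x -> dot xi (hv x) ^+ 2 <= dot xi xi * K.
  by move=> Sx; rewrite -(hK x Sx); exact: cauchy_schwarz.
apply: etrans (rotated_field_same_cos th SOg (measurable_basis_comb xi) yB).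
apply: eq_Rintegral => w _; congr (cos (_ + _)).
pose h := weighted_field 1%:M (fun x => dot (xi *m D^T) (hv x)) w.
have mh : measurable_fun setT h.
  exact: (measurableT_comp (measurable_weighted_field 1%:M (measurable_basis_comb _))
    (pair1_measurable w)).
transitivity (\int[sigma]_(x in S) h x).
  apply/esym/Rintegral_sphere_cut => // x Sx.
  by rewrite /weighted_field [sphere_cut _ x]sphere_cut0// mulr0.
transitivity (\int[sigma]_(x in S) h (x *m g^T)).
  congr fine; apply/esym.
  apply: (@integral_sphere_orthogonal _ 3 g^T (EFin \o h)) => //.
    exact: orthogonalT.
  by apply/measurable_EFinP; exact: measurable_funTS.
apply: Rintegral_sphere_cut => x Sx; last first.
  by rewrite /weighted_field [sphere_cut _ x]sphere_cut0// mulr0.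
have Sxg : S (x *m g^T) by apply/sphere_rotate => //; exact: orthogonalT.
rewrite /h /weighted_field mulmx1 !sphere_cutE//; congr (_ * _).
have -> : hv x = hv (x *m g^T) *m D by rewrite -gD// -mulmxA (orthogonalC og) mulmx1.
by rewrite dot_mulmx trmxK.
Qed.

Lemma exchangeable_charfun_invariant : exchangeable P a ->
  forall s : 'S_n, charfun_invariant P a (perm_mx s).
Proof.
move=> ex s; split=> [|xi th].
  by rewrite /orthogonalmx tr_perm_mx -perm_mxM mulgV perm_mx1.
have ma := measurable_harmonic_coef.
have mcol : measurable_fun setT (fun w => col_perm s (a w)).
  under eq_fun do rewrite col_perm_mulmx.
  exact: (measurableT_comp (measurable_mulmx _) ma).
have := same_law_bounded_Rintegral mcol ma (ex s) (bounded_measurable_wave xi th).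
rewrite /charfun /wave => <-; apply: eq_Rintegral => w _.
by rewrite col_perm_mulmx dot_mulmx tr_perm_mx.
Qed.

Lemma harmonic_orbit x0 x : S x0 -> S x ->
  exists2 D : 'M[R]_n, charfun_invariant P a D & hv x = hv x0 *m D.
Proof.
move=> S0 Sx; have [g [og dg] <-] := sphere_orbit (isT : (1 < 3)%N) S0 Sx.
have SOgT : SO g^T by split; [exact: orthogonalT|rewrite det_tr].
have [D oD gD] := rotation_matrix hY (proj1 SOgT).
by exists D; [exact: rotation_charfun_invariant SOgT oD gD|exact: gD].
Qed.

Let x0 : 'rV[R]_3 := delta_mx ord0 ord0.

Let Sx0 : S x0 := sphere_delta ord0.

Let ones : 'rV[R]_n := const_mx 1.

Let ones_neq0 : ones != 0.
Proof. by apply/eqP => /rowP/(_ ord0); rewrite !mxE => /eqP; rewrite oner_eq0. Qed.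

(** If there were finitely many symmetries, [<u, Y(x)>] would take finitely many
    values, as [Y(x) = Y(x0) D] with [D] a symmetry. *)
Lemma infinite_charfun_invariant : (0 < l)%N -> infinite_set (charfun_invariant P a).
Proof.
move=> l0 finH; apply: (harmonic_comb_infinite_range hY l0 ones_neq0).
apply: sub_finite_set (finite_image (fun D => dot ones (hv x0 *m D)) finH).
by move=> _ [x Sx <-]; have [D HD ->] := harmonic_orbit Sx0 Sx; exists D.
Qed.

(** If every symmetry preserved the line of [u = (1, ..., 1)], it would map [u] to
    [u] or [-u], and [<u, Y(x)> = <u D^T, Y(x0)>] would take at most two
    values. *)
Lemma charfun_invariant_moves_ones : (0 < l)%N ->
  exists g i j, charfun_invariant P a g /\ (ones *m g) ord0 i != (ones *m g) ord0 j.
Proof.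
move=> l0; apply: contrapT => noD; apply: (harmonic_comb_infinite_range hY l0 ones_neq0).
pose v := dot ones (hv x0).
apply: (@sub_finite_set _ _ [set v; - v]); last exact: finite_set2.
move=> _ [x Sx <-]; have [D HD ->] := harmonic_orbit Sx0 Sx.
have HDT := charfun_invariantT HD.
rewrite dotC dot_mulmx dotC.
have DE : ones *m D^T = (ones *m D^T) ord0 ord0 *: ones.
  apply/rowP => i; rewrite [RHS]mxE [X in _ * X]mxE mulr1.
  apply/eqP; rewrite -[_ == _]negbK; apply/negP => ne.
  by apply: noD; exists D^T, i, ord0.
move: DE; set t := (_ *m _) ord0 ord0 => DE.
have tt : t ^+ 2 = 1.
  have := dot_orthogonal ones ones (charfun_invariant_orthogonal HDT).
  rewrite DE dotZl dotZr mulrA -expr2 -[RHS]mul1r => /mulIf -> //.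
  by rewrite dot_eq0.
rewrite DE dotZl -/v; move/eqP: tt; rewrite sqrf_eq1 => /orP[]/eqP ->.
  by left; rewrite /= mul1r.
by right; rewrite /= mulN1r.
Qed.

Lemma coef_charfun_radial : (0 < l)%N -> exchangeable P a ->
  forall x y th, dot x x = dot y y -> charfun P a x th = charfun P a y th.
Proof.
move=> l0 ex; apply: charfun_radial.
- exact: measurable_harmonic_coef.
- exact: integrable_coef_square.
- by rewrite ltnS leq_pmulr.
- exact: infinite_charfun_invariant.
- exact: exchangeable_charfun_invariant.
- exact: charfun_invariant_moves_ones.
Qed.

End coefficients.

End isotropic_field.

(** * Laws with radial cosine transform *)

Section law_charfun.
Context {R : realType} d1 d2 (T1 : measurableType d1) (T2 : measurableType d2).
Context (P : probability T1 R) (Q : probability T2 R) (n : nat).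
Context (X : T1 -> 'rV[R]_n) (Y : T2 -> 'rV[R]_n).
Hypotheses (mX : measurable_fun setT X) (mY : measurable_fun setT Y).

Lemma charfun_same_law : (forall xi th, charfun P X xi th = charfun Q Y xi th) ->
  same_law P X Q Y.
Proof.
move=> XY; pose X' : {mfun T1 >-> 'rV[R]_n} := HB.pack X (isMeasurableFun.Build _ _ _ _ X mX).
pose Y' : {mfun T2 >-> 'rV[R]_n} := HB.pack Y (isMeasurableFun.Build _ _ _ _ Y mY).
apply: (@charfun_unique _ _ (distribution P X') (distribution Q Y')) => xi th.
have [mw [B hB]] := bounded_measurable_wave xi th.
have mEw : measurable_fun setT (EFin \o wave xi th) by exact/measurable_EFinP.
have charfunE d0 (T0 : measurableType d0) (P0 : probability T0 R)
    (Z : {mfun T0 >-> 'rV[R]_n}) :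
    \int[distribution P0 Z]_x wave xi th x = charfun P0 Z xi th.
  have mZ : measurable_fun setT Z by [].
  congr fine; rewrite (@integral_pushforward _ _ _ _ _ _ mZ P0 setT _ mEw) ?preimage_setT//.
  apply: bounded_measurable_integrable; split; first exact: measurableT_comp.
  by exists B.
by rewrite !charfunE XY.
Qed.

End law_charfun.

(** The normalized surface measure, which the cone construction makes a measure
    on all of R^n that is carried by the sphere. *)
Lemma exists_sphere_uniform {R : realType} n : (0 < n)%N ->
  exists U : probability 'rV[R]_n R, forall B : set 'rV[R]_n, measurable B ->
    U B = (fine (surface_measure B) / fine (surface_measure (@sphere R n)))%:E.
Proof.
move=> n0; set M := fine (surface_measure (@sphere R n)).
have M0 : 0 < M.
  rewrite fine_gt0// surface_measure_sphere//=.
  by rewrite ltey_eq fin_num_measure//; exact: measurable_sphere.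
have M0' : 0 <= M^-1 by rewrite invr_ge0 ltW.
pose m := mscale (NngNum M0') (@surface_measure R n).
have mE (B : set 'rV[R]_n) : measurable B -> m B = (fine (surface_measure B) / M)%:E.
  move=> mB; rewrite /m /mscale/= mulrC EFinM fineK//; exact: fin_num_measure.
have m1 : m setT = 1%E.
  rewrite mE//; congr EFin; rewrite (_ : surface_measure setT = surface_measure (@sphere R n)).
    by rewrite mulfV// gt_eqF.
  rewrite -(setvU (@sphere R n)) setUC measureU//.
  - by rewrite [X in (_ + X)%E]surface_measure_sphereC adde0.
  - exact: measurable_sphere.
  - by apply: measurableC; exact: measurable_sphere.
  - by rewrite setICr.
pose U : probability 'rV[R]_n R := HB.pack m (Measure_isProbability.Build _ _ _ m m1).
by exists U.
Qed.

Section radial_law.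
Context {R : realType} d (Omega : measurableType d) (P : probability Omega R).
Context (n : nat) (X : Omega -> 'rV[R]_n).
Hypothesis mX : measurable_fun setT X.
Hypothesis radial : forall x y th, dot x x = dot y y -> charfun P X x th = charfun P X y th.

Lemma radial_same_law g : orthogonalmx g -> same_law P (fun w => X w *m g) P X.
Proof.
move=> og; apply: charfun_same_law => // [|xi th].
  exact: (measurableT_comp (measurable_mulmx g) mX).
rewrite (radial (y := xi *m g^T)); last by rewrite dot_orthogonal//; exact: orthogonalT.
by apply: eq_Rintegral => w _; rewrite dotC dot_mulmx dotC.
Qed.

Lemma radial_rotationally_invariant : rotationally_invariant P X.
Proof.
by move=> g [og _]; apply: radial_same_law; exact: orthogonalT.
Qed.

(** Condition on [X]. The vectors [|X| xi] and [|xi| X] have the same norm, so by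
    invariance of [U] the variables [|X| <xi, u>] and [|xi| <X, u>] have the same
    law under [U]. Exchanging the integrals, [E cos (<|xi| u, X> + th)] is
    [E cos (<xi, X> + th)] for every unit vector [u], by hypothesis. *)
Lemma radial_polar_law (U : probability 'rV[R]_n R) :
  (forall g A, orthogonalmx g -> measurable A -> U ((fun x => x *m g) @^-1` A) = U A) ->
  U (~` @sphere R n) = 0%E ->
  same_law P X (P \x U)%E (fun z => enorm (X z.1) *: z.2).
Proof.
move=> Uinv U0.
have mEX : measurable_fun setT (fun w => enorm (X w)).
  by apply: (measurableT_comp (@measurable_enorm R n)) mX.
have mpolar : measurable_fun setT (fun z : Omega * 'rV[R]_n => enorm (X z.1) *: z.2).
  apply: measurable_scalerV; last exact: measurable_snd.
  exact: (measurableT_comp mEX measurable_fst).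
apply: charfun_same_law => // xi th.
(* Adding 1 makes the integrand nonnegative, so that Tonelli's theorem applies. *)
pose F (t : R) := (1 + cos (t + th))%:E.
have mF : measurable_fun setT F.
  apply/measurable_EFinP; apply: measurable_funD => //.
  by case: (@bounded_measurable_cos _ _ _ id th (@measurable_id _ _ _)).
have F0 t : (0 <= F t)%E.
  by rewrite lee_fin; have := cos_max (t + th); rewrite ler_norml => /andP[]; lra.
have charF d0 (T0 : measurableType d0) (P0 : probability T0 R) (Z : T0 -> 'rV[R]_n) v :
    measurable_fun setT Z ->
    (\int[P0]_w F (dot v (Z w)) = (1 + charfun P0 Z v th)%:E)%E.
  move=> mZ.
  have ib : P0.-integrable setT (EFin \o (fun w => cos (dot v (Z w) + th))).
    apply: bounded_measurable_integrable; apply: bounded_measurable_cos.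
    exact: (measurableT_comp (measurable_dotr v)).
  have i1 : P0.-integrable setT (EFin \o (fun=> 1)) by exact: finite_measure_integrable_cst.
  have i2 := integrableD measurableT i1 ib.
  rewrite -[LHS]fineK ?(integrable_fin_num _ i2)//; congr EFin.
  rewrite -[LHS]/(\int[P0]_w (1 + cos (dot v (Z w) + th))) RintegralD//; congr (_ + _).
  by rewrite Rintegral_cst// mul1r (congr1 fine (probability_setT P0)).
have radialF v v' : dot v v = dot v' v' -> (\int[P]_w F (dot v (X w)) = \int[P]_w F (dot v' (X w)))%E.
  by move=> vv'; rewrite !charF// (radial th vv').
suff : (\int[P]_w F (dot xi (X w)) =
    \int[P \x U]_z F (dot xi (enorm (X z.1) *: z.2)))%E.
  by rewrite (charF _ _ P X)// (charF _ _ (P \x U)%E)// => -[/addrI].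
have msq r v : measurable_fun setT (fun x : 'rV[R]_n => F (r * dot v x)).
  apply: (measurableT_comp mF); apply: measurable_funM => //; exact: measurable_dotr.
have UF g h : orthogonalmx g -> measurable_fun setT h -> (forall x, 0 <= h x)%E ->
    (\int[U]_x h (x *m g) = \int[U]_x h x)%E.
  move=> og mh h0.
  apply: (same_law_ge0_integral (P := U) (Q := U) (X := fun x => x *m g) (Y := id)) => //.
  - exact: measurable_mulmx.
  - by move=> A mA; exact: Uinv.
have mG : measurable_fun setT (fun z : Omega * 'rV[R]_n => F (dot (enorm xi *: z.2) (X z.1))).
  apply: (measurableT_comp mF); apply: measurable_sum => i; apply: measurable_funM.
    apply: measurable_fun_coord; apply: measurable_scalerV => //; exact: measurable_snd.
  exact: (measurable_fun_coord i (measurableT_comp mX measurable_fst)).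
have mH : measurable_fun setT
    (fun z : Omega * 'rV[R]_n => F (dot xi (enorm (X z.1) *: z.2))).
  apply: (measurableT_comp mF); exact: (measurableT_comp (measurable_dotr xi) mpolar).
rewrite fubini_tonelli1//.
transitivity (\int[P]_w \int[U]_x F (dot (enorm xi *: x) (X w)))%E; last first.
  apply: eq_integral => w _; rewrite /fubini_F/=.
  have E : dot (enorm (X w) *: xi) (enorm (X w) *: xi) = dot (enorm xi *: X w) (enorm xi *: X w).
    by rewrite !(dotZl, dotZr) -!sqr_enorm; ring.
  have [g og gE] := orthogonal_transitive E.
  have -> : (\int[U]_x F (dot (enorm xi *: x) (X w)) =
      \int[U]_x F (enorm (X w) * dot xi (x *m g^T))%R)%E.
    apply: eq_integral => x _; congr F.
    by rewrite dotZl -dotZr -gE dotC -scalemxAl dotZl dot_mulmx.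
  rewrite (UF g^T (fun x => F (enorm (X w) * dot xi x)))//; last exact: orthogonalT.
  by apply: eq_integral => x _; rewrite dotZr.
rewrite (@fubini_tonelli _ _ _ _ _ P U _ mG)//=.
transitivity (\int[U]_x \int[P]_w F (dot xi (X w)))%E.
  have U1 : U setT = 1%E by exact: probability_setT.
  transitivity ((\int[P]_w F (dot xi (X w))) * U setT)%E; first by rewrite U1 mule1.
  exact/esym/integral_cst.
apply: ae_eq_integral => //.
  by apply: (@measurable_fun_fubini_tonelli_G _ _ _ _ _ P _ mG) => z.
exists (~` @sphere R n); split => //.
  by apply: measurableC; exact: measurable_sphere.
move=> x /= nx Sx; apply: nx => _; apply: radialF.
by rewrite dotZl dotZr (dot_sphere Sx) mulr1 -expr2 sqr_enorm.
Qed.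

Hypothesis X2 : P.-integrable setT (EFin \o (fun w => dot (X w) (X w))).

Let coord_integrable i j :
  P.-integrable setT (EFin \o (fun w => X w ord0 i * X w ord0 j)).
Proof.
move: X2; apply: le_integrable => //.
  by apply/measurable_EFinP; apply: measurable_funM; exact: measurable_fun_coord.
move=> w _; rewrite /= lee_fin [leRHS]ger0_norm ?dot_ge0//.
have ij k : X w ord0 k ^+ 2 <= dot (X w) (X w).
  by rewrite /dot (bigD1 k)//= -expr2 lerDl sumr_ge0// => k' _; rewrite -expr2 sqr_ge0.
have := ij i; have := ij j; set p := X w ord0 i; set q := X w ord0 j => hq hp.
by rewrite ler_norml; apply/andP; split; nra.
Qed.

(** A reflection in a coordinate changes the sign of the products [X_i X_j],
    [i != j], and a transposition exchanges [X_i^2] and [X_j^2]. Hence the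
    covariance matrix is scalar. *)
Lemma radial_covariance : (0 < n)%N -> exists C : R,
  (forall i j, ('E_P[fun w => (X w ord0 i * X w ord0 j)%R] = (C * (i == j)%:R)%:E)%E) /\
  ('E_P[fun w => (enorm (X w) ^+ 2)%R] = (n%:R * C)%:E)%E.
Proof.
move=> n0; pose c i j := \int[P]_w (X w ord0 i * X w ord0 j).
have cE i j : ('E_P[fun w => (X w ord0 i * X w ord0 j)%R] = (c i j)%:E)%E.
  by rewrite unlock /c fineK// (integrable_fin_num _ (coord_integrable i j)).
have inv g i j : orthogonalmx g ->
    c i j = \int[P]_w ((X w *m g) ord0 i * (X w *m g) ord0 j).
  move=> og; apply/esym.
  have mXg : measurable_fun setT (fun w => X w *m g).
    exact: (measurableT_comp (measurable_mulmx g) mX).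
  apply: (same_law_Rintegral mXg mX (radial_same_law og)
    (h := fun x => x ord0 i * x ord0 j)) => //.
    by apply: measurable_funM; exact: measurable_coord.
  rewrite (_ : _ \o _ = EFin \o (fun w => \sum_k \sum_k' g k i * g k' j * (X w ord0 k * X w ord0 k'))).
    apply: integrable_sum_fin => // k; apply: integrable_sum_fin => // k'.
    by have := integrableZl measurableT (g k i * g k' j) (coord_integrable k k').
  apply/funext => w /=; congr EFin; rewrite !mxE mulr_suml; apply: eq_bigr => k _.
  by rewrite mulr_sumr; apply: eq_bigr => k' _; ring.
have c0 i j : i != j -> c i j = 0.
  move=> ij; pose e : 'rV[R]_n := delta_mx ord0 i.
  have e0 : e != 0.
    by apply/eqP => /rowP/(_ i); rewrite !mxE !eqxx => /eqP; rewrite oner_eq0.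
  have eN : c i j = - c i j.
    rewrite [LHS](inv _ i j (orthogonal_reflection e0)) -[RHS]mulN1r -RintegralZl//.
    apply: eq_Rintegral => w _; rewrite !mul_reflection !dot_delta !mxE !eqxx (eq_sym j) (negbTE ij).
    by rewrite /= mulr0 mulr1 divr1; ring.
  by move: (c i j) eN => t; lra.
have cc i j : c i i = c j j.
  rewrite (inv (perm_mx (tperm i j)) i i); last first.
    by rewrite /orthogonalmx tr_perm_mx -perm_mxM mulgV perm_mx1.
  have E w : (X w *m perm_mx (tperm i j)) ord0 i = X w ord0 j.
    by rewrite -[tperm i j]invgK -col_permE mxE tpermV tpermL.
  by apply: eq_Rintegral => w _; rewrite E.
pose i0 := Ordinal n0.
exists (c i0 i0); split=> [i j|].
  rewrite cE; congr EFin; have [->|ij] := eqVneq i j; first by rewrite mulr1.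
  by rewrite mulr0 c0.
rewrite unlock; under eq_integral do rewrite sqr_enorm.
rewrite -[LHS]fineK ?(integrable_fin_num _ X2)//; congr EFin.
rewrite -[LHS]/(\int[P]_w (\sum_i X w ord0 i * X w ord0 i)) Rintegral_sum//.
rewrite (eq_bigr (fun=> c i0 i0)) => [|i _]; last exact: cc.
by rewrite sumr_const card_ord mulr_natl.
Qed.

End radial_law.

(** * Exchangeable coefficients *)

Theorem theorem3p1 (R : realType) (d : measure_display)
    (Omega : measurableType d) (P : probability Omega R)
    (T : Omega -> 'rV[R]_3 -> R)
    (mT : jointly_measurable T) (vT : finite_variance P T)
    (zT : zero_mean P T) (iT : isotropic P T)
    (l : nat) (l_ge1 : (1 <= l)%N)
    (Y : 'I_(2 * l).+1 -> 'rV[R]_3 -> R)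
    (hY : orthonormal_harmonic_basis l Y)
    (ex : exchangeable P (harmonic_coef T Y)) :
  rotationally_invariant P (harmonic_coef T Y) /\
  exists (d' : measure_display) (Omega' : measurableType d')
    (Q : probability Omega' R)
    (u : {RV Q >-> 'rV[R]_(2 * l).+1}) (eta : {RV Q >-> R}),
    [/\ uniform_on_sphere Q u,
        forall w, 0 <= eta w,
        independent Q eta u,
        ('E_Q[fun w => (eta w ^+ 2)%R]
           = ((2 * l).+1%:R * angular_power P T Y)%:E)%E &
        same_law P (harmonic_coef T Y) Q (fun w => eta w *: u w)].
Proof.
have ma := measurable_harmonic_coef mT hY.
have radial := coef_charfun_radial mT vT iT hY l_ge1 ex.
have a2 := integrable_coef_square mT vT iT hY.
split; first exact: radial_rotationally_invariant.
set a := harmonic_coef T Y in ma radial a2 *; set n := (2 * l).+1 in a ma radial a2 *.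
have [U UE] := exists_sphere_uniform (R := R) (isT : (0 < n)%N).
have mS := @measurable_sphere R n.
have U0 : U (~` @sphere R n) = 0%E.
  by rewrite UE ?surface_measure_sphereC ?mul0r//; exact: measurableC.
have Uinv g A : orthogonalmx g -> measurable A -> U ((fun x => x *m g) @^-1` A) = U A.
  move=> og mA; rewrite !UE ?surface_measure_orthogonal//.
  by have := measurable_mulmx g measurableT mA; rewrite setTI.
have [C [covE normE]] := radial_covariance ma radial a2 isT.
have powerE : angular_power P T Y = C.
  have /(_ ord0 ord0) := @getPex R [set C : R | forall m m',
    ('E_P[fun w => (a w ord0 m * a w ord0 m')%R] = (C * (m == m')%:R)%:E)%E]
    (ex_intro _ C covE).
  by rewrite covE eqxx !mulr1 => -[].
pose Q : probability (Omega * 'rV[R]_n)%type R := (P \x U)%E.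
have meta : measurable_fun setT (fun z : Omega * 'rV[R]_n => enorm (a z.1)).
  exact: (measurableT_comp (measurableT_comp (@measurable_enorm R n) ma) measurable_fst).
have mu : measurable_fun setT (fun z : Omega * 'rV[R]_n => z.2) by exact: measurable_snd.
pose u : {mfun (Omega * 'rV[R]_n)%type >-> 'rV[R]_n} :=
  HB.pack (fun z : Omega * 'rV[R]_n => z.2) (isMeasurableFun.Build _ _ _ _ _ mu).
pose eta : {mfun (Omega * 'rV[R]_n)%type >-> R} := HB.pack
  (fun z : Omega * 'rV[R]_n => enorm (a z.1)) (isMeasurableFun.Build _ _ _ _ _ meta).
exists _, _, Q, u, eta.
have mEa A : measurable A -> measurable ((fun w => enorm (a w)) @^-1` A).
  by move=> mA; have := measurableT_comp (@measurable_enorm R n) ma measurableT mA; rewrite setTI.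
have QE A B : measurable A -> measurable B -> Q (A `*` B) = (P A * U B)%E.
  by move=> mA mB; exact: product_measure1E.
have P1 : P setT = 1%E by exact: probability_setT.
have U1 : U setT = 1%E by exact: probability_setT.
split=> /=.
- move=> B mB; rewrite -UE// -[RHS]mul1e -P1 -QE//.
  by congr (Q _); rewrite setTX.
- by move=> w; exact: enorm_ge0.
- move=> A B mA mB; have mA' := mEa A mA.
  have -> : eta @^-1` A = ((fun w => enorm (a w)) @^-1` A) `*` setT by rewrite setXT.
  have -> : u @^-1` B = setT `*` B by rewrite setTX.
  rewrite -setXI setTI setIT (QE _ _ mA' mB) (QE _ _ mA' measurableT).
  by rewrite (QE _ _ measurableT mB) P1 U1 mul1e mule1.
- rewrite powerE -normE !unlock.
  rewrite (@fubini_tonelli1 _ _ _ _ _ P U (fun z => (enorm (a z.1) ^+ 2)%:E)); last first.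
  + by move=> z; rewrite lee_fin sqr_ge0.
  + by apply/measurable_EFinP; exact: measurable_funX.
  apply: eq_integral => w _; rewrite /fubini_F/=.
  transitivity ((enorm (a w) ^+ 2)%:E * U setT)%E; first exact: integral_cst.
  by rewrite U1 mule1.
- exact: radial_polar_law.
Qed.
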